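(* Let $n\ge 2$ and let $\mathcal{K}=\{K_t\}_{t\ge 0}$ be a family of knots in $S^3$ twisted along $n$ coherently oriented parallel strands. Define $$d_t(\mathcal{K}) = T^{tn(n-1)}\Big(T^{n(n-1)}\rho_1(K_{t+1})-\rho_1(K_t)\Big)\in\mathbb{Z}[T,T^{-1}].$$ Then as $t\to\infty$ the sequence $d_t(\mathcal{K})$ converges (stabilizes positively) to a rational function in $T$ that is not a polynomial. The limit, considered as a rational function, satisfies $$\Big(\lim_{t\to\infty} d_t(\mathcal{K})\Big)\Big|_{T=1}=\pm\frac{n-1}{2n}.$$
   Context: **Twisted families.** Let $K$ be an oriented knot in $S^3$ and $U\subset S^3$ an oriented disk meeting $K$ transversally in $n$ points, all of the same sign. Set $K_0=K$ and, for $t>0$, let $K_t$ be obtained from $K$ by inserting $t$ positive full twists in the $n$ parallel strands of $K$ in a regular neighborhood of $K\cap U$, i.e. inserting the braid $\Omega_n^t$, where $\Omega_n=(\sigma_1\sigma_2\cdots\sigma_{n-1})^n$ is the full twist in the $n$-strand braid group, all of whose crossings are positive. Such $\{K_t\}_{t\ge0}$ is a family of knots twisted along $n$ coherently oriented strands. **The invariant $\rho_1$.** Represent a knot $K$ by an upright long knot diagram $D$: an oriented immersed arc in the unit square with over/under information at transverse double points (crossings), entering at the bottom and leaving at the top, directed upward near its endpoints and such that near each crossing both intersecting pieces are directed upward. Let $\mathcal{C}$ be the set of crossings, $N=|\mathcal{C}|$. The strands are the components of $D-\mathcal{C}$, labeled consecutively $1,\dots,2N+1$ along the orientation. Let $\varphi_k\in\mathbb{Z}$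 be the turning number of strand $k$ (full counterclockwise turns minus full clockwise turns). Write a crossing $c$ as a triple $(\sigma,i,j)$: $\sigma=\pm1$ its sign, $i$ its incoming over-strand, $j$ its incoming under-strand; let $i^+=i+1$, $j^+=j+1$ be the outgoing over- and under-strands. Let $A$ be the $(2N+1)\times(2N+1)$ matrix over $\mathbb{Z}[T,T^{-1}]$ which is the sum over crossings $(\sigma,i,j)$ of the matrices whose only nonzero entries are $a_{i,i^+}=T^{\sigma}$, $a_{i,j^+}=1-T^{\sigma}$, $a_{j,j^+}=1$. Then $I-A$ is invertible over $\mathbb{Z}(T)$ (the field of rational functions); let $G=(g_{k\ell})=(I-A)^{-1}$. For $c=(\sigma,i,j)$ put $$R_1(c)=\sigma\big(g_{ji}(g_{j^+,j}+g_{j,j^+}-g_{ij})-g_{ii}(g_{j,j^+}-1)-\tfrac12\big).$$ With $\Delta_K$ the symmetrized Alexander polynomial, the perturbed Alexander invariant is $$\rho_1(K)=\Delta_K^2\Big(\sum_{c\in\mathcal{C}}R_1(c)-\sum_{k=1}^{2N+1}\varphi_k(g_{kk}-\tfrac12)\Big)\in\mathbb{Z}[T,T^{-1}],$$ which is a knot invariant. **Convergence.** For $p\in\mathbb{Z}[T,T^{-1}]$ let $(p)_r$ be the coefficient of $T^r$. A sequence $\{p_t\}$ in $\mathbb{Z}[T,T^{-1}]$ stabilizes positively if for every $r_0\in\mathbb{Z}$ there is $t_0$ such that $(p_t)_r=(p_{t_0})_r$ for all $t\ge t_0$ and all $r\le r_0$; its limit is the resulting formal Laurent series in $T$. Saying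 the limit is a rational function means that this Laurent series is the expansion at $T=0$ of a rational function. *)

(* Defs.v *)
From HB Require Import structures.
From mathcomp Require Import all_boot all_order all_algebra.
From mathcomp Require Import finmap.

Set Implicit Arguments.
Unset Strict Implicit.
Unset Printing Implicit Defensive.

Import Order.TTheory GRing.Theory Num.Theory.

(* Upright long knot diagrams, cut into horizontal layers read from bottom to
   top.  Between two layers the diagram meets a horizontal line in finitely
   many points, recorded from left to right by their orientations
   (true = upward).  A layer (k, q) applies the piece q at positions k, k + 1
   (counted from 0) and is vertical elsewhere. *)

Inductive piece :=
  (* Both strands go up and swap positions.  With [true] the strand going from
     bottom left to top right is the over-strand (positive crossing); with
     [false] the other one is (negative crossing). *)
  | Crossing of bool
  (* Local minimum; the boolean is the orientation of its left end. *)
  | Cup of bool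
  (* Local maximum. *)
  | Cap.

Definition layer := (nat * piece)%type.
Definition diagram := seq layer.

Definition layer_ok (st : seq bool) (x : layer) : bool :=
  let: (k, q) := x in
  match q with
  | Crossing _ => nth false st k && nth false st k.+1
  | Cup _ => k <= size st
  | Cap => (k.+1 < size st) && (nth false st k != nth false st k.+1)
  end.

Definition layer_out (st : seq bool) (x : layer) : seq bool :=
  let: (k, q) := x in
  match q with
  | Crossing _ => st
  | Cup b => take k st ++ [:: b; ~~ b] ++ drop k st
  | Cap => take k st ++ drop k.+2 st
  end.

Definition top_profile (D : diagram) : seq bool := foldl layer_out [:: true] D.
Definition profile (D : diagram) (l : nat) : seq bool := top_profile (take l D).

Definition well_formed (D : diagram) : Prop :=
  (forall l x, onth D l = Some x -> layer_ok (profile D l) x)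
  /\ top_profile D = [:: true].

(* The points (l, p): p-th point of the diagram on the horizontal line just
   below layer l (or on the top line if l = size D). *)
Definition points (D : diagram) : seq (nat * nat) :=
  [seq (l, p) | l <- iota 0 (size D).+1, p <- iota 0 (size (profile D l))].

(* The next point along the orientation, with the number of counterclockwise
   half turns made in between.  The top endpoint is sent to itself. *)
Definition step (D : diagram) (x : nat * nat) : (nat * nat) * int :=
  let: (l, p) := x in
  if nth false (profile D l) p then
    match onth D l with
    | None => (x, 0%R)
    | Some (k, Crossing _) =>
        ((l.+1, if p == k then k.+1 else if p == k.+1 then k else p), 0%R)
    | Some (k, Cup _) => ((l.+1, if p < k then p else p.+2), 0%R)
    | Some (k, Cap) =>
        if p == k then ((l, k.+1), (-1)%R)
        else if p == k.+1 then ((l, k), 1%R)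
        else ((l.+1, if p < k then p else p.-2), 0%R)
    end
  else
    match onth D l.-1 with
    | None => (x, 0%R)
    | Some (_, Crossing _) => ((l.-1, p), 0%R)
    | Some (k, Cup _) =>
        if p == k then ((l, k.+1), 1%R)
        else if p == k.+1 then ((l, k), (-1)%R)
        else ((l.-1, if p < k then p else p.-2), 0%R)
    | Some (k, Cap) => ((l.-1, if p < k then p else p.+2), 0%R)
    end.

Definition travel (D : diagram) : seq (nat * nat) :=
  traject (fun x => (step D x).1) (0, 0) (size (points D)).

(* The last condition says that there is only one component. *)
Definition upright_long_knot (D : diagram) : Prop :=
  well_formed D /\ {subset points D <= travel D}.

Definition enters_crossing (D : diagram) (x : nat * nat) : bool :=
  if onth D x.1 is Some (k, Crossing _) then (x.2 == k) || (x.2 == k.+1)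
  else false.

(* Strands are numbered 0, ..., 2N instead of 1, ..., 2N + 1. *)
Definition strand (D : diagram) (x : nat * nat) : nat :=
  count (enters_crossing D) (take (index x (travel D)) (travel D)).

(* The triples (sign, incoming over-strand, incoming under-strand). *)
Definition crossings (D : diagram) : seq (int * nat * nat) :=
  pmap (fun l =>
    match onth D l with
    | Some (k, Crossing true) => Some (1%R, strand D (l, k), strand D (l, k.+1))
    | Some (k, Crossing false) =>
        Some ((-1)%R, strand D (l, k.+1), strand D (l, k))
    | _ => None
    end) (iota 0 (size D)).

Local Open Scope ring_scope.

(* Twice the turning number of strand k. *)
Definition half_turns (D : diagram) (k : nat) : int :=
  \sum_(x <- travel D | strand D x == k) (step D x).2.

(* Z(T) *)
Notation ratfun := {fraction {poly int}}.
Definition T : ratfun := tofrac 'X.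

(* Z[T, T^-1]: a Laurent polynomial is its finitely supported family of
   coefficients, so that p r is the coefficient of T^r. *)
Notation laurent := {fsfun int -> int with 0%R}.
Definition ratfun_of (p : laurent) : ratfun :=
  \sum_(r <- finsupp p) (p r)%:~R * T ^ r.

Definition num_strands (D : diagram) : nat := (2 * size (crossings D)).+1.

Definition A_mx (D : diagram) : 'M[ratfun]_(num_strands D) :=
  \sum_(c <- crossings D)
    let: (s, i, j) := c in
    T ^ s *: delta_mx (inord i) (inord i.+1)
    + (1 - T ^ s) *: delta_mx (inord i) (inord j.+1)
    + delta_mx (inord j) (inord j.+1).

Definition G_mx (D : diagram) : 'M[ratfun]_(num_strands D) :=
  invmx (1%:M - A_mx D).
Definition g (D : diagram) (k l : nat) : ratfun := G_mx D (inord k) (inord l).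

Definition R1 (D : diagram) (c : int * nat * nat) : ratfun :=
  let: (s, i, j) := c in
  s%:~R * (g D j i * (g D j.+1 j + g D j j.+1 - g D i j)
           - g D i i * (g D j j.+1 - 1) - 1 / 2%:R).

(* The matrix 1 - A_mx D is the Fox matrix, with the column of the last
   generator removed, of the Wirtinger presentation of the knot group read
   from the diagram seen from behind; its determinant is thus an Alexander
   polynomial, defined up to a unit of Z[T, T^-1]. *)
Definition symmetrized_alexander (D : diagram) (p : laurent) : Prop :=
  [/\ exists (e : bool) (k : int),
        ratfun_of p = (-1) ^+ e * T ^ k * \det (1%:M - A_mx D),
      forall r : int, p (- r) = p r
    & \sum_(r <- finsupp p) p r = 1].

(* p is the perturbed Alexander invariant rho_1, as computed from D. *)
Definition perturbed_alexander (D : diagram) (p : laurent) : Prop :=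
  exists2 Delta : laurent, symmetrized_alexander D Delta &
    ratfun_of p = ratfun_of Delta ^+ 2 *
      (\sum_(c <- crossings D) R1 D c
       - \sum_(k < num_strands D)
           ((half_turns D k)%:~R / 2%:R) * (g D k k - 1 / 2%:R)).

(* (sigma_1 ... sigma_(n-1))^n on the strands at positions k, ..., k + n - 1. *)
Definition full_twist (k n : nat) : diagram :=
  flatten (nseq n [seq ((k + i)%N, Crossing true) | i <- iota 0 n.-1]).

(* The disk is a horizontal slice, between D1 and D2, of the n adjacent upward
   strands at positions k, ..., k + n - 1. *)
Definition twisted_family (n : nat) (K : nat -> diagram) : Prop :=
  exists (D1 D2 : diagram) (k : nat),
    [/\ upright_long_knot (D1 ++ D2),
        forall i, (i < n)%N -> nth false (top_profile D1) (k + i)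
      & forall t, K t = D1 ++ flatten (nseq t (full_twist k n)) ++ D2].

Definition stabilizes_positively (p : nat -> laurent) : Prop :=
  forall r0 : int, exists t0 : nat, forall (t : nat) (r : int),
    (t0 <= t)%N -> r <= r0 -> p t r = p t0 r.

Definition positive_limit (p : nat -> laurent) (s : int -> int) : Prop :=
  forall r0 : int, exists t0 : nat, forall (t : nat) (r : int),
    (t0 <= t)%N -> r <= r0 -> p t r = s r.

(* The formal Laurent series with coefficients s is the expansion at T = 0 of
   f = P / Q: the exponents are bounded below, and Q s = P. *)
Definition laurent_expansion (f : ratfun) (s : int -> int) : Prop :=
  (exists r0 : int, forall r, r < r0 -> s r = 0) /\
  exists P Q : {poly int},
    [/\ Q != 0, f = tofrac P / tofrac Q
      & forall r : int, \sum_(i < size Q) Q`_i * s (r - i%:Z)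
                        = if r is Posz m then P`_m else 0].

Definition has_value (f : ratfun) (a : int) (v : rat) : Prop :=
  exists P Q : {poly int},
    [/\ Q.[a] != 0, f = tofrac P / tofrac Q & v = P.[a]%:~R / Q.[a]%:~R].

(* Main.v *)
Require Import Defs.
From mathcomp Require Import all_boot all_order all_fingroup all_algebra.
From mathcomp Require Import finmap ring zify generic_quotient.
From Stdlib Require Import IndefiniteDescription.

Set Implicit Arguments.
Unset Strict Implicit.
Unset Printing Implicit Defensive.

Import Order.TTheory GRing.Theory Num.Theory.

(** The matrix [A] describes a random walk along the knot. At a crossing of sign
    [s] the walker on the over-strand goes on with weight [T ^ s] and falls to the
    outgoing under-strand with weight [1 - T ^ s]; otherwise the walk follows the
    orientation. So the entries of the inverse of [1 - A] are expected numbers of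
    visits, and they and [det (1 - A)] may be computed from any model of the walk.
    The states of [walk_mx] are all the points of the diagram, because points,
    unlike the numbering of strands, survive cutting and pasting. The passage
    between the models ([det_strands], [R1_green], [turning_sum]) is an elimination
    of states among which the walk cannot return ([det_elimination],
    [green_elimination]). At [T = 1] nobody falls: the determinant is one, and the
    number of visits from one point to another is one or zero according to their
    order along the knot ([hv_green]).

    Seen from outside, a braid acts on the walkers by its Burau matrix
    ([det_coupon], [green_last_copy]). For [t] full twists this matrix is
    [x + (1 - x) * mean] with [x = T ^ (n t)], where the mean is taken for the
    stationary weights [T ^ q / (1 + T + .. + T ^ (n - 1))]
    ([burau_act_twists]). As [t] grows, [x] tends T-adically to zero, and so all
    determinants and visits converge. More precisely, [delta t], that is [det (1 - A)] for
    the [t]-th diagram, is [delta 0 * det (1 + (1 - x) Z Gamma)], where [Z = 1 - mean] and [Gamma]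
    records the visits between the [n] points of the disc ([deltaE]). At [T = 1]
    the matrix [Gamma] is that of a strict total order, the order in which the knot
    crosses the disc. Hence the limit of the determinants has the value [1 / n]
    ([det_center_visits1]), and the factor that depends on [t] has the derivative
    [t n (n - 1) / 2] at [T = 1] ([jet1_det]). A symmetrized Alexander polynomial has
    derivative zero there, which fixes the unit in its definition: the product of
    [T ^ (t n (n - 1))] and of the square of the symmetrized polynomial is
    [q t = (T ^ m0 * delta t) ^+ 2], with [m0] independent of [t]
    ([alexander_square]).

    The sum over the crossings grows linearly in [t]. A crossing above [a] full
    twists and below [b] of them contributes [- 1 / 2] plus a polynomial in
    [T ^ (n a)] and [T ^ (n b)] without constant term, whose coefficients converge
    ([visits_bulk], [R1_of_bulk]): deep inside the twists the walkers are
    already stationary. Summing geometric series, the whole sum in the definition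
    of [rho_1] is [gamma t - t n (n - 1) / 2] with a convergent [gamma]
    ([R1_minus_turning]). Therefore [T ^ (t n (n - 1)) * rho_1] is
    [q t * (gamma t - t n (n - 1) / 2)], of which [d t] is the increment. It tends
    to [- (lim q) * n (n - 1) / 2] because [t * (q (t + 1) - q t)] tends to zero
    ([tends_increments]), and at [T = 1] this limit is
    [- (1 / n) ^ 2 * n (n - 1) / 2 = - (n - 1) / (2 n)]. This is not an integer, hence
    the limit is not a Laurent polynomial ([not_laurent]). Finally, T-adic
    convergence yields stabilization and the expansion of the limit
    ([stabilizes_of_tends], [limit_of_tends]). *)

(** * Travelling along a long knot *)

Notation pt := (nat * nat)%type.

Lemma uniq_points D : uniq (points D).
Proof.
rewrite /points; apply: allpairs_uniq_dep; rewrite ?iota_uniq //.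
  by move=> l _; apply: iota_uniq.
by move=> [l p] [l' p'] _ _ [-> ->].
Qed.

Lemma mem_points D (x : pt) :
  (x \in points D) = (x.1 <= size D)%N && (x.2 < size (profile D x.1))%N.
Proof.
case: x => l p; apply/allpairsPdep/idP.
  by case=> l0 [p0 [+ + [-> ->]]]; rewrite !mem_iota !add0n !ltnS /= => -> ->.
by move=> /andP[h1 h2]; exists l, p; split => //; rewrite mem_iota leq0n add0n ?ltnS.
Qed.

Lemma profile_cat_le D E l : (l <= size D)%N -> profile (D ++ E) l = profile D l.
Proof.
move=> lD; rewrite /profile /top_profile take_cat.
case: ltnP => // h; have -> : l = size D by apply/eqP; rewrite eqn_leq lD.
by rewrite subnn take0 cats0 take_size.
Qed.

Lemma profile_size D : profile D (size D) = top_profile D.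
Proof. by rewrite /profile take_size. Qed.

Lemma profileS D l x : onth D l = Some x ->
  profile D l.+1 = layer_out (profile D l) x.
Proof.
move=> h; have lD : (l < size D)%N by rewrite -onthTE h.
by rewrite /profile /top_profile (take_nth x lD) foldl_rcons (onth_nth x _ _ _ h).
Qed.

Section Travel.
Variable D : diagram.
Hypothesis D_knot : upright_long_knot D.

Definition next_pt (x : pt) : pt := (step D x).1.
Definition top_end : pt := (size D, 0).

Local Notation N := (size (points D)).

Lemma size_travel : size (travel D) = N.
Proof. exact: size_traject. Qed.

Lemma travel_uniq : uniq (travel D).
Proof.
have [_ sub] := D_knot; apply: leq_size_uniq sub _; first exact: uniq_points.
by rewrite size_travel.
Qed.

Lemma mem_travel : travel D =i points D.
Proof.
have [_ sub] := D_knot.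
have [_ h] := uniq_min_size (uniq_points D) sub (eq_leq size_travel).
by move=> x; rewrite h.
Qed.

Lemma profile_top : profile D (size D) = [:: true].
Proof. by have [[_ h] _] := D_knot; rewrite profile_size. Qed.

Lemma top_end_point : top_end \in points D.
Proof. by rewrite mem_points /= leqnn profile_top. Qed.

Lemma onth_top : onth D (size D) = None.
Proof. by rewrite onth_default. Qed.

Lemma next_pt_top_end : next_pt top_end = top_end.
Proof. by rewrite /next_pt /= profile_top /= onth_top. Qed.

Lemma points_gt0 : (0 < N)%N.
Proof. by move: top_end_point; case: (points D). Qed.

Definition nth_pt (i : nat) : pt := nth (0, 0) (travel D) i.
Definition idx (x : pt) : nat := index x (travel D).

Lemma nth_ptS i : (i.+1 < N)%N -> next_pt (nth_pt i) = nth_pt i.+1.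
Proof.
move=> h; rewrite /nth_pt !nth_traject //; last exact: ltnW.
Qed.

Lemma nth_ptK i : (i < N)%N -> idx (nth_pt i) = i.
Proof. by move=> h; rewrite /idx index_uniq ?size_travel // travel_uniq. Qed.

Lemma idxK x : x \in points D -> nth_pt (idx x) = x.
Proof. by rewrite -mem_travel => h; rewrite /nth_pt nth_index. Qed.

Lemma idx_lt x : x \in points D -> (idx x < N)%N.
Proof. by rewrite -mem_travel -index_mem size_travel. Qed.

Lemma nth_pt_mem i : (i < N)%N -> nth_pt i \in points D.
Proof. by move=> h; rewrite -mem_travel mem_nth ?size_travel. Qed.

Lemma nth_pt_last : nth_pt N.-1 = top_end.
Proof.
have := top_end_point; set e := top_end => he; have := idx_lt he; set i := idx e => iN.
have [lt|] := ltnP i.+1 N; last first.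
  move=> h; have -> : N.-1 = i by lia.
  by rewrite idxK.
have := nth_ptS lt; rewrite idxK // next_pt_top_end => /(congr1 idx).
by rewrite nth_ptK // -/e -/i => h; lia.
Qed.

Lemma nth_pt_top_end i : (i < N)%N -> (nth_pt i == top_end) = (i == N.-1).
Proof.
move=> iN; rewrite -nth_pt_last; have N0 := points_gt0.
apply/eqP/eqP => [/(congr1 idx)|->//]; rewrite !nth_ptK //; lia.
Qed.

Lemma pointP x : x \in points D -> exists2 i, (i < N)%N & x = nth_pt i.
Proof. by move=> xD; exists (idx x); [apply: idx_lt | rewrite idxK]. Qed.

Lemma idx_next_pt x : x \in points D -> x != top_end -> idx (next_pt x) = (idx x).+1.
Proof.
case/pointP => i iN ->; rewrite nth_pt_top_end // => ni.
by rewrite nth_ptS ?nth_ptK //; lia.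
Qed.

Lemma next_pt_mem x : x \in points D -> next_pt x \in points D.
Proof.
move=> xD; have [->|] := eqVneq x top_end.
  by rewrite next_pt_top_end top_end_point.
case/pointP: xD => i iN ->; rewrite nth_pt_top_end // => ni.
by rewrite nth_ptS ?nth_pt_mem //; lia.
Qed.

(** ** Strands *)

Local Notation enters := (enters_crossing D).

Lemma not_enters_top_end : enters top_end = false.
Proof. by rewrite /enters_crossing /= onth_top. Qed.

Lemma strand_nth_pt i : (i < N)%N -> strand D (nth_pt i) = count enters (take i (travel D)).
Proof. by move=> h; rewrite /strand -/(idx _) nth_ptK. Qed.

Lemma strand_nth_ptS i : (i.+1 < N)%N ->
  strand D (nth_pt i.+1) = (strand D (nth_pt i) + enters (nth_pt i))%N.
Proof.
move=> h; rewrite !strand_nth_pt //; last exact: ltnW.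
rewrite (take_nth (0, 0)) ?size_travel ?(ltnW h) // -cats1 count_cat /=.
by rewrite addn0.
Qed.

Lemma strand_next_pt x : x \in points D -> x != top_end ->
  strand D (next_pt x) = (strand D x + enters x)%N.
Proof.
case/pointP => i iN ->; rewrite nth_pt_top_end // => ni.
by rewrite nth_ptS ?strand_nth_ptS //; lia.
Qed.

Lemma strand_mono i j : (i <= j)%N -> (j < N)%N -> (strand D (nth_pt i) <= strand D (nth_pt j))%N.
Proof.
elim: j => [|j IH]; first by rewrite leqn0 => /eqP ->.
rewrite leq_eqVlt => /orP [/eqP -> //|]; rewrite ltnS => ij jN.
by rewrite strand_nth_ptS // (leq_trans (IH ij (ltnW jN))) // leq_addr.
Qed.

Lemma strand_lt i j : (i < j)%N -> (j < N)%N -> enters (nth_pt i) ->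
  (strand D (nth_pt i) < strand D (nth_pt j))%N.
Proof.
move=> ij jN ei; apply: leq_trans (strand_mono ij jN).
by rewrite strand_nth_ptS ?ei ?addn1 //; lia.
Qed.

Lemma strand_enters_inj x y : x \in points D -> y \in points D ->
  enters x -> enters y -> strand D x = strand D y -> x = y.
Proof.
case/pointP => i iN -> /pointP [j jN ->] ei ej e; congr nth_pt.
case: (ltngtP i j) => // h.
  by have := strand_lt h jN ei; rewrite e ltnn.
by have := strand_lt h iN ej; rewrite e ltnn.
Qed.

Lemma enters_onth x : enters x ->
  exists k b, onth D x.1 = Some (k, Crossing b) /\ (x.2 = k \/ x.2 = k.+1).
Proof.
rewrite /enters_crossing; case: (onth D x.1) => [[k [b|b|]]|] //.
by move=> h; exists k, b; split => //; case/orP: h => /eqP; [left | right].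
Qed.

Lemma crossing_ok l k b : onth D l = Some (k, Crossing b) ->
  nth false (profile D l) k /\ nth false (profile D l) k.+1.
Proof. by have [[h _] _] := D_knot => /h /andP. Qed.

Lemma nth_true_lt s k : nth false s k -> (k < size s)%N.
Proof. by move=> h; rewrite ltnNge; apply/negP => h'; rewrite nth_default in h. Qed.

Lemma crossing_points l k b : onth D l = Some (k, Crossing b) ->
  ((l, k) \in points D) /\ ((l, k.+1) \in points D).
Proof.
move=> h; have [/nth_true_lt h1 /nth_true_lt h2] := crossing_ok h.
by rewrite !mem_points /= h1 h2 !andbT ltnW // -onthTE h.
Qed.

Lemma size_crossings : (size (crossings D)).*2 = count enters (points D).
Proof.
rewrite /points count_flatten -map_comp.
have -> : iota 0 (size D).+1 = iota 0 (size D) ++ [:: size D].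
  by rewrite -addn1 iotaD.
rewrite map_cat sumn_cat /= addn0.
rewrite profile_top /= {2}/enters_crossing /= onth_top /= addn0.
rewrite /crossings size_pmap -sum1_count sumnE big_map -muln2 addn0.
rewrite big_mkcond big_distrl /=; apply: eq_big_seq => l _.
rewrite count_map; case E : (onth D l) => [[k [b|b|]]|] /=; try by
  rewrite mul0n (eq_count (a2 := pred0)) ?count_pred0 // => p;
  rewrite /= /enters_crossing /= E.
have [/nth_true_lt h1 /nth_true_lt h2] := crossing_ok E.
rewrite (eq_count (a2 := predU (pred1 k) (pred1 k.+1))); last first.
  by move=> p; rewrite /= /enters_crossing /= E.
have := count_predUI (pred1 k) (pred1 k.+1) (iota 0 (size (profile D l))).
rewrite (@eq_count _ (predI _ _) pred0); last by move=> p /=; lia.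
rewrite count_pred0 addn0 => ->; rewrite !count_uniq_mem ?iota_uniq // !mem_iota /=.
by rewrite !add0n h1 h2; case: b {E}.
Qed.
End Travel.

(** * One step in a well-formed diagram *)

Definition up (D : diagram) (x : pt) : bool := nth false (profile D x.1) x.2.

Lemma nth_cup (st : seq bool) k b p : (k <= size st)%N ->
  nth false (take k st ++ [:: b; ~~ b] ++ drop k st) p =
  if (p < k)%N then nth false st p
  else if p == k then b else if p == k.+1 then ~~ b else nth false st p.-2.
Proof.
move=> kst; rewrite nth_cat size_takel //; case: ltnP => h; first by rewrite nth_take.
have [->|pk] := eqVneq p k; first by rewrite subnn.
have [->|pk1] := eqVneq p k.+1; first by rewrite subSnn.
have -> : (p - k = (p - k).-2.+2)%N by lia.
by rewrite /= nth_drop; congr nth; lia.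
Qed.

Lemma nth_cap (st : seq bool) k p : (k.+1 < size st)%N ->
  nth false (take k st ++ drop k.+2 st) p =
  if (p < k)%N then nth false st p else nth false st p.+2.
Proof.
move=> kst; rewrite nth_cat size_takel; last by lia.
case: ltnP => h; first by rewrite nth_take.
by rewrite nth_drop; congr nth; lia.
Qed.

Lemma size_cup (st : seq bool) k b : (k <= size st)%N ->
  size (take k st ++ [:: b; ~~ b] ++ drop k st) = (size st).+2.
Proof. by move=> h; rewrite !size_cat size_takel //= size_drop; lia. Qed.

Lemma size_cap (st : seq bool) k : (k.+1 < size st)%N ->
  size (take k st ++ drop k.+2 st) = (size st).-2.
Proof. by move=> h; rewrite size_cat size_takel ?size_drop; lia. Qed.

Section Step.
Variable D : diagram.
Hypothesis D_wf : well_formed D.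

(** A step stays in the diagram, and it respects the orientations: an upward point
    is left upwards or over a maximum, a downward one downwards or through a
    minimum. *)
Lemma step_spec x : x \in points D -> x != top_end D ->
  let y := next_pt D x in
  y \in points D /\
  (if up D x then (y.1 == x.1.+1) && up D y || (y.1 == x.1) && ~~ up D y
   else (0 < x.1)%N && ((y.1 == x.1.-1) && ~~ up D y || (y.1 == x.1) && up D y)).
Proof.
have [ok top] := D_wf.
case: x => l p; rewrite mem_points /= => /andP [lD pl] nt.
rewrite /next_pt /step /up /=; case upx : (nth false (profile D l) p).
  have ltD : (l < size D)%N.
    rewrite ltn_neqAle lD andbT; apply: contra nt => /eqP le.
    move: pl; rewrite le profile_size top /= => p1.
    by apply/eqP; rewrite /top_end; congr pair; move: p1; case: p {upx}.
  case E : (onth D l) => [[k q]|]; last by move: ltD; rewrite -onthTE E.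
  have := ok _ _ E; have := profileS E; rewrite /=.
  case: q E => [b|b|] E /= eP.
  - move=> /andP [uk uk1].
    have [kl k1l] := (nth_true_lt uk, nth_true_lt uk1).
    rewrite mem_points /= ltD eP /= eqxx.
    have [_|pk] := eqVneq p k; first by rewrite k1l uk1.
    have [_|pk1] := eqVneq p k.+1; first by rewrite kl uk.
    by rewrite pl upx.
  - move=> kl; rewrite mem_points /= ltD eP eqxx size_cup // !nth_cup //.
    case: (ltnP p k) => h; first by rewrite h upx; split=> //; lia.
    have -> : (p.+2 < k)%N = false by lia.
    have -> : (p.+2 == k) = false by lia.
    have -> : (p.+2 == k.+1) = false by lia.
    by rewrite -[p.+2.-2]/p upx; split => //; lia.
  - move=> /andP [kl neq].
    have [pk|pk] := eqVneq p k; rewrite /=.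
      move: neq; rewrite -pk upx mem_points /= lD eqxx pk kl.
      by case: (nth false _ k.+1) => // _; rewrite orbT.
    have [pk1|pk1] := eqVneq p k.+1; rewrite /=.
      move: neq; rewrite -pk1 upx mem_points /= lD eqxx (ltnW kl).
      by case: (nth false _ k) => // _; rewrite orbT.
    rewrite mem_points /= ltD eP eqxx size_cap // nth_cap //.
    case: (ltnP p k) => h; first by rewrite h upx; lia.
    have -> : (p.-2 < k)%N = false by lia.
    have -> : p.-2.+2 = p by lia.
    by rewrite upx; lia.
have l0 : (0 < l)%N.
  rewrite lt0n; apply/eqP => l0; move: pl upx; rewrite l0 /profile take0 /=.
  by case: p {nt}.
have E0 : l = l.-1.+1 by rewrite prednK.
case E : (onth D l.-1) => [[k q]|]; last first.
  by have := onthTE D l.-1; rewrite E /=; lia.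
have := ok _ _ E; have := profileS E; rewrite /= -E0.
rewrite l0 /=; case: q E => [b|b|] E /= eP.
- move=> /andP [uk uk1].
  rewrite mem_points /= -eP upx pl eqxx; split => //; lia.
- move=> kl; move: pl upx; rewrite eP size_cup // !nth_cup // => pl.
  have [pk|pk] := ltnP p k.
    move=> upx; have -> : (p == k) = false by lia.
    have -> : (p == k.+1) = false by lia.
    by rewrite mem_points /= upx eqxx /=; lia.
  have [pk'|pk'] := eqVneq p k.
    move=> bF; rewrite mem_points /= eP size_cup // nth_cup //.
    have -> : (k.+1 < k)%N = false by lia.
    have -> : (k.+1 == k) = false by lia.
    by rewrite !eqxx bF /=; lia.
  have [pk1|pk1] := eqVneq p k.+1.
    move=> bF; rewrite mem_points /= eP size_cup // nth_cup // ltnn !eqxx.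
    by case: b bF {E eP} => //= _; lia.
  move=> upx; rewrite mem_points /= upx eqxx /=; lia.
- move=> /andP [kl neq]; move: pl upx; rewrite eP size_cap // nth_cap // => pl.
  by case: ltnP => h upx; rewrite mem_points /= upx eqxx /=; lia.
Qed.

Lemma wf_next_pt_mem x : x \in points D -> next_pt D x \in points D.
Proof.
move=> xD; have [->|nt] := eqVneq x (top_end D); last by case: (step_spec xD nt).
have [_ top] := D_wf.
rewrite /next_pt /= profile_size top /= onth_default //= mem_points /= leqnn.
by rewrite profile_size top.
Qed.

Lemma wf_origin : (0, 0)%N \in points D.
Proof. by rewrite mem_points /profile /= take0. Qed.

(** A repetition-free orbit of the bottom point cannot be longer than the number
    of points, so the orbit repeats itself within [travel], which cuts it off at
    that length: nothing reachable is lost. *)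
Lemma long_knot_of_reachable :
  (forall x, x \in points D -> exists m, x = iter m (next_pt D) (0, 0)%N) ->
  upright_long_knot D.
Proof.
move=> reach; split => // x /reach [m ->].
set M := size (points D); have [loop|nloop] := boolP (looping (next_pt D) (0, 0)%N M).
  by move/loopingP: loop => /(_ m).
move: nloop; rewrite -looping_uniq => uq.
suff sub : {subset traject (next_pt D) (0, 0)%N M.+1 <= points D}.
  by have := uniq_leq_size uq sub; rewrite size_traject ltnn.
move=> z /trajectP [i _ ->]; elim: i => [|i IH]; first exact: wf_origin.
by rewrite iterS wf_next_pt_mem.
Qed.
End Step.

(** * Inserting a pure positive braid *)

Definition braid_on (k n : nat) (w : seq nat) : Prop :=
  {in w, forall q, (k <= q)%N && (q.+1 < k + n)%N}.

Definition swap (q p : nat) : nat :=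
  if p == q then q.+1 else if p == q.+1 then q else p.

Definition follow (w : seq nat) (p : nat) : nat := foldl (fun p q => swap q p) p w.

Lemma swapK q : involutive (swap q).
Proof. by move=> p; rewrite /swap; do !case: eqP => //; lia. Qed.

Lemma follow_rcons w q p : follow (rcons w q) p = swap q (follow w p).
Proof. by rewrite /follow foldl_rcons. Qed.

Lemma follow_rev w p : follow w (follow (rev w) p) = p.
Proof.
elim: w p => [|q w IH] p //.
by rewrite rev_cons follow_rcons /= /follow /= swapK -/(follow w _) IH.
Qed.

Definition braid (w : seq nat) : diagram := [seq (q, Crossing true) | q <- w].

Section Insertion.
Variables (D1 D2 : diagram) (w : seq nat).
Let D0 := D1 ++ D2.
Let K := D1 ++ braid w ++ D2.
Local Notation l1 := (size D1).
Local Notation L := (size w).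
Local Notation st := (profile D0 l1).

Hypothesis D0_knot : upright_long_knot D0.
Hypothesis w_up : {in w, forall q, nth false st q && nth false st q.+1}.
Hypothesis w_pure : follow w =1 id.

Lemma size_K : size K = (size D0 + L)%N.
Proof. by rewrite /K /D0 !size_cat size_map; lia. Qed.

Lemma onth_K_lo l : (l < l1)%N -> onth K l = onth D0 l.
Proof. by move=> h; rewrite /K /D0 !onth_cat h. Qed.

Lemma onth_K_mid m : (m < L)%N -> onth K (l1 + m) = Some (nth 0 w m, Crossing true).
Proof.
move=> h; rewrite /K !onth_cat ifF; last by lia.
by rewrite addKn size_map h onthE (nth_map (0, Cap)) ?size_map // (nth_map 0).
Qed.

Lemma onth_K_hi l : (l1 <= l)%N -> onth K (l + L) = onth D0 l.
Proof.
move=> h; rewrite /K /D0 !onth_cat !size_map !ifF; try lia.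
by congr onth; lia.
Qed.

Lemma profile_K_lo l : (l <= l1)%N -> profile K l = profile D0 l.
Proof. by move=> h; rewrite /K /D0 !profile_cat_le. Qed.

Lemma foldl_braid s v : foldl layer_out s (braid v) = s.
Proof. by elim: v s. Qed.

Lemma profile_K_mid m : (m <= L)%N -> profile K (l1 + m) = st.
Proof.
move=> h; rewrite /profile /top_profile /K /D0 !take_cat ltnn subnn take0 cats0.
rewrite ifF; last by lia.
rewrite addKn size_map foldl_cat.
have -> : (if (m < L)%N then take m (braid w) else braid w ++ take (m - L) D2)
   = braid (take m w).
  case: ltnP => h'; first by rewrite /braid map_take.
  have -> : m = L by lia.
  by rewrite subnn take0 cats0 take_size.
exact: foldl_braid.
Qed.

Lemma profile_K_hi l : (l1 <= l)%N -> profile K (l + L) = profile D0 l.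
Proof.
move=> h; rewrite /profile /top_profile /K /D0 !take_cat size_map !ifF; try lia.
rewrite !foldl_cat foldl_braid; congr (foldl _ _ (take _ _)); lia.
Qed.

(** The line where the braid is inserted has two copies in [K], below and above
    the braid. On an upward strand the lower copy comes first along the
    orientation, on a downward strand the upper one. *)
Definition last_copy (x : pt) : pt :=
  if (x.1 < l1)%N || (x.1 == l1) && ~~ nth false st x.2 then x else (x.1 + L, x.2)%N.
Definition first_copy (x : pt) : pt :=
  if (x.1 < l1)%N || (x.1 == l1) && nth false st x.2 then x else (x.1 + L, x.2)%N.

Lemma wf_K : well_formed K.
Proof.
have [[ok top] _] := D0_knot; split; last first.
  rewrite -profile_size size_K profile_K_hi ?profile_size //.
  by rewrite /D0 size_cat leq_addr.
move=> l x; have [h|h] := ltnP l l1.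
  by rewrite onth_K_lo // profile_K_lo 1?ltnW //; apply: ok.
have [h'|h'] := ltnP l (l1 + L).
  have e : l = (l1 + (l - l1))%N by lia.
  rewrite e onth_K_mid; last by lia.
  have mL : (l - l1 < L)%N by lia.
  rewrite (profile_K_mid (ltnW mL)) => -[<-].
  by apply: w_up; rewrite mem_nth.
have e : l = ((l - L) + L)%N by lia.
rewrite e onth_K_hi ?profile_K_hi; try lia.
exact: ok.
Qed.

Lemma l1_le : (l1 <= size D0)%N.
Proof. by rewrite /D0 size_cat leq_addr. Qed.

Lemma last_copy_mem x : x \in points D0 -> last_copy x \in points K.
Proof.
rewrite !mem_points size_K /last_copy; case: x => l p /= /andP [h h'].
case: ifP => [h1|/negbT]; rewrite /=.
  have h2 : (l <= l1)%N by case/orP: h1 => [/ltnW //|/andP [/eqP -> _]].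
  by rewrite profile_K_lo ?h' ?andbT // (leq_trans h) // leq_addr.
by rewrite negb_or -leqNgt => /andP [h1 _]; rewrite profile_K_hi // h' andbT; lia.
Qed.

Lemma last_copy_inj : injective last_copy.
Proof.
move=> [l p] [l' p']; rewrite /last_copy /=.
case: ifP => h; case: ifP => h' // [] e; rewrite ?e => e'; congr pair; subst => //; try lia.
all: move: h h'; rewrite ?e' //; case: (nth _ _ _) => /=; lia.
Qed.

Lemma last_copy_top : last_copy (top_end D0) = top_end K.
Proof.
rewrite /last_copy /top_end /= size_K.
have := l1_le; rewrite leq_eqVlt => /orP [/eqP e|h]; last by rewrite ifF //; lia.
have [[_ top] _] := D0_knot; move: top; rewrite -profile_size -e => ->.
by rewrite ltnn eqxx.
Qed.

(** Outside the braid nothing changes: the step that leaves a point of [D0]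
    starts at its last copy and arrives at the first copy of the next one, with
    the same turn. *)
Lemma step_last_copy x : x \in points D0 -> x != top_end D0 ->
  step K (last_copy x) = (first_copy (next_pt D0 x), (step D0 x).2).
Proof.
move=> xD xt; have [wf _] := D0_knot.
have [yD spec] := step_spec wf xD xt.
have stK : up K (last_copy x) = up D0 x.
  move: xD; case: x {xt yD spec} => l p xD; rewrite /up /last_copy /=.
  case: ifP => /= [h|/negbT h]; first by rewrite profile_K_lo //; lia.
  by rewrite profile_K_hi //; move: h; rewrite negb_or; lia.
have ltop : up D0 x -> (x.1 < size D0)%N.
  move=> ux; have [xl xp] : (x.1 <= size D0)%N /\ (x.2 < size (profile D0 x.1))%N.
    by apply/andP; rewrite -mem_points.
  rewrite ltn_neqAle xl andbT; apply: contra xt => /eqP e.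
  have [_ top] := wf; move: xp; rewrite e profile_size top /= ltnS leqn0 => /eqP e'.
  by rewrite /top_end -e -e'; case: (x).
move: spec stK ltop; rewrite /next_pt /up.
case: x xD xt yD => l p xD xt yD /=; rewrite /up /=.
case ux : (nth false (profile D0 l) p) => spec stK ltop.
  have {}ltop := ltop isT.
  have [ll|ll] := ltnP l l1.
    have eL : last_copy (l, p) = (l, p) by rewrite /last_copy /= ll.
    rewrite eL /= profile_K_lo 1?ltnW // onth_K_lo //.
    move: spec; rewrite /next_pt /= ?ux; case E : (onth D0 l) => [[k q]|]; last first.
      by move: ltop; rewrite -onthTE E.
    have cS p' : nth false (profile D0 l.+1) p' -> first_copy (l.+1, p') = (l.+1, p').
      move=> h; rewrite /first_copy /=; case: (ltngtP l.+1 l1) => //= [|e]; first by lia.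
      by rewrite -e h.
    have c0 p' : first_copy (l, p') = (l, p') by rewrite /first_copy /= ll.
    case: q E => [b|b|] E /=; rewrite ?eqxx /=.
    - by case/orP => [h|/andP [/eqP]]; [rewrite cS | lia].
    - by case/orP => [h|/andP [/eqP]]; [rewrite cS | lia].
    case: (p == k) => /=; first by rewrite c0.
    case: (p == k.+1) => /=; first by rewrite c0.
    by rewrite eqxx /=; case/orP => [h|/andP [/eqP]]; [rewrite cS | lia].
  have eL : last_copy (l, p) = (l + L, p)%N.
    rewrite /last_copy /= ltnNge ll /=; case: eqP => //= e.
    by move: ux; rewrite e => ->.
  rewrite eL /= profile_K_hi // onth_K_hi // ux.
  move: spec; rewrite /next_pt /= ?ux; case E : (onth D0 l) => [[k q]|]; last first.
    by move: ltop; rewrite -onthTE E.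
  have cS p' : first_copy (l.+1, p') = ((l + L).+1, p')%N.
    by rewrite /first_copy /= ifF //; lia.
  have c0 p' : ~~ nth false (profile D0 l) p' -> first_copy (l, p') = (l + L, p')%N.
    move=> h; rewrite /first_copy /= ltnNge ll /=; case: eqP => //= e.
    by move: h; rewrite e => /negbTE ->.
  case: q E => [b|b|] E /=; rewrite ?cS //.
  case: (p == k) => /=; first by case/orP => /andP [/eqP]; [lia | move=> _ /c0 ->].
  case: (p == k.+1) => /=; first by case/orP => /andP [/eqP]; [lia | move=> _ /c0 ->].
  by rewrite cS.
have l0 : (0 < l)%N by case/andP: spec.
have [ll|ll] := leqP l l1.
  have eL : last_copy (l, p) = (l, p).
    rewrite /last_copy /=; case: ltngtP ll => //= e _; by rewrite -e ux.
  rewrite eL /= profile_K_lo // ux onth_K_lo; last by lia.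
  move: spec; rewrite ?l0 /next_pt /= ?ux; case E : (onth D0 l.-1) => [[k q]|]; last first.
    by have := onthTE D0 l.-1; rewrite E /=; move: xD; rewrite mem_points /=; lia.
  have cP p' : first_copy (l.-1, p') = (l.-1, p').
    by rewrite /first_copy /= ifT //; lia.
  have c0 p' : nth false (profile D0 l) p' -> first_copy (l, p') = (l, p').
    by move=> h; rewrite /first_copy /=; case: ltngtP ll => //= e _; rewrite -e h.
  case: q E => [b|b|] E /=; rewrite ?cP //.
  case: (p == k) => /=; first by case/orP => /andP [/eqP]; [lia | move=> _ /c0 ->].
  case: (p == k.+1) => /=; first by case/orP => /andP [/eqP]; [lia | move=> _ /c0 ->].
  by rewrite cP.
have eL : last_copy (l, p) = (l + L, p)%N by rewrite /last_copy /= ifF //; lia.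
rewrite eL /= profile_K_hi 1?ltnW // ux.
have -> : (l + L).-1 = (l.-1 + L)%N by lia.
rewrite onth_K_hi; last by lia.
move: spec; rewrite ?l0 /next_pt /= ?ux; case E : (onth D0 l.-1) => [[k q]|]; last first.
  by have := onthTE D0 l.-1; rewrite E /=; move: xD; rewrite mem_points /=; lia.
have c0 p' : first_copy (l, p') = (l + L, p')%N.
  by rewrite /first_copy /= ifF //; lia.
have cP p' : ~~ nth false (profile D0 l.-1) p' -> first_copy (l.-1, p') = (l.-1 + L, p')%N.
  move=> h; rewrite /first_copy /= ifF //; case: eqP => [e|]; last by lia.
  by move: h; rewrite e => /negbTE ->; lia.
case: q E => [b|b|] E /=; rewrite ?c0 ?eqxx //=.
- by case/orP => [h|/andP [/eqP]]; [rewrite cP | lia].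
- case: (p == k) => //=; first by rewrite c0.
  case: (p == k.+1) => //=; first by rewrite c0.
  by rewrite eqxx /=; case/orP => [h|/andP [/eqP]]; [rewrite cP | lia].
- by case/orP => [h|/andP [/eqP]]; [rewrite cP | lia].
Qed.

Lemma next_pt_last_copy x : x \in points D0 -> x != top_end D0 -> next_pt K (last_copy x) = first_copy (next_pt D0 x).
Proof. by move=> xD xt; rewrite /next_pt step_last_copy. Qed.

Lemma next_pt_mid_up m p : (m < L)%N -> nth false st p ->
  next_pt K (l1 + m, p) = (l1 + m.+1, swap (nth 0 w m) p)%N.
Proof.
move=> h hp; rewrite /next_pt /= profile_K_mid 1?ltnW // hp onth_K_mid //= addnS.
by rewrite /swap.
Qed.

Lemma next_pt_mid_down m p : (m < L)%N -> ~~ nth false st p ->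
  next_pt K (l1 + m.+1, p) = (l1 + m, p)%N.
Proof.
move=> h hp; rewrite /next_pt /= profile_K_mid // (negbTE hp) addnS /= onth_K_mid //.
Qed.

Lemma nth_swap q p : q \in w -> nth false st (swap q p) = nth false st p.
Proof.
move=> /w_up /andP [h h']; rewrite /swap; case: eqP => [->|_]; first by rewrite h h'.
by case: eqP => [->|]; rewrite ?h ?h'.
Qed.

Lemma nth_follow v p : {subset v <= w} -> nth false st (follow v p) = nth false st p.
Proof.
elim/last_ind: v => [//|v q IH] sub; rewrite follow_rcons nth_swap; last first.
  by apply: sub; rewrite mem_rcons mem_head.
by apply: IH => z zv; apply: sub; rewrite mem_rcons inE zv orbT.
Qed.

Definition reachable x := exists m, x = iter m (next_pt K) (0, 0)%N.

Lemma reachable_next_pt x : reachable x -> reachable (next_pt K x).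
Proof. by case=> m ->; exists m.+1. Qed.

Lemma climb p m : (m <= L)%N -> nth false st p -> reachable (l1, p) ->
  reachable (l1 + m, follow (take m w) p)%N.
Proof.
move=> + hp rp; elim: m => [|m IH] h; first by rewrite take0 addn0.
have := reachable_next_pt (IH (ltnW h)); rewrite next_pt_mid_up //.
  by rewrite -follow_rcons -take_nth.
by rewrite nth_follow // => z /mem_take.
Qed.

Lemma descend p m : (m <= L)%N -> ~~ nth false st p -> reachable (l1 + L, p)%N ->
  reachable (l1 + (L - m), p)%N.
Proof.
move=> + hp rp; elim: m => [|m IH] h; first by rewrite subn0.
have := reachable_next_pt (IH (ltnW h)).
have -> : (L - m = (L - m.+1).+1)%N by lia.
by rewrite next_pt_mid_down //; lia.
Qed.

Lemma reachable_last_copy x : reachable (first_copy x) -> reachable (last_copy x).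
Proof.
case: x => l p; rewrite /first_copy /last_copy /=; have [//|_|->] /= := ltngtP l l1; first by [].
case: (boolP (nth false st p)) => hp rp /=.
  by have := climb (leqnn _) hp rp; rewrite take_size w_pure.
by have := descend (leqnn _) hp rp; rewrite subnn addn0.
Qed.

Lemma reachable_first_copy x : x \in points D0 -> reachable (first_copy x).
Proof.
case/(pointP D0_knot) => i iN ->; elim: i iN => [|i IH] iN.
  exists 0; rewrite /= /nth_pt /travel; have := points_gt0 D0_knot.
  case: (size (points D0)) => //= _ _; rewrite /first_copy /=.
  case: (posnP l1) => [e|h] //=.
  by rewrite e eqxx /profile take0.
have iN' := ltnW iN; have := reachable_next_pt (reachable_last_copy (IH iN')).
rewrite next_pt_last_copy ?nth_ptS ?nth_pt_mem // nth_pt_top_end //; lia.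
Qed.

(** A pure braid leads from the first copy of each point of the line to the last
    copy of the same point, so the knot visits the copies of the points of [D0] in
    the old order; the points inside the braid are met on the way. *)
Lemma braid_knot : upright_long_knot K.
Proof.
apply: (long_knot_of_reachable wf_K) => -[l p] xK.
have [h|h] := ltnP l l1.
  have := @reachable_first_copy (l, p); rewrite /first_copy /= h; apply.
  move: xK; rewrite !mem_points size_K /= profile_K_lo ?(ltnW h) // => /andP [_ ->].
  by have := l1_le; lia.
have [h'|h'] := ltnP (l1 + L) l.
  have e : l = ((l - L) + L)%N by lia.
  have := @reachable_first_copy (l - L, p)%N; rewrite /first_copy /= ifF -?e; last by lia.
  apply; move: xK; rewrite !mem_points size_K /= {2}e profile_K_hi; last by lia.
  by move=> /andP [? ->]; lia.
have e : l = (l1 + (l - l1))%N by lia.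
set m := (l - l1)%N in e; rewrite e in xK *.
have mL : (m <= L)%N by lia.
have xD q : nth false st q = nth false st p -> (q < size st)%N -> (l1, q) \in points D0.
  by move=> _ h1; rewrite mem_points /= h1 l1_le.
have pst : (p < size st)%N by move: xK; rewrite mem_points /= profile_K_mid // => /andP [].
case: (boolP (nth false st p)) => hp.
  (* the strand through this point enters the braid at [p0] *)
  pose p0 := follow (rev (take m w)) p.
  have hp0 : nth false st p0.
    by rewrite nth_follow // => z; rewrite mem_rev => /mem_take.
  have := @reachable_first_copy (l1, p0); rewrite /first_copy /= ltnn eqxx hp0 /=.
  move=> /(_ (xD _ (etrans hp0 (esym hp)) (nth_true_lt hp0))) rp0.
  have := climb mL hp0 rp0; rewrite follow_rev //.
have := @reachable_first_copy (l1, p); rewrite /first_copy /= ltnn eqxx (negbTE hp) /=.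
move=> /(_ (xD _ erefl pst)) rp.
have := @descend p (L - m)%N (leq_subr _ _) hp rp.
by have -> : (L - (L - m) = m)%N by lia.
Qed.

End Insertion.

Local Open Scope ring_scope.

(** * Determinants and the elimination of states *)

(** The sum of the ranks is invariant under permutation, so no rank can increase
    unless another decreases. *)
Lemma perm_rank_eq (n : nat) (rk : 'I_n -> nat) (s : 'S_n) :
  (forall i, rk i <= rk (s i))%N -> forall i, rk (s i) = rk i.
Proof.
move=> le_rk i; apply/eqP; rewrite eq_sym.
have := leqif_sum (fun i (_ : true) => leqif_geq (le_rk i)).
rewrite /index_enum => -[_].
have -> : (\sum_i rk (s i))%N = (\sum_i rk i)%N.
  by symmetry; exact: (reindex_inj (@perm_inj _ s)).
rewrite eqxx => /esym /forallP /(_ i) /= h.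
by rewrite eqn_leq le_rk h.
Qed.

(** A matrix that strictly increases a rank is nilpotent. *)
Lemma det_1_sub_ranked (R : comNzRingType) n (A : 'M[R]_n) (rk : 'I_n -> nat) :
  (forall i j, A i j != 0 -> (rk i < rk j)%N) -> \det (1%:M - A) = 1.
Proof.
move=> rkA.
have Aii i : A i i = 0.
  by apply/eqP/negPn/negP => /rkA; rewrite ltnn.
rewrite /determinant (bigD1 1%g) //= [X in _ + X]big1 ?addr0.
  rewrite odd_perm1 mul1r big1 // => i _.
  by rewrite !mxE perm1 eqxx Aii subr0.
move=> s s1; have [i /eqP si0] : exists i, (1%:M - A) i (s i) == 0.
  apply/existsP; apply: contraNT s1; rewrite negb_exists => /forallP nz.
  have step i : (s i == i) || (rk i < rk (s i))%N.
    case: eqVneq => //= nsi; apply: rkA; have := nz i.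
    by rewrite !mxE [i == _]eq_sym (negPf nsi) sub0r oppr_eq0.
  have := @perm_rank_eq _ rk s _; move=> E.
  have {}E i : rk (s i) = rk i.
    by apply: E => j; case/orP: (step j) => [/eqP->|/ltnW].
  apply/eqP/permP => i; rewrite perm1.
  by have := step i; rewrite E ltnn orbF => /eqP.
by rewrite (bigD1 i) //= si0 mul0r mulr0.
Qed.

Lemma det_1_sub_mulC (R : comNzRingType) m n (A : 'M[R]_(m, n)) (B : 'M[R]_(n, m)) :
  \det (1%:M - A *m B) = \det (1%:M - B *m A).
Proof.
pose C := block_mx 1%:M A B 1%:M.
have E1 : C *m block_mx 1%:M 0 (- B) 1%:M = block_mx (1%:M - A *m B) A 0 1%:M.
  rewrite mulmx_block !mulmx1 !mul1mx !mulmx0 !add0r mulmxN; congr block_mx.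
  by rewrite subrr.
have E2 : block_mx 1%:M 0 (- B) 1%:M *m C = block_mx 1%:M A 0 (1%:M - B *m A).
  rewrite mulmx_block !mulmx1 !mul1mx !mul0mx !addr0 mulNmx; congr block_mx.
    by rewrite addNr.
  by rewrite addrC.
have := congr1 determinant E1; rewrite det_mulmx det_lblock det_ublock !det1 !mulr1.
move<-; have := congr1 determinant E2.
by rewrite det_mulmx det_lblock det_ublock !det1 !mul1r.
Qed.

(** The states of the matrix [A] are thinned out to those in the image of [kept].
    The columns of [S] extend functions on the kept states to all states, in a
    harmonic way outside the kept ones: this is [intertwine]. *)
Section Elimination.
Variables (R : comNzRingType) (v w : nat).
Variables (A : 'M[R]_v) (Ab : 'M[R]_w) (S : 'M[R]_(v, w)).
Variables (kept : 'I_w -> 'I_v) (rk : 'I_v -> nat).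
Hypothesis kept_inj : injective kept.
Hypothesis S_kept : forall k k', S (kept k) k' = (k == k')%:R.

Definition incl_mx : 'M[R]_(v, w) := \matrix_(i, k) (i == kept k)%:R.

Hypothesis intertwine : (1%:M - A) *m S = incl_mx *m (1%:M - Ab).
Hypothesis rkA : forall i j, i \notin codom kept -> j \notin codom kept ->
  A i j != 0 -> (rk i < rk j)%N.

Lemma incl_mxK : incl_mx^T *m incl_mx = 1%:M.
Proof.
apply/matrixP => k k'; rewrite !mxE (bigD1 (kept k)) //= !mxE eqxx mul1r.
rewrite (inj_eq kept_inj) big1 ?addr0 // => i ik.
by rewrite !mxE (negPf ik) mul0r.
Qed.

(** As the eliminated states are ranked, [1 - A] restricted to them is unipotent,
    and so is the square matrix [Sh] that completes [S] by the eliminated states.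
    Then [(1 - A) Sh = N (1 - Ab)], with [Ab] extended by zero and [N] unipotent. *)
Lemma det_elimination : \det (1%:M - A) = \det (1%:M - Ab).
Proof.
pose outm : 'M[R]_v := \matrix_(i, j) ((j \notin codom kept) && (i == j))%:R.
pose Sh : 'M[R]_v := S *m incl_mx^T + outm.
pose N : 'M[R]_v := incl_mx *m incl_mx^T + (1%:M - A) *m outm.
have proj : incl_mx *m incl_mx^T + outm = 1%:M.
  apply/matrixP => i j; rewrite !mxE.
  case: (boolP (j \in codom kept)) => [/codomP [k ->]|nj] /=.
    rewrite (bigD1 k) //= !mxE eqxx mulr1 big1 ?addr0 // => l lk.
    by rewrite !mxE (inj_eq kept_inj) [k == l]eq_sym (negPf lk) mulr0.
  rewrite big1 ?add0r // => l _; rewrite !mxE.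
  have -> : (j == kept l) = false by apply/negP => /eqP e; rewrite e codom_f in nj.
  by rewrite mulr0.
have outI : outm *m incl_mx = 0.
  apply/matrixP => i k; rewrite !mxE big1 // => l _; rewrite !mxE.
  case: (boolP (l \in codom kept)) => [_|nl]; first by rewrite mul0r.
  have -> : (l == kept k) = false by apply/negP => /eqP e; rewrite e codom_f in nl.
  by rewrite mulr0.
have key : (1%:M - A) *m Sh = N *m (1%:M - incl_mx *m Ab *m incl_mx^T).
  have NI : N *m incl_mx = incl_mx.
    by rewrite mulmxDl -!mulmxA incl_mxK outI mulmx0 addr0 mulmx1.
  rewrite mulmxBr mulmx1 !mulmxA NI /Sh mulmxDr mulmxA intertwine.
  by rewrite mulmxBr mulmx1 mulmxBl /N addrAC.
have dSh : \det Sh = 1.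
  have -> : Sh = 1%:M - (1%:M - Sh) by rewrite opprB addrC subrK.
  apply: (@det_1_sub_ranked _ _ _ (fun i => (i \in codom kept))) => i j.
  rewrite !mxE; case: (boolP (j \in codom kept)) => [/codomP [k ->]|nj] /=.
    rewrite addr0 (bigD1 k) //= !mxE eqxx mulr1 big1 ?addr0; last first.
      by move=> l lk; rewrite !mxE (inj_eq kept_inj) [k == l]eq_sym (negPf lk) mulr0.
    case: (boolP (i \in codom kept)) => [/codomP [l ->]|//].
    by rewrite S_kept (inj_eq kept_inj) subrr eqxx.
  rewrite big1 ?add0r ?subrr ?eqxx // => l _; rewrite !mxE.
  have -> : (j == kept l) = false by apply/negP => /eqP e; rewrite e codom_f in nj.
  by rewrite mulr0.
have dN : \det N = 1.
  have -> : N = 1%:M - A *m outm.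
    by rewrite /N mulmxBl mul1mx addrA proj.
  apply: (@det_1_sub_ranked _ _ _
     (fun i => if i \in codom kept then 0 else (rk i).+1)%N) => i j.
  rewrite !mxE; case: (boolP (j \in codom kept)) => [jc|nj].
    by rewrite big1 ?eqxx // => l _; rewrite !mxE jc mulr0.
  rewrite (bigD1 j) //= !mxE nj eqxx mulr1 big1 ?addr0; last first.
    by move=> l lj; rewrite !mxE nj (negPf lj) mulr0.
  by case: ifPn => // ni /(rkA ni nj).
have := congr1 determinant key; rewrite !det_mulmx dSh dN mulr1 mul1r => ->.
rewrite -mulmxA det_1_sub_mulC -mulmxA incl_mxK mulmx1 //.
Qed.

End Elimination.

(** From [intertwine], [S (1 - Ab)^-1] is the inverse of [1 - A] on the columns of
    the kept states. *)
Lemma green_elimination (F : fieldType) v w (A : 'M[F]_v) (Ab : 'M[F]_w)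
    (S : 'M[F]_(v, w)) (kept : 'I_w -> 'I_v) :
  1%:M - A \in unitmx -> 1%:M - Ab \in unitmx ->
  (1%:M - A) *m S = incl_mx F kept *m (1%:M - Ab) ->
  forall i k, invmx (1%:M - A) i (kept k) = (S *m invmx (1%:M - Ab)) i k.
Proof.
move=> uA uB E i k.
have <- : invmx (1%:M - A) *m incl_mx F kept = S *m invmx (1%:M - Ab).
  apply: (can_inj (mulKmx uA)); rewrite mulmxA mulmxV // mul1mx.
  by rewrite mulmxA E -mulmxA mulmxV // mulmx1.
rewrite mxE (bigD1 (kept k)) //= !mxE eqxx mulr1 big1 ?addr0 // => j jk.
by rewrite !mxE (negPf jk) mulr0.
Qed.

Lemma det_rank_one (R : comNzRingType) n (u : 'cV[R]_n) (x : 'rV[R]_n) :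
  \det (1%:M - u *m x) = 1 - (x *m u) 0 0.
Proof. by rewrite det_1_sub_mulC det_mx11 !mxE eqxx. Qed.

(** A permutation other than the identity moves at least two indices, so it only
    contributes to second order in [e]. The predicate [P] stands for a subring
    that contains [e] and the entries, and so the remainder. *)
Lemma det_1_add_scale (R : comNzRingType) (P : R -> Prop) n (Y : 'M[R]_n) (e : R) :
  P 0 -> P 1 -> P e -> (forall x y, P x -> P y -> P (x + y)) ->
  (forall x, P x -> P (- x)) ->
  (forall x y, P x -> P y -> P (x * y)) -> (forall i j, P (Y i j)) ->
  exists2 u, P u & \det (1%:M + e *: Y) = 1 + e * \tr Y + e ^+ 2 * u.
Proof.
move=> P0 P1 Pe PD PN PM PY.
have Psum (I : Type) (r : seq I) (Q : pred I) (f : I -> R) :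
    (forall i, Q i -> P (f i)) -> P (\sum_(i <- r | Q i) f i).
  by move=> Pf; elim/big_rec: _ => // i x Qi Px; apply: (PD) => //; apply: Pf.
have Pprod (I : Type) (r : seq I) (Q : pred I) (f : I -> R) :
    (forall i, Q i -> P (f i)) -> P (\prod_(i <- r | Q i) f i).
  by move=> Pf; elim/big_rec: _ => // i x Qi Px; apply: (PM) => //; apply: Pf.
pose M := 1%:M + e *: Y.
have PMij i j : P (M i j).
  by rewrite !mxE; apply: (PD); [case: (_ == _) | apply: (PM)].
have off i j : i != j -> M i j = e * Y i j by rewrite !mxE => /negPf ->; rewrite add0r.
have diag (r : seq 'I_n) : exists2 u, P u &
    \prod_(i <- r) M i i = 1 + e * (\sum_(i <- r) Y i i) + e ^+ 2 * u.
  elim: r => [|i r [u Pu IH]].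
    by exists 0 => //; rewrite !big_nil !mulr0 !addr0.
  exists (u + Y i i * \sum_(i <- r) Y i i + e * Y i i * u).
    apply: (PD); last by apply: (PM) => //; apply: (PM).
    by apply: (PD) => //; apply: (PM) => //; apply: (Psum).
  rewrite !big_cons IH !mxE eqxx mulr1n; ring.
have offd (s : 'S_n) : s != 1%g -> exists2 u, P u &
   (-1) ^+ s * \prod_i M i (s i) = e ^+ 2 * u.
  move=> s1; have [i si] : exists i, s i != i.
    apply/existsP; apply: contraNT s1; rewrite negb_exists => /forallP h.
    by apply/eqP/permP => i; rewrite perm1; apply/eqP; rewrite -[_ == _]negbK h.
  have ssi : s (s i) != s i by rewrite (inj_eq perm_inj).
  exists ((-1) ^+ s * (Y i (s i) * Y (s i) (s (s i)) *
      \prod_(j | (j != i) && (j != s i)) M j (s j))).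
    apply: (PM); first by case: (odd_perm s); rewrite ?expr0 ?expr1 //; apply: (PN).
    by apply: (PM); [apply: (PM); exact: PY | exact: Pprod].
  rewrite (bigD1 i) // (bigD1 (s i)) //= !off 1?eq_sym //.
  set c := \prod_(j | _) _; set a := Y i _; set b := Y (s i) _.
  move: ((-1) ^+ s) a b c => g a b c; ring.
have [u Pu Eu] : exists2 u, P u & \prod_i M i i = 1 + e * \tr Y + e ^+ 2 * u.
  exact: diag.
have sumoff (r : seq 'S_n) : exists2 u, P u &
   \sum_(s <- r | s != 1%g) (-1) ^+ s * \prod_i M i (s i) = e ^+ 2 * u.
  elim: r => [|s r [x Px IH]]; first by exists 0; rewrite ?big_nil ?mulr0.
  rewrite big_cons; case: ifP => [/offd [y Py ->]|_]; last by exists x.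
  by exists (y + x); [apply: (PD) | rewrite IH mulrDr].
have [x Px Ex] := sumoff (index_enum _).
exists (u + x); first exact: (PD).
rewrite -/M /determinant (bigD1 1%g) //= Ex odd_perm1 mul1r.
have -> : \prod_i M i ((1%g : 'S_n) i) = \prod_i M i i.
  by apply: eq_bigr => i _; rewrite perm1.
rewrite Eu; ring.
Qed.

(** * Values of rational functions *)

Lemma ratfun_fraction (f : ratfun) :
  exists P Q : {poly int}, Q != 0 /\ f = tofrac P / tofrac Q.
Proof.
have [x ->] : exists x, f = \pi_({fraction {poly int}})%qT x.
  by elim/quotW: f => x; exists x.
exists (fraction.frac x).1, (fraction.frac x).2.
have dx : (fraction.frac x).2 != 0 by exact: fraction.denom_ratioP.
split => //; apply: (canRL (mulfK _)); first by rewrite tofrac_eq0.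
unlock tofrac; rewrite -[LHS]FracField.pi_mul; apply/eqmodP.
by rewrite /= FracField.equivfE /FracField.mulf !fraction.numden_Ratio ?mulf_neq0 ?oner_eq0 ?mulr1 // mulrC.
Qed.

Lemma T_neq0 : T != 0 :> ratfun.
Proof. by rewrite tofrac_eq0 polyX_eq0. Qed.

Lemma horner_neq0 (Q : {poly int}) a : Q.[a] != 0 -> Q != 0.
Proof. by apply: contraNneq => ->; rewrite horner0. Qed.

Section HasValue.
Variable a : int.
Implicit Types (f g : ratfun) (v w : rat).

Lemma hv_poly (P : {poly int}) : has_value (tofrac P) a P.[a]%:~R.
Proof.
exists P, 1; split; first by rewrite hornerC oner_eq0.
  by rewrite tofrac1 divr1.
by rewrite hornerC divr1.
Qed.

Lemma hvD f g v w :
  has_value f a v -> has_value g a w -> has_value (f + g) a (v + w).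
Proof.
move=> [P [Q [Qa -> ->]]] [P' [Q' [Qa' -> ->]]].
exists (P * Q' + P' * Q), (Q * Q'); split.
- by rewrite hornerM mulf_neq0.
- have [/horner_neq0 Q0 /horner_neq0 Q0'] := (Qa, Qa').
  by rewrite tofracD !tofracM addf_div ?tofrac_eq0.
- by rewrite hornerD !hornerM intrD !intrM addf_div ?intr_eq0.
Qed.

Lemma hvM f g v w :
  has_value f a v -> has_value g a w -> has_value (f * g) a (v * w).
Proof.
move=> [P [Q [Qa -> ->]]] [P' [Q' [Qa' -> ->]]].
exists (P * P'), (Q * Q'); split; first by rewrite hornerM mulf_neq0.
  by rewrite !tofracM mulf_div.
by rewrite !hornerM !intrM mulf_div.
Qed.

Lemma hv_int (z : int) : has_value z%:~R a z%:~R.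
Proof.
have -> : z%:~R = tofrac (z%:P) :> ratfun.
  by rewrite -[z in RHS]intz !rmorph_int.
by have := hv_poly z%:P; rewrite hornerC.
Qed.

Lemma hv_nat (z : nat) : has_value z%:R a z%:R.
Proof. exact: hv_int z%:Z. Qed.

Lemma hv0 : has_value 0 a 0. Proof. exact: hv_int 0. Qed.
Lemma hv1 : has_value 1 a 1. Proof. exact: hv_int 1. Qed.

Lemma hvT : has_value T a a%:~R.
Proof. by have := hv_poly 'X; rewrite hornerX. Qed.

Lemma hvN f v : has_value f a v -> has_value (- f) a (- v).
Proof.
by move=> /(hvM (hv_int (-1))); rewrite !intrN !mulN1r.
Qed.

Lemma hvB f g v w :
  has_value f a v -> has_value g a w -> has_value (f - g) a (v - w).
Proof. by move=> fv gw; apply: hvD => //; apply: hvN. Qed.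

Lemma hvV f v : has_value f a v -> v != 0 -> has_value f^-1 a v^-1.
Proof.
move=> [P [Q [Qa -> ->]]]; rewrite mulf_eq0 invr_eq0 negb_or !intr_eq0.
by case/andP=> Pa _; exists Q, P; rewrite !invf_div.
Qed.

Lemma hvX f v n : has_value f a v -> has_value (f ^+ n) a (v ^+ n).
Proof.
by move=> fv; elim: n => [|n IH]; rewrite ?expr0 ?exprS; [apply: hv1 | apply: hvM].
Qed.

Lemma hv_sum (I : Type) (r : seq I) (p : pred I) (f : I -> ratfun) (v : I -> rat) :
  (forall i, p i -> has_value (f i) a (v i)) ->
  has_value (\sum_(i <- r | p i) f i) a (\sum_(i <- r | p i) v i).
Proof.
move=> fv; elim/big_rec2: _ => [|i x y pi xy]; first exact: hv0.
by apply: hvD => //; apply: fv.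
Qed.

Lemma hv_prod (I : Type) (r : seq I) (p : pred I) (f : I -> ratfun) (v : I -> rat) :
  (forall i, p i -> has_value (f i) a (v i)) ->
  has_value (\prod_(i <- r | p i) f i) a (\prod_(i <- r | p i) v i).
Proof.
move=> fv; elim/big_rec2: _ => [|i x y pi xy]; first exact: hv1.
by apply: hvM => //; apply: fv.
Qed.

Lemma hv_uniq f v w : has_value f a v -> has_value f a w -> v = w.
Proof.
move=> [P [Q [Qa -> ->]]] [P' [Q' [Qa' E ->]]].
have [/horner_neq0 Q0 /horner_neq0 Q0'] := (Qa, Qa').
have: tofrac (P * Q') == tofrac (P' * Q).
  by rewrite !tofracM -eqr_div ?tofrac_eq0 // E.
rewrite tofrac_eq => /eqP /(congr1 (horner^~ a)).
rewrite !hornerM => e; apply/eqP; rewrite eqr_div ?intr_eq0 //.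
by rewrite -!intrM e.
Qed.

Lemma hv_det n (M : 'M[ratfun]_n) (M1 : 'M[rat]_n) :
  (forall i j, has_value (M i j) a (M1 i j)) -> has_value (\det M) a (\det M1).
Proof.
move=> hM; apply: hv_sum => s _; apply: hvM; last by apply: hv_prod.
by apply: hvX; apply: hvN; apply: hv1.
Qed.

Lemma hv_invmx n (M : 'M[ratfun]_n) (M1 : 'M[rat]_n) :
  M \in unitmx -> M1 \in unitmx ->
  (forall i j, has_value (M i j) a (M1 i j)) ->
  forall i j, has_value (invmx M i j) a (invmx M1 i j).
Proof.
move=> uM uM1 hM i j; rewrite /invmx uM uM1 !mxE.
apply: hvM; first by apply: hvV; [exact: hv_det | rewrite -unitfE].
rewrite /cofactor; apply: hvM.
  by apply: hvX; apply: hvN; apply: hv1.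
by apply: hv_det => k l; rewrite !mxE.
Qed.

(** Clearing denominators, this is the factor theorem. *)
Lemma hv_factor f :
  has_value f a 0 -> exists2 u, exists v, has_value u a v & f = (T - a%:~R) * u.
Proof.
move=> [P [Q [Qa -> /eqP]]].
rewrite eq_sym mulf_eq0 invr_eq0 !intr_eq0 (negPf Qa) orbF.
move/factor_theorem => [P' ->]; exists (tofrac P' / tofrac Q).
  by exists (P'.[a]%:~R / Q.[a]%:~R), P', Q.
have -> : T - a%:~R = tofrac ('X - a%:P).
  by rewrite tofracB /T -[a in RHS]intz !rmorph_int.
by rewrite tofracM mulrA [tofrac P' * _]mulrC.
Qed.

End HasValue.

(** Regularity at [a]; on the T-adic side, [reg 0 (f / T ^+ m)] says that the
    valuation of [f] is at least [m]. *)
Definition reg (a : int) (f : ratfun) : Prop := exists v, has_value f a v.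

Section Reg.
Variable a : int.
Implicit Types (f g : ratfun).

Lemma regD f g : reg a f -> reg a g -> reg a (f + g).
Proof. by move=> [v fv] [w gw]; exists (v + w); apply: hvD. Qed.
Lemma regM f g : reg a f -> reg a g -> reg a (f * g).
Proof. by move=> [v fv] [w gw]; exists (v * w); apply: hvM. Qed.
Lemma regN f : reg a f -> reg a (- f).
Proof. by move=> [v fv]; exists (- v); apply: hvN. Qed.
Lemma regB f g : reg a f -> reg a g -> reg a (f - g).
Proof. by move=> rf rg; apply: regD => //; apply: regN. Qed.
Lemma reg_int z : reg a z%:~R. Proof. by exists z%:~R; apply: hv_int. Qed.
Lemma reg0 : reg a 0. Proof. exact: reg_int 0. Qed.
Lemma reg1 : reg a 1. Proof. exact: reg_int 1. Qed.
Lemma regT : reg a T. Proof. by exists a%:~R; apply: hvT. Qed.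
Lemma regX f n : reg a f -> reg a (f ^+ n).
Proof. by move=> [v fv]; exists (v ^+ n); apply: hvX. Qed.
Lemma reg_nat z : reg a z%:R. Proof. exact: reg_int z%:Z. Qed.
Lemma reg_sum (I : Type) (r : seq I) (p : pred I) (f : I -> ratfun) :
  (forall i, p i -> reg a (f i)) -> reg a (\sum_(i <- r | p i) f i).
Proof.
by move=> h; elim/big_rec: _ => [|i x pi rx]; [apply: reg0 | apply: regD; [apply: h|]].
Qed.
End Reg.

(** * First order expansion at T = 1 *)

(** Value one and derivative [b] at [T = 1]. *)
Definition jet1 (f : ratfun) (b : int) : Prop :=
  exists2 u, reg 1 u & f = 1 + b%:~R * (T - 1) + (T - 1) ^+ 2 * u.

Lemma regT1 a : reg a (T - 1).
Proof. by apply: regB; [apply: regT | apply: reg1]. Qed.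

Lemma hvT1 : has_value (T - 1) 1 0.
Proof. by rewrite -[0](subrr 1%:~R); apply: hvB; [apply: hvT | apply: hv1]. Qed.

Lemma T1_neq0 : T - 1 != 0 :> ratfun.
Proof.
rewrite /T -tofrac1 -tofracB tofrac_eq0 subr_eq0.
by apply/eqP => e; have := size_polyX int; rewrite e size_poly1.
Qed.

Lemma jet1M f g b c : jet1 f b -> jet1 g c -> jet1 (f * g) (b + c).
Proof.
move=> [u ru ->] [v rv ->].
exists (u * (1 + c%:~R * (T - 1) + (T - 1) ^+ 2 * v) + b%:~R * c%:~R
         + (1 + b%:~R * (T - 1)) * v); last by rewrite intrD; ring.
repeat first [assumption | apply: reg_int | exact: regT1 | exact: reg1
  | apply: regD | apply: regM | apply: regX].
Qed.

Lemma jet1_value f b : jet1 f b -> has_value f 1 1.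
Proof.
move=> [u [v uv] ->]; have -> : 1 = 1 + b%:~R * 0 + 0 ^+ 2 * v :> rat by ring.
apply: hvD; first apply: hvD; first exact: hv1.
  by apply: hvM; [apply: hv_int | apply: hvT1].
by apply: hvM => //; apply: hvX; apply: hvT1.
Qed.

Lemma jet1_uniq f b c : jet1 f b -> jet1 f c -> b = c.
Proof.
move=> [u ru ->] [v rv E].
have e : (b - c)%:~R = (T - 1) * (v - u) :> ratfun.
  apply: (mulIf T1_neq0); rewrite intrB.
  have : 1 + b%:~R * (T - 1) + (T - 1) ^+ 2 * u
     - (1 + c%:~R * (T - 1) + (T - 1) ^+ 2 * u) =
     1 + c%:~R * (T - 1) + (T - 1) ^+ 2 * v
     - (1 + c%:~R * (T - 1) + (T - 1) ^+ 2 * u) by rewrite E.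
  by rewrite (_ : _ - _ = (b%:~R - c%:~R) * (T - 1)); [move=> ->|]; ring.
have [w vw] := regB rv ru.
have := hv_uniq (hv_int 1 (b - c)); rewrite e => /(_ _ (hvM hvT1 vw)).
by rewrite mul0r => /eqP; rewrite intr_eq0 subr_eq0 => /eqP.
Qed.

Lemma jet1_T : jet1 T 1.
Proof. by exists 0; [apply: reg0 | ring]. Qed.

Lemma jet1_1 : jet1 1 0.
Proof. by exists 0; [apply: reg0 | ring]. Qed.

Lemma inv_expansion (F : fieldType) (x : F) : x != 0 ->
  x^-1 = 1 + (-1)%:~R * (x - 1) + (x - 1) ^+ 2 * x^-1.
Proof. by move=> x0; field. Qed.

Lemma jet1_Tinv : jet1 T^-1 (-1).
Proof.
exists T^-1; first by exists 1^-1; apply: hvV; [apply: hvT | ].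
exact: inv_expansion T_neq0.
Qed.

Lemma jet1_exprz (m : int) : jet1 (T ^ m) m.
Proof.
case: m => m.
  elim: m => [|m IH]; first exact: jet1_1.
  by rewrite -exprnP exprS; have := jet1M jet1_T IH; rewrite intS.
rewrite NegzE; elim: m => [|m IH]; first exact: jet1_Tinv.
have -> : T ^ (- m.+2%:Z) = T^-1 * T ^ (- m.+1%:Z).
  by rewrite -!exprnN exprS invfM.
have := jet1M jet1_Tinv IH.
by rewrite -[X in jet1 _ X -> _]opprD -intS.
Qed.

(** * T-adic convergence *)

Lemma mulf_divK (F : fieldType) (x a b : F) : a != 0 -> a * (x / (a * b)) = x / b.
Proof. by move=> a0; rewrite invfM mulrCA mulVKf. Qed.

Lemma mulf_div_cancel (F : fieldType) (x w a b : F) : b != 0 ->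
  x / (a * b) * (b * w) = x * w / a.
Proof. by move=> b0; rewrite mulrA [_ * b]mulrC [a * b]mulrC mulf_divK // mulrAC. Qed.

Lemma sub_inv_div (F : fieldType) (x l a b : F) : l != 0 -> a != 0 -> b != 0 ->
  1 + (x - l) / l != 0 ->
  (x^-1 - l^-1) / b = - (a * l^-1 * ((x - l) / l / (b * a)) * (1 + (x - l) / l)^-1).
Proof.
move=> l0 a0 b0 e0; have x0 : x != 0.
  apply: contraNneq e0 => ->.
  by rewrite sub0r mulNr mulfV // subrr.
by field; apply/and4P; split=> //; rewrite addrC subrK.
Qed.

(** T-adic convergence: the valuation of [u t - l] grows beyond any [m]. *)
Definition tends (u : nat -> ratfun) (l : ratfun) : Prop :=
  forall m : nat, exists t0 : nat, forall t, (t0 <= t)%N ->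
    reg 0 ((u t - l) / T ^+ m).

Lemma Tn_neq0 m : T ^+ m != 0 :> ratfun.
Proof. by rewrite expf_neq0 // T_neq0. Qed.

(** Products and inverses of convergent sequences converge because a fixed
    rational function only shifts valuations by a bounded amount. *)
Lemma pole_order_bounded (f : ratfun) : exists c, reg 0 (T ^+ c * f).
Proof.
have [P [Q [Q0 ->]]] := ratfun_fraction f.
have [k [Q' /implyP /(_ Q0) rQ' EQ]] := multiplicity_XsubC Q 0.
exists k, (P.[0]%:~R / Q'.[0]%:~R); exists P, Q'; split => //.
have Q'0 : Q' != 0 by apply: (@horner_neq0 _ 0).
rewrite EQ subr0 tofracM tofracXn -/T.
by rewrite [Q in _ / Q]mulrC mulf_divK ?Tn_neq0.
Qed.

Lemma reg_le m k f : (k <= m)%N -> reg 0 (f / T ^+ m) -> reg 0 (f / T ^+ k).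
Proof.
move=> km /(regM (regX (m - k) (regT 0))); congr reg.
by rewrite -{2}(subnK km) exprD mulf_divK ?Tn_neq0.
Qed.

Lemma tends_ext u v l : u =1 v -> tends u l -> tends v l.
Proof.
by move=> uv ul m; have [t0 h] := ul m; exists t0 => t /h; rewrite uv.
Qed.

Lemma tends_const l : tends (fun=> l) l.
Proof. by move=> m; exists 0%N => t _; rewrite subrr mul0r; apply: reg0. Qed.

Lemma tendsD u v l k : tends u l -> tends v k -> tends (fun t => u t + v t) (l + k).
Proof.
move=> ul vk m; have [[t0 h] [t1 h']] := (ul m, vk m).
exists (maxn t0 t1) => t; rewrite geq_max => /andP[/h ru /h' rv].
by rewrite opprD addrACA mulrDl; apply: regD.
Qed.

Lemma tendsM u v l k : tends u l -> tends v k -> tends (fun t => u t * v t) (l * k).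
Proof.
move=> ul vk m; have [c rl] := pole_order_bounded l.
have [d rk] := pole_order_bounded k.
have [[t0 h] [t1 h']] := (ul (m + d)%N, vk (m + c)%N).
exists (maxn t0 t1) => t; rewrite geq_max => /andP[/h ru /h' rv].
have -> : (u t * v t - l * k) / T ^+ m =
   (u t - l) / T ^+ (m + d) * (T ^+ d * k)
   + (v t - k) / T ^+ (m + c) * (T ^+ c * l)
   + (u t - l) / T ^+ m * (v t - k).
  have inv (x y z : ratfun) : y != 0 -> x / (z * y) * y = x / z.
    by move=> y0; rewrite invfM mulrA divfK.
  rewrite !exprD !mulrA !inv ?Tn_neq0 //.
  move: (u t) (v t) (T ^+ m)^-1 => a b e; ring.
apply: regD; first by apply: regD; apply: regM.
apply: regM; first exact: reg_le (leq_addr d m) ru.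
by have := reg_le (leq0n _) rv; rewrite expr0 divr1.
Qed.

Lemma tendsN u l : tends u l -> tends (fun t => - u t) (- l).
Proof.
move=> /(tendsM (tends_const (-1))); rewrite mulN1r.
by apply: tends_ext => t; rewrite mulN1r.
Qed.

Lemma tendsB u v l k : tends u l -> tends v k -> tends (fun t => u t - v t) (l - k).
Proof. by move=> ul vk; apply: tendsD => //; apply: tendsN. Qed.

Lemma tendsX u l n : tends u l -> tends (fun t => u t ^+ n) (l ^+ n).
Proof.
move=> ul; elim: n => [|n IH]; first exact: tends_const.
by rewrite exprS; apply: tends_ext (tendsM ul IH) => t; rewrite exprS.
Qed.

Lemma tends_sum (I : Type) (r : seq I) (p : pred I) (u : I -> nat -> ratfun)
    (l : I -> ratfun) :
  (forall i, p i -> tends (u i) (l i)) ->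
  tends (fun t => \sum_(i <- r | p i) u i t) (\sum_(i <- r | p i) l i).
Proof.
move=> h; elim: r => [|i r IH].
  by rewrite big_nil; apply: tends_ext (tends_const _) => t; rewrite big_nil.
rewrite big_cons; case: ifP => pi.
  apply: tends_ext (tendsD (h i pi) IH) => t; by rewrite big_cons pi.
by apply: tends_ext IH => t; rewrite big_cons pi.
Qed.

Lemma tends_prod (I : Type) (r : seq I) (p : pred I) (u : I -> nat -> ratfun)
    (l : I -> ratfun) :
  (forall i, p i -> tends (u i) (l i)) ->
  tends (fun t => \prod_(i <- r | p i) u i t) (\prod_(i <- r | p i) l i).
Proof.
move=> h; elim: r => [|i r IH].
  by rewrite big_nil; apply: tends_ext (tends_const _) => t; rewrite big_nil.
rewrite big_cons; case: ifP => pi.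
  apply: tends_ext (tendsM (h i pi) IH) => t; by rewrite big_cons pi.
by apply: tends_ext IH => t; rewrite big_cons pi.
Qed.

Lemma tends_det n (M : nat -> 'M[ratfun]_n) (L : 'M[ratfun]_n) :
  (forall i j, tends (fun t => M t i j) (L i j)) ->
  tends (fun t => \det (M t)) (\det L).
Proof.
move=> h; apply: tends_sum => s _; apply: tendsM; first exact: tends_const.
exact: tends_prod.
Qed.

Lemma tendsV u l : l != 0 -> tends u l -> tends (fun t => (u t)^-1) l^-1.
Proof.
move=> l0 ul m; have [c rw] := pole_order_bounded l^-1.
have [t0 h] := ul (m + c + c).+1; exists t0 => t /h ru.
(* [u t = l (1 + e)] with [e] of high valuation, so [1 + e] is a unit at zero *)
set e := (u t - l) / l.
have [x xv] : reg 0 (e / T ^+ (m + c).+1).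
  have -> : e / T ^+ (m + c).+1 = (u t - l) / T ^+ (m + c + c).+1 * (T ^+ c * l^-1).
    have -> : T ^+ (m + c + c).+1 = T ^+ (m + c).+1 * T ^+ c by rewrite -exprD.
    by rewrite mulf_div_cancel ?Tn_neq0.
  exact: regM.
have he : has_value (1 + e) 0 1.
  rewrite -[1 in X in has_value _ _ X](addr0 1); apply: hvD; first exact: hv1.
  have -> : e = T ^+ (m + c).+1 * (e / T ^+ (m + c).+1).
    by rewrite mulrC divfK ?Tn_neq0.
  by have := hvM (hvX (m + c).+1 (hvT 0)) xv; rewrite expr0n /= mul0r.
have e1 : 1 + e != 0.
  apply/eqP => e10; rewrite e10 in he.
  by have /eqP := hv_uniq he (hv0 0); rewrite oner_eq0.
have -> : ((u t)^-1 - l^-1) / T ^+ m =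
    - ((T ^+ c * l^-1) * (e / T ^+ (m + c)) * (1 + e)^-1).
  rewrite exprD.
  exact: (@sub_inv_div _ (u t) l (T ^+ c) (T ^+ m) l0 (Tn_neq0 c) (Tn_neq0 m) e1).
apply: regN; apply: regM; last first.
  by exists 1^-1; apply: hvV he _; rewrite oner_eq0.
apply: regM => //; apply: (@reg_le (m + c).+1); first by [].
by exists x.
Qed.

Lemma tends_invmx n (M : nat -> 'M[ratfun]_n) (L : 'M[ratfun]_n) :
  (forall t, M t \in unitmx) -> L \in unitmx ->
  (forall i j, tends (fun t => M t i j) (L i j)) ->
  forall i j, tends (fun t => invmx (M t) i j) (invmx L i j).
Proof.
move=> uM uL h i j; rewrite /invmx uL !mxE.
apply: (@tends_ext (fun t => (\det (M t))^-1 * cofactor (M t) j i)).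
  by move=> t; rewrite uM !mxE.
apply: tendsM; first by apply: tendsV; [rewrite -unitfE -unitmxE; exact: uL | exact: tends_det].
rewrite /cofactor; apply: tendsM; first exact: tends_const.
apply: (@tends_ext (fun t => \det (row' j (col' i (M t))))) => //.
by apply: tends_det => k l; rewrite !mxE; apply: tends_ext (h _ _) => t; rewrite !mxE.
Qed.

Lemma tends_shift u l : tends u l -> tends (fun t => u t.+1) l.
Proof.
by move=> ul m; have [t0 h] := ul m; exists t0 => t /leqW /h.
Qed.

Lemma tends_pow_mul k (u : nat -> ratfun) : (0 < k)%N -> (forall t, reg 0 (u t)) ->
  tends (fun t => T ^+ (k * t) * u t) 0.
Proof.
move=> k0 ru m; exists m => t mt; rewrite subr0.
apply: (@reg_le (k * t)); first by rewrite (leq_trans mt) // leq_pmull.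
by rewrite mulrAC mulfV ?Tn_neq0 // mul1r.
Qed.

(** Integers have no pole at zero, so the factor [t] cannot lower the valuation. *)
Lemma tends_natmul u : tends u 0 -> tends (fun t => t%:R * u t) 0.
Proof.
move=> ul m; have [t0 h] := ul m; exists t0 => t /h.
by rewrite !subr0 -mulrA => ru; apply: regM => //; apply: reg_nat.
Qed.

(** * Laurent polynomials *)

(** A polynomial of valuation at least [M] has no coefficients below [M], because
    the denominator of the quotient has a nonzero constant term. *)
Lemma reg_coef (E : {poly int}) M :
  reg 0 (tofrac E / T ^+ M) -> forall i, (i < M)%N -> E`_i = 0.
Proof.
move=> [v [P [Q [Q0 e _]]]].
have nQ : Q != 0 := horner_neq0 Q0.
have {}e : Q * E = 'X^M * P.
  move/eqP: e; rewrite eqr_div ?tofrac_eq0 ?Tn_neq0 // => /eqP e.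
  apply/eqP; rewrite -tofrac_eq !tofracM tofracXn -/T; apply/eqP.
  by rewrite mulrC e mulrC.
elim/ltn_ind => i IH iM.
have : (Q * E)`_i = 0 by rewrite e coefXnM iM.
rewrite coefM big_ord_recl /= subn0 big1 => [|j _]; last first.
  by have ji := ltn_ord j; rewrite /bump /= IH ?mulr0 //; lia.
rewrite addr0 => /eqP; rewrite mulf_eq0 -horner_coef0 (negPf Q0) /= => /eqP //.
Qed.

Definition shift_poly (N : nat) (p : laurent) : {poly int} :=
  \sum_(r <- finsupp p) (p r)%:P * 'X^(absz (r + N%:Z)).

Definition bounded_below (N : nat) (p : laurent) :=
  forall r : int, r < - N%:Z -> p r = 0.

Lemma bounded_belowP p : exists N0, forall N, (N0 <= N)%N -> bounded_below N p.
Proof.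
exists (\sum_(r <- finsupp p) absz r)%N => N leN r rN; apply/eqP.
apply: contraTT rN => pr; rewrite -leNgt.
have rin : r \in finsupp p by rewrite mem_finsupp.
have : (absz r <= N)%N.
  apply: leq_trans leN; rewrite (big_rem r) //=; exact: leq_addr.
lia.
Qed.

Lemma shift_polyE N p : bounded_below N p -> forall i, (shift_poly N p)`_i = p (i%:Z - N%:Z).
Proof.
move=> bN i; rewrite /shift_poly coef_sum.
have nonneg r : r \in finsupp p -> 0 <= r + N%:Z.
  rewrite mem_finsupp; apply: contraNT; rewrite -ltNge => h.
  by apply/eqP/bN; lia.
rewrite (eq_big_seq (fun r => if r == i%:Z - N%:Z then p r else 0)); last first.
  move=> r /nonneg h; rewrite coefCM coefXn.
  have -> : (i == absz (r + N%:Z)) = (r == i%:Z - N%:Z) by apply/eqP/eqP; lia.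
  by case: eqP => _; rewrite ?mulr1 ?mulr0.
have [inp|ninp] := boolP (i%:Z - N%:Z \in finsupp p).
  rewrite (bigD1_seq (i%:Z - N%:Z)) ?fset_uniq //= eqxx big1 ?addr0 //.
  by move=> r /negPf ->.
rewrite big1_seq; first by apply/esym/eqP; rewrite -[_ == _]negbK -mem_finsupp.
by move=> r /andP[_ rin]; case: eqP => // e; rewrite -e rin in ninp.
Qed.

Lemma shift_poly_ratfun N p : bounded_below N p ->
  tofrac (shift_poly N p) = T ^+ N * ratfun_of p.
Proof.
move=> bN; rewrite /shift_poly /ratfun_of mulr_sumr rmorph_sum /=.
apply: eq_big_seq => r rin.
have h : 0 <= r + N%:Z.
  rewrite leNgt; apply/negP => h; move: rin; rewrite mem_finsupp bN ?eqxx //; lia.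
rewrite tofracM tofracXn -/T mulrCA; congr (_ * _).
  by rewrite -[p r in LHS]intz !rmorph_int.
have -> : r = (absz (r + N%:Z))%:Z - N%:Z by lia.
rewrite expfzDr ?T_neq0 // -exprnN -exprnP mulrCA mulfV ?Tn_neq0 // mulr1.
by congr (_ ^+ _); lia.
Qed.

(** This is the comparison of the coefficients of [Q p] and [P] below degree [m],
    once a power of [T] has turned [p] into a polynomial. *)
Lemma laurent_near_fraction (p : laurent) (P Q : {poly int}) m :
  reg 0 ((tofrac Q * ratfun_of p - tofrac P) / T ^+ m) ->
  forall r : int, r < m%:Z ->
    \sum_(i < size Q) Q`_i * p (r - i%:Z) = if r is Posz j then P`_j else 0.
Proof.
move=> rg r rm; have [N0 /(_ N0 (leqnn _)) bN] := bounded_belowP p.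
pose N := N0; rewrite -/N in bN *.
have [rN|rN] := ltP r (- N%:Z).
  rewrite big1 => [|i _]; first by case: r rm rN => // k; lia.
  by rewrite bN ?mulr0 //; lia.
pose E := Q * shift_poly N p - 'X^N * P.
have rE : reg 0 (tofrac E / T ^+ (N + m)).
  have -> // : tofrac E / T ^+ (N + m) = (tofrac Q * ratfun_of p - tofrac P) / T ^+ m.
  rewrite tofracB !tofracM tofracXn -/T shift_poly_ratfun // mulrCA -mulrBr.
  by rewrite exprD invfM mulrACA mulfV ?Tn_neq0 // mul1r.
have lt_m : (absz (r + N%:Z)%R < N + m)%N by lia.
have /eqP := reg_coef rE lt_m; rewrite coefB subr_eq0 => /eqP.
rewrite coefXnM => EE.
have -> : \sum_(i < size Q) Q`_i * p (r - i%:Z) = (Q * shift_poly N p)`_(absz (r + N%:Z)).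
  rewrite -[Q in RHS]coefK poly_def mulr_suml coef_sum; apply: eq_bigr => i _.
  rewrite -scalerAl coefZ coefXnM shift_polyE //.
  case: ltnP => h; first by rewrite bN //; lia.
  by congr (_ * p _); lia.
rewrite EE; move: {EE lt_m} r rm rN => [] k rm rN.
  have -> : (absz (k%:Z + N%:Z)%R < N)%N = false by lia.
  by congr (_`_ _); lia.
by have -> : (absz (Negz k + N%:Z)%R < N)%N by lia.
Qed.

(** The terms are eventually close to the same limit, hence to each other, and
    closeness is equality of the low coefficients. *)
Lemma stabilizes_of_tends (d : nat -> laurent) (f : ratfun) :
  tends (fun t => ratfun_of (d t)) f -> stabilizes_positively d.
Proof.
move=> df r0; have [t0 h] := df (absz r0).+1; exists t0 => t r /h ht rr0.
have h0 := h _ (leqnn t0).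
have [[N1 b1] [N2 b2]] := (bounded_belowP (d t), bounded_belowP (d t0)).
pose N := maxn N1 N2.
have {}b1 : bounded_below N (d t) by apply: b1; exact: leq_maxl.
have {}b2 : bounded_below N (d t0) by apply: b2; exact: leq_maxr.
have [rN|rN] := ltP r (- N%:Z); first by rewrite b1 ?b2.
pose E := shift_poly N (d t) - shift_poly N (d t0).
have rE : reg 0 (tofrac E / T ^+ (N + (absz r0).+1)).
  have := regB ht h0; congr reg.
  rewrite tofracB !shift_poly_ratfun // -mulrBr exprD invfM mulrACA.
  rewrite mulfV ?Tn_neq0 // mul1r -mulrBl; congr (_ / _).
  by rewrite opprB addrA subrK.
have lt_r : (absz (r + N%:Z)%R < N + (absz r0).+1)%N by lia.
have /eqP := reg_coef rE lt_r; rewrite coefB subr_eq0 !shift_polyE // => /eqP.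
by have -> : (absz (r + N%:Z))%:Z - N%:Z = r by lia.
Qed.

(** The series is made of the coefficients at which the sequence stabilizes. Low
    coefficients of [Q] times the series involve finitely many of these, and agree
    with those of [Q * d t] for a large [t]. *)
Lemma limit_of_tends (d : nat -> laurent) (f : ratfun) :
  tends (fun t => ratfun_of (d t)) f ->
  exists2 s, positive_limit d s & laurent_expansion f s.
Proof.
move=> df; have st := stabilizes_of_tends df.
have [s0 hs0] := functional_choice _ st.
pose s r := d (s0 r) r.
have lim : positive_limit d s.
  move=> r0; exists (s0 r0) => t r t0 rr0; rewrite /s (hs0 r0 t r) //.
  rewrite -(hs0 r (maxn (s0 r) (s0 r0)) r) ?leq_maxl //.
  by rewrite (hs0 r0) ?leq_maxr.
exists s => //; split.
  have [N bN] := bounded_belowP (d (s0 0)).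
  exists (- N%:Z) => r rN; have [t0 h] := lim 0.
  rewrite -(h (maxn t0 (s0 0))) ?leq_maxl //; last by lia.
  by rewrite (hs0 0) ?leq_maxr ?(bN N) //; lia.
have [P [Q [Q0 Ef]]] := ratfun_fraction f; exists P, Q; split => // r.
have [t1 h1] := lim r.
have [t2 h2] := tendsM (tends_const (tofrac Q)) df (absz r).+1.
pose t := maxn t1 t2.
have := h2 t (leq_maxr _ _).
rewrite {1}Ef mulrC -[tofrac Q * (_ / _)]mulrC divfK ?tofrac_eq0 // mulrC.
move=> /laurent_near_fraction /(_ r) <-; last by lia.
by apply: eq_bigr => i _; rewrite h1 ?leq_maxl //; lia.
Qed.

Lemma laurent_value_int (p : laurent) : exists z : int, has_value (ratfun_of p) 1 z%:~R.
Proof.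
exists (\sum_(r <- finsupp p) p r); rewrite rmorph_sum; apply: hv_sum => r _.
by rewrite -[X in has_value _ _ X]mulr1; apply: hvM (hv_int 1 _) (jet1_value (jet1_exprz r)).
Qed.

(** Most limits only matter through their existence. *)
Definition conv (u : nat -> ratfun) : Prop := exists l, tends u l.

Lemma conv_ext u v : u =1 v -> conv u -> conv v.
Proof. by move=> uv [l ul]; exists l; apply: tends_ext ul. Qed.
Lemma conv_const c : conv (fun=> c).
Proof. by exists c; apply: tends_const. Qed.
Lemma convD u v : conv u -> conv v -> conv (fun t => u t + v t).
Proof. by move=> [l ul] [m vm]; exists (l + m); apply: tendsD. Qed.
Lemma convM u v : conv u -> conv v -> conv (fun t => u t * v t).
Proof. by move=> [l ul] [m vm]; exists (l * m); apply: tendsM. Qed.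
Lemma convN u : conv u -> conv (fun t => - u t).
Proof. by move=> [l ul]; exists (- l); apply: tendsN. Qed.
Lemma convB u v : conv u -> conv v -> conv (fun t => u t - v t).
Proof. by move=> cu cv; apply: convD => //; apply: convN. Qed.

Lemma conv_sum (I : eqType) (r : seq I) (u : I -> nat -> ratfun) :
  (forall i, i \in r -> conv (u i)) -> conv (fun t => \sum_(i <- r) u i t).
Proof.
elim: r => [|i r IH] h.
  by apply: conv_ext (conv_const 0) => t; rewrite big_nil.
have h1 : conv (u i) by apply: h; rewrite mem_head.
have h2 : conv (fun t => \sum_(i <- r) u i t).
  by apply: IH => j jr; apply: h; rewrite inE jr orbT.
by apply: conv_ext (convD h1 h2) => t; rewrite big_cons.
Qed.

(** With [i] or [j] zero this is a geometric series, read from the bottom or from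
    the top of the twists. With both positive every term is divisible by
    [T ^+ t.-1], and the sum tends to zero. *)
Lemma conv_geometric (n i j : nat) : (0 < n)%N -> (0 < i + j)%N ->
  conv (fun t => \sum_(a < t) T ^+ (n * a) ^+ i * T ^+ (n * (t.-1 - a)) ^+ j).
Proof.
move=> n0 ij0.
have geo m : (0 < m)%N -> conv (fun t => \sum_(a < t) T ^+ m ^+ a).
  move=> m0; have nz : T ^+ m - 1 != 0 :> ratfun.
    rewrite /T -tofracXn -tofrac1 -tofracB tofrac_eq0 subr_eq0.
    by apply/eqP => e; have := size_polyXn int m; rewrite e size_poly1; lia.
  apply: (@conv_ext (fun t => (T ^+ (m * t) * 1 - 1) / (T ^+ m - 1))) => [t|].
    by rewrite mulr1 exprM subrX1 mulrAC mulfV // mul1r.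
  apply: convM (conv_const _); apply: convB (conv_const _); exists 0.
  by apply: tends_pow_mul => // t; apply: reg1.
have [j0|j0] := posnP j.
  apply: (@conv_ext (fun t => \sum_(a < t) T ^+ (n * i) ^+ a)) => [t|].
    by apply: eq_bigr => a _; rewrite j0 expr0 mulr1 -!exprM mulnAC.
  by apply: geo; rewrite muln_gt0 n0; lia.
have [i0|i0] := posnP i.
  apply: (@conv_ext (fun t => \sum_(a < t) T ^+ (n * j) ^+ a)) => [t|].
    rewrite (reindex_inj rev_ord_inj) /=; apply: eq_bigr => a _.
    rewrite i0 expr0 mul1r -!exprM; congr (_ ^+ _); rewrite mulnAC.
    by congr (_ * _ * _)%N; have := ltn_ord a; lia.
  by apply: geo; rewrite muln_gt0 n0; lia.
exists 0 => m; exists m.+1 => t mt; rewrite subr0 mulr_suml.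
apply: reg_sum => a _; rewrite -!exprM -exprD.
have le : (m <= n * a * i + n * (t.-1 - a) * j)%N.
  have at_ := ltn_ord a.
  have h1 : (a <= n * a * i)%N.
    by rewrite -mulnA mulnCA leq_pmulr // muln_gt0 n0.
  have h2 : (t.-1 - a <= n * (t.-1 - a) * j)%N.
    by rewrite -mulnA mulnCA leq_pmulr // muln_gt0 n0.
  by apply: leq_trans (leq_add h1 h2); lia.
by rewrite -(subnK le) exprD mulfK ?Tn_neq0 //; apply: regX; apply: regT.
Qed.

(** * The random walk on the points of a diagram *)

(** Layer [l] as a triple (sign, over-point, under-point), the points being the
    entries below the crossing. *)
Definition crossing_at (D : diagram) (l : nat) : option (int * pt * pt) :=
  if onth D l is Some (k, Crossing b) then
    Some (if b then (1, (l, k), (l, k.+1)) else (-1, (l, k.+1), (l, k)))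
  else None.

(** The mean of [U] over the next position of a walker at [x]; the walk ends at the
    top. *)
Definition flow (F : fieldType) (a : F) (D : diagram) (U : pt -> F) (x : pt) : F :=
  if x == top_end D then 0 else
  if crossing_at D x.1 is Some (s, o, u) then
    if x == o then a ^ s * U (next_pt D o) + (1 - a ^ s) * U (next_pt D u) else U (next_pt D x)
  else U (next_pt D x).

Definition walk_mx (F : fieldType) (a : F) (D : diagram) : 'M[F]_(size (points D)) :=
  \matrix_(i, j) flow a D (fun z => (z == nth_pt D j)%:R) (nth_pt D i).

Lemma big_pmap (R : nmodType) (I J : Type) (h : I -> option J) (s : seq I) (f : J -> R) :
  \sum_(j <- pmap h s) f j = \sum_(i <- s) oapp f 0 (h i).
Proof.
elim: s => [|i s IH]; first by rewrite !big_nil.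
by rewrite /= big_cons; case: (h i) => [j|] /=; rewrite ?big_cons IH ?add0r.
Qed.

Lemma big_crossings (R : nmodType) (D : diagram) (f : int * nat * nat -> R) :
  \sum_(c <- crossings D) f c =
  \sum_(l <- iota 0 (size D))
    if crossing_at D l is Some (s, o, u) then f (s, strand D o, strand D u) else 0.
Proof.
rewrite big_pmap; apply: eq_bigr => l _; rewrite /crossing_at.
by case: (onth D l) => [[k [[]|b|]]|].
Qed.

Section Flow.
Variables (D : diagram) (D_knot : upright_long_knot D).
Local Notation N := (size (points D)).

Lemma crossing_at_points l s o u : crossing_at D l = Some (s, o, u) ->
  [/\ o \in points D, u \in points D, o != u, o.1 = l & u.1 = l].
Proof.
rewrite /crossing_at; case E : (onth D l) => [[k [b|b|]]|] //.
have [h1 h2] := crossing_points D_knot E.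
by case: b E => _ [_ <- <-]; split => //; rewrite xpair_eqE eqxx //; lia.
Qed.

Lemma crossing_at_enters l s o u : crossing_at D l = Some (s, o, u) ->
  enters_crossing D o /\ enters_crossing D u.
Proof.
rewrite /crossing_at /enters_crossing; case E : (onth D l) => [[k [b|b|]]|] //.
by case: b E => E [_ <- <-] /=; rewrite E !eqxx ?orbT.
Qed.

Lemma enters_crossing_at x : enters_crossing D x ->
  exists s o u, crossing_at D x.1 = Some (s, o, u) /\ (x = o \/ x = u).
Proof.
case: x => l p; rewrite /crossing_at /enters_crossing /=.
case: (onth D l) => [[k [b|b|]]|] // /orP [] /eqP ->; case: b; do 3 eexists; split;
  by [reflexivity | left | right].
Qed.

Lemma enters_neq_top x : enters_crossing D x -> x != top_end D.
Proof. by apply: contraTneq => ->; rewrite not_enters_top_end. Qed.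

Lemma flow_top (F : fieldType) (a : F) U : flow a D U (top_end D) = 0.
Proof. by rewrite /flow eqxx. Qed.

Lemma flow_over (F : fieldType) (a : F) U l s o u : crossing_at D l = Some (s, o, u) ->
  flow a D U o = a ^ s * U (next_pt D o) + (1 - a ^ s) * U (next_pt D u).
Proof.
move=> E; have [_ _ _ ol _] := crossing_at_points E; have [eo _] := crossing_at_enters E.
by rewrite /flow (negPf (enters_neq_top eo)) ol E eqxx.
Qed.

Lemma flow_under (F : fieldType) (a : F) U l s o u : crossing_at D l = Some (s, o, u) ->
  flow a D U u = U (next_pt D u).
Proof.
move=> E; have [_ _ ou _ ul] := crossing_at_points E; have [_ eu] := crossing_at_enters E.
by rewrite /flow (negPf (enters_neq_top eu)) ul E eq_sym (negPf ou).
Qed.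

Lemma flow_plain (F : fieldType) (a : F) U x :
  x != top_end D -> ~~ enters_crossing D x -> flow a D U x = U (next_pt D x).
Proof.
move=> /negPf xt ne; rewrite /flow xt; case E : (crossing_at D x.1) => [[[s o] u]|] //.
case: eqP => // xo; have [eo _] := crossing_at_enters E.
by rewrite xo eo in ne.
Qed.

Lemma flow_ext (F : fieldType) (a : F) U V x : x \in points D ->
  {in points D, U =1 V} -> flow a D U x = flow a D V x.
Proof.
move=> xD UV; rewrite /flow; case: eqP => // _.
case E : (crossing_at D x.1) => [[[s o] u]|]; last by rewrite UV ?next_pt_mem.
have [oD uD _ _ _] := crossing_at_points E.
by case: eqP => _; rewrite !UV ?next_pt_mem.
Qed.

Lemma flow_sum (F : fieldType) (a : F) (I : Type) (r : seq I) (P : pred I)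
    (c : I -> F) (V : I -> pt -> F) x :
  flow a D (fun z => \sum_(i <- r | P i) c i * V i z) x =
  \sum_(i <- r | P i) c i * flow a D (V i) x.
Proof.
rewrite /flow; case: eqP => _; first by rewrite big1 // => i _; rewrite mulr0.
case E : (crossing_at D x.1) => [[[s o] u]|] //; case: eqP => _ //.
rewrite !mulr_sumr -big_split /=; apply: eq_bigr => i _.
by rewrite mulrDr !(mulrCA (c i)).
Qed.

Lemma flowD (F : fieldType) (a : F) U V x :
  flow a D (fun z => U z + V z) x = flow a D U x + flow a D V x.
Proof.
rewrite /flow; case: eqP => _; first by rewrite addr0.
case E : (crossing_at D x.1) => [[[s o] u]|] //; case: eqP => _ //.
by rewrite !mulrDr addrACA.
Qed.

Lemma flow1 (F : fieldType) U x : x != top_end D ->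
  flow (1 : F) D U x = U (next_pt D x).
Proof.
move=> /negPf xt; rewrite /flow xt; case E : (crossing_at D x.1) => [[[s o] u]|] //.
by case: eqP => // ->; rewrite exp1rz subrr mul0r mul1r addr0.
Qed.

Lemma nth_pt_eq i j : (i < N)%N -> (j < N)%N -> (nth_pt D i == nth_pt D j) = (i == j).
Proof.
move=> iN jN; apply/eqP/eqP => [/(congr1 (idx D))|->//].
by rewrite !nth_ptK.
Qed.

Lemma sum_delta (F : fieldType) (U : pt -> F) x : x \in points D ->
  \sum_(j < N) U (nth_pt D j) * (x == nth_pt D j)%:R = U x.
Proof.
case/(pointP D_knot) => i iN ->; rewrite (bigD1 (Ordinal iN)) //= eqxx mulr1.
rewrite big1 ?addr0 // => j ij; rewrite nth_pt_eq //.
have -> : (i == j) = false by apply: contraNF ij => /eqP e; apply/eqP/val_inj.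
by rewrite mulr0.
Qed.

Lemma walk_mxE (F : fieldType) (a : F) (U : pt -> F) (i : 'I_N) :
  \sum_j walk_mx a D i j * U (nth_pt D j) = flow a D U (nth_pt D i).
Proof.
under eq_bigr => j _ do rewrite mxE mulrC.
rewrite -(flow_sum a _ _ (fun j : 'I_N => U (nth_pt D j)) (fun j z => (z == nth_pt D j)%:R)).
by apply: flow_ext => [|z zD]; [apply: nth_pt_mem | apply: sum_delta].
Qed.

(** Points are compared with [nth_pt] so that nothing depends on a proof that
    they lie on the diagram. *)
Definition entry_at (F : fieldType) (M : 'M[F]_N) (x y : pt) : F :=
  \sum_(i < N | nth_pt D i == x) \sum_(j < N | nth_pt D j == y) M i j.

Lemma entry_atE (F : fieldType) (M : 'M[F]_N) (i j : 'I_N) : entry_at M (nth_pt D i) (nth_pt D j) = M i j.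
Proof.
rewrite /entry_at (big_pred1 i) => [|k]; last by rewrite nth_pt_eq.
by rewrite (big_pred1 j) // => k; rewrite nth_pt_eq.
Qed.

(** The expected number of visits to the second point of a walk from the first. *)
Definition green (F : fieldType) (a : F) : pt -> pt -> F :=
  entry_at (invmx (1%:M - walk_mx a D)).

Lemma point_ord x : x \in points D -> exists i : 'I_N, x = nth_pt D i.
Proof. by case/(pointP D_knot) => i iN ->; exists (Ordinal iN). Qed.

(** The visits to [y] are characterized by the equation that expands the first
    step. The other lemmas compute visits by guessing a solution. *)
Lemma green_uniq (F : fieldType) (a : F) (U : pt -> F) y :
  1%:M - walk_mx a D \in unitmx -> y \in points D ->
  (forall x, x \in points D -> U x = (x == y)%:R + flow a D U x) ->
  forall x, x \in points D -> green a x y = U x.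
Proof.
move=> uA /point_ord [j ->] hU x /point_ord [i ->]; rewrite /green entry_atE.
pose V : 'cV[F]_N := \col_k U (nth_pt D k).
have E : (1%:M - walk_mx a D) *m V = \col_k (k == j)%:R.
  apply/colP => k; rewrite mulmxBl mul1mx !mxE.
  have -> : \sum_l walk_mx a D k l * V l 0 = flow a D U (nth_pt D k).
    by rewrite -walk_mxE; apply: eq_bigr => l _; rewrite !mxE.
  rewrite hU ?nth_pt_mem //.
  by rewrite nth_pt_eq // addrK.
have <- : V i 0 = U (nth_pt D i) by rewrite mxE.
rewrite -[V](mulKmx uA) E mxE (bigD1 j) //= mxE eqxx mulr1 big1 ?addr0 // => k kj.
by rewrite mxE (negPf kj) mulr0.
Qed.

Lemma green_row (F : fieldType) (a : F) x y :
  1%:M - walk_mx a D \in unitmx -> x \in points D -> y \in points D ->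
  green a x y = (x == y)%:R + flow a D (green a ^~ y) x.
Proof.
move=> uA /point_ord [i ->] /point_ord [j ->]; rewrite -walk_mxE.
under eq_bigr => k _ do rewrite /green entry_atE.
have := mulmxV uA => /matrixP /(_ i j); rewrite mulmxBl mul1mx !mxE.
by rewrite /green entry_atE nth_pt_eq // => <-; rewrite subrK.
Qed.

Lemma green_col (F : fieldType) (a : F) x y :
  1%:M - walk_mx a D \in unitmx -> x \in points D -> y \in points D ->
  green a x y = (x == y)%:R +
    \sum_(k < N) green a x (nth_pt D k) * flow a D (fun z => (z == y)%:R) (nth_pt D k).
Proof.
move=> uA /point_ord [i ->] /point_ord [j ->].
have fE (k : 'I_N) : flow a D (fun z => (z == nth_pt D j)%:R) (nth_pt D k) = walk_mx a D k j.
  by rewrite mxE.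
under eq_bigr => k _ do rewrite /green entry_atE fE.
have := mulVmx uA => /matrixP /(_ i j); rewrite mulmxBr mulmx1 !mxE.
rewrite /green entry_atE nth_pt_eq // => <-.
by rewrite subrK.
Qed.

(** At [T = 1] nobody falls off an over-strand: the walk follows the knot, and
    [walk_mx] is strictly triangular for the order along it. *)
Lemma det_walk1 (F : fieldType) : \det (1%:M - walk_mx (1 : F) D) = 1.
Proof.
apply: (@det_1_sub_ranked _ _ _ (fun i => i)) => i j; rewrite mxE.
have [->|nt] := eqVneq (nth_pt D i) (top_end D); first by rewrite flow_top eqxx.
rewrite flow1 //; case: (next_pt D _ =P _) => [|_]; last by rewrite eqxx.
move=> /(congr1 (idx D)); rewrite idx_next_pt ?nth_pt_mem // !nth_ptK //; lia.
Qed.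

Lemma unit_walk1 (F : fieldType) : 1%:M - walk_mx (1 : F) D \in unitmx.
Proof. by rewrite unitmxE det_walk1 unitr1. Qed.

Lemma green_walk1 (F : fieldType) x y : x \in points D -> y \in points D ->
  green (1 : F) x y = (idx D x <= idx D y)%N%:R.
Proof.
move=> xD yD.
apply: (green_uniq (U := fun x => (idx D x <= idx D y)%N%:R)) => // [|z zD].
  exact: unit_walk1.
have [->|nt] := eqVneq z (top_end D).
  rewrite flow_top addr0; congr (_%:R).
  have it : idx D (top_end D) = N.-1.
    by rewrite -nth_pt_last // nth_ptK //; have := points_gt0 D_knot; lia.
  have := idx_lt D_knot yD; have [<-|ny] := eqVneq (top_end D) y.
    by rewrite leqnn.
  have : idx D y != N.-1.
    by apply: contra ny => /eqP e; rewrite -it in e; rewrite -(idxK D_knot yD) e idxK // top_end_point.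
  by rewrite it; lia.
rewrite flow1 // idx_next_pt //; have [->|zy] := eqVneq z y.
  by rewrite leqnn ltnn addr0.
rewrite add0r; congr (_%:R); have : idx D z != idx D y.
  by apply: contra zy => /eqP e; rewrite -(idxK D_knot zD) e idxK.
by lia.
Qed.

Lemma hv_flow (U : pt -> ratfun) (V : pt -> rat) x :
  (forall z, has_value (U z) 1 (V z)) ->
  has_value (flow T D U x) 1 (flow 1 D V x).
Proof.
move=> UV; rewrite /flow; case: eqP => _; first exact: hv0.
case E : (crossing_at D x.1) => [[[s o] u]|] //; case: eqP => _ //.
have h : has_value (T ^ s) 1 (1 ^ s) by rewrite exp1rz; apply: jet1_value (jet1_exprz s).
by apply: hvD; apply: hvM => //; apply: hvB => //; apply: hv1.
Qed.

Lemma hv_nat_of_bool a (b : bool) : has_value b%:R a b%:R.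
Proof. by case: b; [apply: hv1 | apply: hv0]. Qed.

Lemma hv_1_sub_walk i j : has_value ((1%:M - walk_mx T D) i j) 1 ((1%:M - walk_mx 1 D) i j).
Proof.
rewrite !mxE; apply: hvB; first exact: hv_nat_of_bool.
by apply: hv_flow => z; apply: hv_nat_of_bool.
Qed.

Lemma hv_det_walk : has_value (\det (1%:M - walk_mx T D)) 1 1.
Proof. by rewrite -(det_walk1 rat); apply: hv_det => i j; apply: hv_1_sub_walk. Qed.

Lemma hv_neq0 f a v : has_value f a v -> v != 0 -> f != 0.
Proof. by move=> h; apply: contraNneq => f0; rewrite f0 in h; apply/eqP/(hv_uniq h)/hv0. Qed.

Lemma det_walk_neq0 : \det (1%:M - walk_mx T D) != 0.
Proof. by apply: hv_neq0 hv_det_walk _; rewrite oner_eq0. Qed.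

Lemma unit_walk : 1%:M - walk_mx T D \in unitmx.
Proof. by rewrite unitmxE unitfE det_walk_neq0. Qed.

(** At [T = 1] the walk follows the knot. *)
Lemma hv_green x y : x \in points D -> y \in points D ->
  has_value (green T x y) 1 (idx D x <= idx D y)%N%:R.
Proof.
move=> xD yD; rewrite -(green_walk1 rat) //.
have [[i ->] [j ->]] := (point_ord xD, point_ord yD); rewrite /green !entry_atE.
apply: hv_invmx; [exact: unit_walk | exact: unit_walk1 | exact: hv_1_sub_walk].
Qed.

End Flow.

(** * From strands to points *)

Section Strands.
Variables (D : diagram) (D_knot : upright_long_knot D).
Local Notation N := (size (points D)).
Local Notation enters := (enters_crossing D).

Lemma strand_top : strand D (top_end D) = (size (crossings D)).*2.
Proof.
rewrite size_crossings // -(seq.permP (uniq_perm (travel_uniq D_knot) (uniq_points D) (mem_travel D_knot))).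
have N0 := points_gt0 D_knot.
rewrite -nth_pt_last // strand_nth_pt //; last by lia.
rewrite -[in RHS](cat_take_drop N.-1 (travel D)) count_cat.
have -> : drop N.-1 (travel D) = [:: top_end D].
  rewrite (drop_nth (0, 0)%N) ?size_travel //; last by lia.
  rewrite -/(nth_pt D N.-1) nth_pt_last // drop_oversize // size_travel; lia.
by rewrite /= not_enters_top_end !addn0.
Qed.

Lemma strand_le_top x : x \in points D -> (strand D x <= (size (crossings D)).*2)%N.
Proof.
case/(pointP D_knot) => i iN ->; rewrite -strand_top -nth_pt_last //.
by apply: strand_mono => //; lia.
Qed.

Lemma strand_bound x : x \in points D -> (strand D x < num_strands D)%N.
Proof. by move/strand_le_top; rewrite /num_strands mul2n ltnS. Qed.

Lemma strand_enters_lt x : x \in points D -> enters x ->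
  (strand D x < (size (crossings D)).*2)%N.
Proof.
move=> xD ex; have /eqP h := strand_next_pt D_knot xD (enters_neq_top ex).
have := strand_le_top (next_pt_mem D_knot xD); rewrite (eqP h) ex; lia.
Qed.

(** Each strand is represented by its last point, where its crossing is entered;
    all its walkers pass there. *)
Definition is_rep (x : pt) := enters x || (x == top_end D).

Lemma rep_inj x y : x \in points D -> y \in points D -> is_rep x -> is_rep y ->
  strand D x = strand D y -> x = y.
Proof.
move=> xD yD /orP [ex|/eqP xt] /orP [ey|/eqP yt] e.
- exact: (strand_enters_inj D_knot xD yD ex ey e).
- by have := strand_enters_lt xD ex; rewrite e yt strand_top ltnn.
- by have := strand_enters_lt yD ey; rewrite -e xt strand_top ltnn.
- by rewrite xt yt.
Qed.

Lemma rep_ex (k : 'I_(num_strands D)) :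
  exists i : 'I_N, (strand D (nth_pt D i) == k) && is_rep (nth_pt D i).
Proof.
have N0 := points_gt0 D_knot.
have kle : (k <= (size (crossings D)).*2)%N.
  by rewrite -ltnS -mul2n; exact: ltn_ord k.
have N1 : (N.-1 < N)%N by lia.
have [ke|kne] := eqVneq (val k) (size (crossings D)).*2.
  by exists (Ordinal N1); rewrite /= /is_rep nth_pt_last // strand_top ke !eqxx orbT.
have ex0 : exists i, (i < N)%N && (strand D (nth_pt D i) <= k)%N.
  by exists 0; rewrite N0 strand_nth_pt // take0.
have bd i : (i < N)%N && (strand D (nth_pt D i) <= k)%N -> (i <= N)%N by case/andP=> /ltnW.
case: (ex_maxnP ex0 bd) => i /andP [iN ik] imax.
have iN1 : (i.+1 < N)%N.
  rewrite ltn_neqAle iN andbT; apply: contra kne => /eqP e.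
  have iE : i = N.-1 by lia.
  move: ik; rewrite iE nth_pt_last // strand_top => h; apply/eqP/eqP; rewrite eqn_leq kle /=.
  exact: h.
have := imax i.+1; rewrite iN1 /= ltnn => /contraNF /(_ isT).
rewrite strand_nth_ptS // => /negbT; rewrite -ltnNge => h.
exists (Ordinal iN); rewrite /is_rep /=; case: (enters (nth_pt D i)) h ik => h ik /=; last lia.
by rewrite andbT; apply/eqP; lia.
Qed.

Definition rep (k : 'I_(num_strands D)) : 'I_N := xchoose (rep_ex k).

Lemma strand_rep k : strand D (nth_pt D (rep k)) = k.
Proof. by have /andP [/eqP] := xchooseP (rep_ex k). Qed.

Lemma rep_is_rep k : is_rep (nth_pt D (rep k)).
Proof. by have /andP [] := xchooseP (rep_ex k). Qed.

Lemma rep_injective : injective rep.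
Proof. by move=> k l e; apply/val_inj; rewrite /= -(strand_rep k) e strand_rep. Qed.

Lemma rep_codom (i : 'I_N) : (i \in codom rep) = is_rep (nth_pt D i).
Proof.
apply/codomP/idP => [[k ->]|h]; first exact: rep_is_rep.
have iD : nth_pt D i \in points D by apply: nth_pt_mem.
exists (Ordinal (strand_bound iD)); apply/val_inj => /=.
apply/eqP; rewrite -(nth_pt_eq D_knot) //; apply/eqP.
by apply: rep_inj; rewrite ?nth_pt_mem ?rep_is_rep ?strand_rep.
Qed.

Lemma inord_strand x k : x \in points D ->
  (inord (strand D x) == k :> 'I_(num_strands D)) = (strand D x == k).
Proof. by move=> xD; rewrite -val_eqE /= inordK // -/(num_strands D) strand_bound. Qed.

Lemma inord_strandS x (k : 'I_(num_strands D)) : x \in points D -> enters x ->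
  (inord (strand D x).+1 == k :> 'I_(num_strands D)) = (strand D (next_pt D x) == k).
Proof.
move=> xD ex; rewrite -val_eqE strand_next_pt ?(enters_neq_top ex) // ex addn1 /= inordK //.
by rewrite ltnS; have := strand_enters_lt xD ex; rewrite mul2n.
Qed.

(** One step from the last point of a strand leads to the strands prescribed by
    [A_mx]. *)
Lemma A_mx_row x (k l : 'I_(num_strands D)) : x \in points D -> is_rep x -> strand D x = k ->
  A_mx D k l = flow T D (fun z => (strand D z == l)%:R) x.
Proof.
move=> xD rx xk; rewrite /A_mx big_crossings summxE.
have term m s o u : crossing_at D m = Some (s, o, u) ->
   (T ^ s *: delta_mx (inord (strand D o)) (inord (strand D o).+1)
    + (1 - T ^ s) *: delta_mx (inord (strand D o)) (inord (strand D u).+1)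
    + delta_mx (inord (strand D u)) (inord (strand D u).+1)
      : 'M[ratfun]_(num_strands D)) k l
   = (x == o)%:R * (T ^ s * (strand D (next_pt D o) == l)%:R
        + (1 - T ^ s) * (strand D (next_pt D u) == l)%:R)
     + (x == u)%:R * (strand D (next_pt D u) == l)%:R.
  move=> E; have [oD uD ou _ _] := crossing_at_points D_knot E; have [eo eu] := crossing_at_enters E.
  have xE y : y \in points D -> enters y -> (k == inord (strand D y)) = (x == y).
    move=> yD ey; rewrite eq_sym inord_strand // -xk.
    apply/eqP/eqP => [e|-> //]; apply: rep_inj => //; by rewrite /is_rep ey.
  rewrite !mxE !xE // ![l == _]eq_sym !inord_strandS //.
  by case: (x == o); case: (x == u); rewrite ?mul0r ?mul1r ?mulr0 ?addr0 ?add0r.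
have zero m : m \in iota 0 (size D) -> m != x.1 ->
   (if crossing_at D m is Some (s, o, u) then
    (T ^ s *: delta_mx (inord (strand D o)) (inord (strand D o).+1)
    + (1 - T ^ s) *: delta_mx (inord (strand D o)) (inord (strand D u).+1)
    + delta_mx (inord (strand D u)) (inord (strand D u).+1)
      : 'M[ratfun]_(num_strands D)) else 0) k l = 0.
  move=> _ mx; case E : (crossing_at D m) => [[[s o] u]|]; last by rewrite mxE.
  rewrite (term _ _ _ _ E); have [_ _ _ o1 u1] := crossing_at_points D_knot E.
  have -> : (x == o) = false by apply: contraNF mx => /eqP ->; rewrite o1.
  have -> : (x == u) = false by apply: contraNF mx => /eqP ->; rewrite u1.
  by rewrite !mul0r addr0.
have [ex|nex] := boolP (enters x); last first.
  have xt : x = top_end D by move: rx; rewrite /is_rep (negPf nex) => /eqP.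
  rewrite xt flow_top big1_seq // => m /= min; apply: zero => //.
  by move: min; rewrite mem_iota xt /=; lia.
have [s [o [u [E xou]]]] := enters_crossing_at ex.
have xin : x.1 \in iota 0 (size D).
  rewrite mem_iota /= add0n; have [k' [b [h _]]] := enters_onth ex.
  by rewrite -onthTE h.
rewrite (bigD1_seq x.1) ?iota_uniq //= E (term _ _ _ _ E) big1_seq ?addr0; last first.
  by move=> m /andP [mx min]; apply: zero.
have [oD uD ou _ _] := crossing_at_points D_knot E.
case: xou => xe; rewrite xe.
  by rewrite (flow_over D_knot _ _ E) eqxx (negPf ou) mul1r mul0r addr0.
by rewrite (flow_under D_knot _ _ E) eqxx eq_sym (negPf ou) mul1r mul0r add0r.
Qed.

(** Functions of the strand, seen as functions of the point. *)
Definition strand_mx : 'M[ratfun]_(N, num_strands D) :=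
  \matrix_(i, k) (strand D (nth_pt D i) == k)%:R.

Lemma strand_intertwine :
  (1%:M - walk_mx T D) *m strand_mx = incl_mx _ rep *m (1%:M - A_mx D).
Proof.
apply/matrixP => i k; rewrite mulmxBl mul1mx.
have E : ((walk_mx T D *m strand_mx)) i k
          = flow T D (fun z => (strand D z == k)%:R) (nth_pt D i).
  by rewrite mxE -(walk_mxE D_knot); apply: eq_bigr => j _; rewrite !mxE.
rewrite [LHS]mxE [X in _ + X]mxE E mxE; rewrite [RHS]mxE.
have iD : nth_pt D i \in points D by apply: nth_pt_mem.
have [/codomP [l il]|ni] := boolP (i \in codom rep).
  rewrite (bigD1 l) //= !mxE il eqxx mul1r big1 ?addr0; last first.
    by move=> m ml; rewrite !mxE (inj_eq rep_injective) [l == _]eq_sym (negPf ml) mul0r.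
  rewrite -(@A_mx_row _ l) ?rep_is_rep ?strand_rep // -?il //.
rewrite big1 => [|m _]; last first.
  rewrite !mxE; have -> : (i == rep m) = false by apply: contraNF ni => /eqP ->; rewrite codom_f.
  by rewrite mul0r.
move: ni; rewrite rep_codom /is_rep negb_or => /andP [ne nt].
by rewrite flow_plain // strand_next_pt // (negPf ne) addn0 subrr.
Qed.

Lemma det_strands : \det (1%:M - A_mx D) = \det (1%:M - walk_mx T D).
Proof.
symmetry; apply: (@det_elimination _ _ _ _ _ strand_mx rep (fun i => i)).
- exact: rep_injective.
- by move=> k l; rewrite mxE strand_rep.
- exact: strand_intertwine.
move=> i j; rewrite !rep_codom /is_rep !negb_or => /andP [ne nt] _; rewrite mxE.
rewrite flow_plain //; case: (next_pt D _ =P _) => [|_]; last by rewrite eqxx.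
by move=> /(congr1 (idx D)); rewrite idx_next_pt ?nth_pt_mem // !nth_ptK // => <-.
Qed.

Lemma unit_strands : 1%:M - A_mx D \in unitmx.
Proof. by rewrite unitmxE unitfE det_strands det_walk_neq0. Qed.

Lemma g_green x y : x \in points D -> y \in points D -> is_rep y ->
  g D (strand D x) (strand D y) = green D T x y.
Proof.
move=> /(point_ord D_knot) [i ->] yD ry.
have := green_elimination (unit_walk D_knot) unit_strands strand_intertwine i.
move/(_ (Ordinal (strand_bound yD))).
have -> : rep (Ordinal (strand_bound yD)) = Ordinal (idx_lt D_knot yD).
  apply/val_inj/eqP; rewrite -(nth_pt_eq D_knot) ?(idx_lt D_knot yD) //=; apply/eqP.
  by rewrite idxK //; apply: rep_inj; rewrite ?nth_pt_mem ?rep_is_rep ?strand_rep.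
have -> : green D T (nth_pt D i) y
          = invmx (1%:M - walk_mx T D) i (Ordinal (idx_lt D_knot yD)).
  by rewrite -(entry_atE D_knot) /= idxK.
move=> ->.
have iD : nth_pt D i \in points D by apply: nth_pt_mem.
rewrite mxE (bigD1 (Ordinal (strand_bound iD))) //= mxE eqxx mul1r big1 ?addr0.
  by rewrite /g /G_mx; congr (_ _ _); apply/val_inj; rewrite /= inordK // -/(num_strands D) strand_bound.
move=> k kx; rewrite mxE.
have -> : (strand D (nth_pt D i) == k) = false.
  by apply: contraNF kx => /eqP e; apply/eqP/val_inj.
by rewrite mul0r.
Qed.

Lemma next_pt_inj x y : x \in points D -> y \in points D -> x != top_end D ->
  y != top_end D -> (next_pt D x == next_pt D y) = (x == y).
Proof.
move=> xD yD xt yt; apply/eqP/eqP => [/(congr1 (idx D))|-> //].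
rewrite !idx_next_pt // => -[e]; by rewrite -(idxK D_knot xD) e idxK.
Qed.

(** Behind a point [v] that enters no crossing a walker can only come from [v]. *)
Lemma green_next_pt_plain x v : x \in points D -> v \in points D -> v != top_end D ->
  ~~ enters v -> x != next_pt D v -> green D T x (next_pt D v) = green D T x v.
Proof.
move=> xD vD vt nv xv; rewrite (green_col D_knot (unit_walk D_knot)) ?next_pt_mem //.
rewrite (negPf xv) add0r -[RHS](sum_delta D_knot (green D T x) vD).
apply: eq_bigr => k _; congr (_ * _).
have kD : nth_pt D k \in points D by apply: nth_pt_mem.
have [kt|kt] := eqVneq (nth_pt D k) (top_end D).
  by rewrite kt flow_top (negPf vt).
have [ek|nk] := boolP (enters (nth_pt D k)); last first.
  by rewrite flow_plain // next_pt_inj // eq_sym.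
have vne y : enters y -> (y == v) = false by move=> ey; apply: contraNF nv => /eqP <-.
have [s [o [u [E ou]]]] := enters_crossing_at ek.
have [eo eu] := crossing_at_enters E; have [oD uD _ _ _] := crossing_at_points D_knot E.
have [ot ut] := (enters_neq_top eo, enters_neq_top eu).
rewrite [v == _]eq_sym vne //; case: ou => ->.
  by rewrite (flow_over D_knot _ _ E) !next_pt_inj // !vne // !mulr0 addr0.
by rewrite (flow_under D_knot _ _ E) next_pt_inj // vne.
Qed.

Lemma green_next_pt_under x l s o u : crossing_at D l = Some (s, o, u) -> x \in points D ->
  x != next_pt D u ->
  green D T x (next_pt D u) = green D T x u + (1 - T ^ s) * green D T x o.
Proof.
move=> E xD xu; have [eo eu] := crossing_at_enters E.
have [oD uD neq_ou ol ul] := crossing_at_points D_knot E.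
have [ot ut] := (enters_neq_top eo, enters_neq_top eu).
rewrite (green_col D_knot (unit_walk D_knot)) ?next_pt_mem // (negPf xu) add0r.
rewrite -[X in _ = X + _](sum_delta D_knot (green D T x) uD).
rewrite -[green D T x o in RHS](sum_delta D_knot (green D T x) oD) mulr_sumr -big_split /=.
apply: eq_bigr => k _; rewrite mulrCA -mulrDr; congr (_ * _).
have kD : nth_pt D k \in points D by apply: nth_pt_mem.
rewrite ![_ == nth_pt D k]eq_sym.
have [kt|kt] := eqVneq (nth_pt D k) (top_end D).
  by rewrite kt flow_top eq_sym (negPf ut) eq_sym (negPf ot) mulr0 addr0.
have [ko|ko] := eqVneq (nth_pt D k) o.
  rewrite ko (flow_over D_knot _ _ E) !next_pt_inj // (negPf neq_ou) eqxx.
  by rewrite mulr0 !add0r.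
rewrite mulr0 addr0.
have [ek|nk] := boolP (enters (nth_pt D k)); last by rewrite flow_plain // next_pt_inj.
have [s' [o' [u' [E' ou']]]] := enters_crossing_at ek.
have [eo' eu'] := crossing_at_enters E'; have [oD' uD' _ ol' ul'] := crossing_at_points D_knot E'.
have [ot' ut'] := (enters_neq_top eo', enters_neq_top eu').
have same y : y \in [:: o'; u'] -> y \in [:: o; u] -> o' = o /\ u' = u.
  move=> yin yin'; have e : (nth_pt D k).1 = l.
    have <- : y.1 = (nth_pt D k).1 by move: yin; rewrite !inE => /orP [] /eqP ->.
    by move: yin'; rewrite !inE => /orP [] /eqP ->.
  by move: E'; rewrite e E => -[_ -> ->].
have o'u : (o' == u) = false.
  apply/negP => /eqP e; have [] := @same u _ _; rewrite ?inE ?e ?eqxx ?orbT //.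
  by move=> e'; move: neq_ou; rewrite -e' eqxx.
case: ou' => ke; rewrite ke; last by rewrite (flow_under D_knot _ _ E') next_pt_inj.
have u'u : (u' == u) = false.
  apply/negP => /eqP e; have [] := @same u _ _; rewrite ?inE ?e ?eqxx ?orbT //.
  by move=> e' _; move: ko; rewrite ke e' eqxx.
by rewrite (flow_over D_knot _ _ E') !next_pt_inj // o'u u'u !mulr0 addr0.
Qed.

Lemma green_strand x i j : (i <= j)%N -> (j < N)%N -> x \in points D ->
  strand D (nth_pt D i) = strand D (nth_pt D j) ->
  (forall m, (i < m <= j)%N -> x != nth_pt D m) ->
  green D T x (nth_pt D j) = green D T x (nth_pt D i).
Proof.
elim: j => [|j IH]; first by rewrite leqn0 => /eqP ->.
rewrite leq_eqVlt => /orP [/eqP -> //|]; rewrite ltnS => ij jN xD eS xm.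
have le1 := strand_mono D_knot ij (ltnW jN).
have eS' := strand_nth_ptS D_knot jN.
have ne : ~~ enters (nth_pt D j).
  by move: eS'; case: (enters _) => // h; move: le1; rewrite eS h; lia.
have jN' := ltnW jN; have jD := nth_pt_mem D_knot jN'.
have jt : nth_pt D j != top_end D by rewrite nth_pt_top_end // neq_ltn; apply/orP; left; rewrite -ltnS prednK // (leq_trans _ jN').
have xj : x != next_pt D (nth_pt D j) by rewrite nth_ptS // xm // ltnS ij leqnn.
rewrite -nth_ptS // green_next_pt_plain //; apply: IH => //.
  by rewrite eS eS' (negPf ne) addn0.
by move=> m /andP [im mj]; apply: xm; rewrite im leqW.
Qed.

(** [g] counts visits at the last point of the strand of [z]. As the start [x] does
    not lie between [z] and that point and no walker joins the strand there, these
    are the visits to [z]. *)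
Lemma g_behind x z : x \in points D -> z \in points D -> (idx D x <= idx D z)%N ->
  g D (strand D x) (strand D z) = green D T x z.
Proof.
move=> xD zD xz; pose k := Ordinal (strand_bound zD); pose w := rep k.
have ew : strand D (nth_pt D w) = strand D z by rewrite strand_rep.
have wD : nth_pt D w \in points D by apply: nth_pt_mem.
rewrite -{1}ew g_green ?rep_is_rep //.
have le : (idx D z <= w)%N.
  rewrite leqNgt; apply/negP => lt.
  have := rep_is_rep k; rewrite /is_rep -/w => /orP [ew'|/eqP wt].
    by have := strand_lt D_knot lt (idx_lt D_knot zD) ew'; rewrite idxK // ew ltnn.
  have : (w == N.-1 :> nat) by rewrite -nth_pt_top_end // wt.
  by have := idx_lt D_knot zD; move: lt; lia.
rewrite (@green_strand x (idx D z) w) ?idxK //.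
move=> m /andP [im mw]; apply/eqP => xm.
have mN : (m < N)%N by apply: leq_ltn_trans mw _.
by move: xz im; rewrite xm nth_ptK //; lia.
Qed.

(** The walkers that arrive behind the under-passage come along the under-strand
    or fall from the over-strand. *)
Lemma g_under_next l s o u : crossing_at D l = Some (s, o, u) ->
  g D (strand D u) (strand D u).+1 = green D T u u + (1 - T ^ s) * green D T u o.
Proof.
move=> E; have [eo eu] := crossing_at_enters E.
have [oD uD neq_ou ol ul] := crossing_at_points D_knot E.
have ut := enters_neq_top eu.
have zD := next_pt_mem D_knot uD; set z := next_pt D u in zD.
have uz : u != z.
  apply/eqP => /(congr1 (idx D)); rewrite idx_next_pt //; lia.
have zS : strand D z = (strand D u).+1 by rewrite strand_next_pt // eu addn1.
rewrite -(green_next_pt_under E) // -/z -zS g_behind // /z idx_next_pt //.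
Qed.

Lemma g_next_under l s o u : crossing_at D l = Some (s, o, u) ->
  g D (strand D u).+1 (strand D u) = green D T u u - 1.
Proof.
move=> E; have [eo eu] := crossing_at_enters E.
have [oD uD neq_ou ol ul] := crossing_at_points D_knot E.
have ut := enters_neq_top eu.
rewrite -[(strand D u).+1]addn1 -[1%N]/(nat_of_bool true) -eu -strand_next_pt //.
rewrite g_green ?next_pt_mem //; last by rewrite /is_rep eu.
rewrite [green D T u u](green_row D_knot (unit_walk D_knot)) // eqxx.
by rewrite (flow_under D_knot _ _ E) addrAC subrr add0r.
Qed.

(** [R1] in terms of the visits between the two entries [o] and [u] of a crossing,
    the indices [j+] being eliminated by [g_under_next] and [g_next_under]. *)
Definition R1_of (F : fieldType) (s a goo gou guo guu : F) : F :=
  s * (guo * (guu - 1 + (guu + (1 - a) * guo) - gou)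
       - goo * (guu + (1 - a) * guo - 1) - 1 / 2%:R).

Lemma R1_green l s o u : crossing_at D l = Some (s, o, u) ->
  R1 D (s, strand D o, strand D u) =
  R1_of s%:~R (T ^ s) (green D T o o) (green D T o u) (green D T u o) (green D T u u).
Proof.
move=> E; have [eo eu] := crossing_at_enters E.
have [oD uD neq_ou ol ul] := crossing_at_points D_knot E.
have [ro ru] : is_rep o /\ is_rep u by rewrite /is_rep eo eu.
by rewrite /R1 (g_under_next E) (g_next_under E) !g_green.
Qed.

(** By [g_behind] the sum over the strands can be spread over the points, each with
    its own half turns. *)
Lemma turning_sum :
  \sum_(k < num_strands D)
     ((half_turns D k)%:~R / 2%:R) * (g D k k - 1 / 2%:R)
  = \sum_(x <- points D)
     ((step D x).2)%:~R / 2%:R * (green D T x x - 1 / 2%:R) :> ratfun.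
Proof.
under eq_bigr => k _.
  rewrite /half_turns rmorph_sum !mulr_suml.
  rewrite big_mkcond /=.
  over.
rewrite exchange_big /= (perm_big (points D)) /=; last first.
  exact: (uniq_perm (travel_uniq D_knot) (uniq_points D) (mem_travel D_knot)).
apply: eq_big_seq => x xD; rewrite -big_mkcond /=.
rewrite (big_pred1 (Ordinal (strand_bound xD))) => [|k]; last first.
  by apply/eqP/eqP => [e|-> //]; apply/val_inj.
by rewrite g_behind.
Qed.

End Strands.

(** * The Burau action *)

Section Burau.
Variables (F : fieldType) (a : F).

(** The mean of [f] over the exits of a walker that enters a positive crossing at
    position [p], the over-strand going from [q] to [q + 1]. *)
Definition sigma_act (q : nat) (f : nat -> F) (p : nat) : F :=
  if p == q then (1 - a) * f q + a * f q.+1 else if p == q.+1 then f q else f p.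

Definition burau_act (w : seq nat) (f : nat -> F) : nat -> F := foldr sigma_act f w.

Lemma burau_act_cat v w f : burau_act (v ++ w) f = burau_act v (burau_act w f).
Proof. by rewrite /burau_act foldr_cat. Qed.

Lemma sigma_act_ext q f g : f =1 g -> sigma_act q f =1 sigma_act q g.
Proof. by move=> fg p; rewrite /sigma_act !fg. Qed.

Lemma burau_act_ext w f g : f =1 g -> burau_act w f =1 burau_act w g.
Proof. by move=> fg; elim: w => [|q w IH] //=; apply: sigma_act_ext. Qed.

Lemma burau_actD w f g p : burau_act w (fun z => f z + g z) p = burau_act w f p + burau_act w g p.
Proof.
elim: w p => [|q w IH] p //=; rewrite -/(burau_act w _) (sigma_act_ext _ IH) /sigma_act.
by case: eqP => _; [ring | case: eqP].
Qed.

Lemma burau_actZ w c f p : burau_act w (fun z => c * f z) p = c * burau_act w f p.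
Proof.
elim: w p => [|q w IH] p //=; rewrite -/(burau_act w _) (sigma_act_ext _ IH) /sigma_act.
by case: eqP => _; [ring | case: eqP].
Qed.

Lemma burau_act0 w p : burau_act w (fun=> 0) p = 0.
Proof.
elim: w p => [|q w IH] p //=; rewrite -/(burau_act w _) (sigma_act_ext _ IH) /sigma_act.
by case: eqP => _; [ring | case: eqP].
Qed.

Lemma burau_act_sum w (I : Type) (r : seq I) (f : I -> nat -> F) p :
  burau_act w (fun z => \sum_(i <- r) f i z) p = \sum_(i <- r) burau_act w (f i) p.
Proof.
elim: r => [|i r IH].
  rewrite big_nil -[RHS](burau_act0 w p); apply: burau_act_ext => z; by rewrite big_nil.
rewrite big_cons -IH -burau_actD; apply: burau_act_ext => z; by rewrite big_cons.
Qed.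

Lemma burau_act_fix w f p : {in w, forall q, (p != q) && (p != q.+1)} -> burau_act w f p = f p.
Proof.
elim: w => [|q w IH] //= h; have /andP [/negbTE h1 /negbTE h2] := h q (mem_head _ _).
by rewrite /sigma_act h1 h2 IH // => z zw; apply: h; rewrite inE zw orbT.
Qed.

End Burau.

(** * Replacing a braid by its Burau matrix *)

Section Lift.
Variables (D1 D2 : diagram) (w : seq nat) (k n : nat).
Let D0 := D1 ++ D2.
Let K := D1 ++ braid w ++ D2.
Local Notation l1 := (size D1).
Local Notation L := (size w).
Local Notation st := (profile D0 l1).
Local Notation N0 := (size (points D0)).
Local Notation NK := (size (points K)).
Local Notation lastc := (last_copy D1 D2 w).
Local Notation firstc := (first_copy D1 D2 w).

Hypothesis D0_knot : upright_long_knot D0.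
Hypothesis disc_up : forall p, (k <= p < k + n)%N -> nth false st p.
Hypothesis w_disc : braid_on k n w.
Hypothesis w_pure : follow w =1 id.

Lemma w_up : {in w, forall q, nth false st q && nth false st q.+1}.
Proof.
move=> q /w_disc /andP [h h']; rewrite !disc_up //; lia.
Qed.

Let K_knot : upright_long_knot K := braid_knot D0_knot w_up w_pure.

Variables (F : fieldType) (a : F).

Lemma nth_w_up m : (m < L)%N ->
  nth false st (nth 0%N w m) && nth false st (nth 0%N w m).+1.
Proof. by move=> h; apply: w_up; rewrite mem_nth. Qed.

Lemma crossing_at_K_lo l : (l < l1)%N -> crossing_at K l = crossing_at D0 l.
Proof. by move=> h; rewrite /crossing_at onth_K_lo. Qed.

Lemma crossing_at_K_hi l s o u : (l1 <= l)%N -> crossing_at D0 l = Some (s, o, u) ->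
  crossing_at K (l + L)%N = Some (s, ((l + L)%N, o.2), ((l + L)%N, u.2)).
Proof.
move=> h; rewrite /crossing_at onth_K_hi //; case: (onth D0 l) => [[k' [b|b|]]|] //.
by case: b => -[<- <- <-].
Qed.

Lemma crossing_at_K_mid m : (m < L)%N ->
  crossing_at K (l1 + m)%N = Some (1%:Z, ((l1 + m)%N, nth 0%N w m), ((l1 + m)%N, (nth 0%N w m).+1)).
Proof. by move=> h; rewrite /crossing_at onth_K_mid. Qed.

Lemma crossing_at_up l s o u : crossing_at D0 l = Some (s, o, u) ->
  nth false (profile D0 l) o.2 /\ nth false (profile D0 l) u.2.
Proof.
rewrite /crossing_at; case E : (onth D0 l) => [[k' [b|b|]]|] //.
have [h h'] := crossing_ok D0_knot E.
by case: b E => _ [_ <- <-].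
Qed.

Lemma crossing_at_K_last_copy l s o u : crossing_at D0 l = Some (s, o, u) ->
  crossing_at K (lastc o).1 = Some (s, lastc o, lastc u).
Proof.
move=> E; have [uo uu] := crossing_at_up E; have [_ _ _ ol ul] := crossing_at_points D0_knot E.
have ioE x : x.1 = l -> nth false (profile D0 l) x.2 ->
   lastc x = if (l < l1)%N then x else (l + L, x.2)%N.
  move=> xl hx; rewrite /last_copy xl; case: ltngtP => //= e.
  by rewrite -e hx.
rewrite !ioE //; case: ltnP => h; first by rewrite ol crossing_at_K_lo.
exact: crossing_at_K_hi.
Qed.

Lemma enters_K_last_copy x : x \in points D0 -> enters_crossing K (lastc x) = enters_crossing D0 x.
Proof.
case: x => l p xD; rewrite /enters_crossing /last_copy /=.
case: ltngtP => //= [h|h|e].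
- by rewrite onth_K_lo.
- by rewrite onth_K_hi // ltnW.
case: (boolP (nth false st p)) => hp /=; first by rewrite e onth_K_hi.
have noD : (if onth D0 l is Some (k', Crossing _) then (p == k') || (p == k'.+1) else false) = false.
  case E : (onth D0 l) => [[k' [b|b|]]|] //.
  have [h h'] := crossing_ok D0_knot E; rewrite e in h h'.
  by apply: contraNF hp => /orP [] /eqP ->.
rewrite noD e; case: (posnP L) => [w0|w0].
  rewrite -(addn0 l1) -[in X in (l1 + X)%N]w0 onth_K_hi // -e; exact: noD.
rewrite -(addn0 l1) onth_K_mid //.
have /andP [h h'] := nth_w_up w0.
by apply: contraNF hp => /orP [] /eqP ->.
Qed.

Lemma flow_K_last_copy V x : x \in points D0 ->
  flow a K V (lastc x) = flow a D0 (V \o firstc) x.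
Proof.
move=> xD; have [->|xt] := eqVneq x (top_end D0).
  by rewrite last_copy_top // !flow_top.
have xt' : lastc x != top_end K.
  by rewrite -(last_copy_top w D0_knot) (inj_eq (@last_copy_inj _ _ _)).
have [ex|nex] := boolP (enters_crossing D0 x); last first.
  by rewrite !flow_plain ?enters_K_last_copy // next_pt_last_copy.
have [s [o [u [E xou]]]] := enters_crossing_at ex.
have [oD uD _ ol ul] := crossing_at_points D0_knot E.
have [eo eu] := crossing_at_enters E.
have [ot ut] := (enters_neq_top eo, enters_neq_top eu).
have E' := crossing_at_K_last_copy E.
case: xou => ->.
  by rewrite (flow_over K_knot _ _ E') (flow_over D0_knot _ _ E) !next_pt_last_copy.
by rewrite (flow_under K_knot _ _ E') (flow_under D0_knot _ _ E) !next_pt_last_copy.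
Qed.

Lemma mid_neq_top m p : (m < L)%N -> (l1 + m, p)%N != top_end K.
Proof.
move=> h; rewrite /top_end /K !size_cat size_map xpair_eqE.
by have -> : (l1 + m == l1 + (L + size D2))%N = false by lia.
Qed.

Lemma flow_K_mid_up V m p : (m < L)%N -> nth false st p ->
  flow a K V (l1 + m, p)%N = sigma_act a (nth 0%N w m) (fun z => V (l1 + m.+1, z)%N) p.
Proof.
move=> h hp; have E := crossing_at_K_mid h; have /andP [h1 h2] := nth_w_up h.
have no : next_pt K (l1 + m, nth 0%N w m)%N = (l1 + m.+1, (nth 0%N w m).+1)%N.
  by rewrite next_pt_mid_up // /swap eqxx.
have nu : next_pt K (l1 + m, (nth 0%N w m).+1)%N = (l1 + m.+1, (nth 0%N w m))%N.
  by rewrite next_pt_mid_up // /swap ifF ?eqxx //; lia.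
rewrite /sigma_act; case: eqP => [->|/eqP po].
  by rewrite (flow_over K_knot _ _ E) no nu addrC.
case: eqP => [->|/eqP pu]; first by rewrite (flow_under K_knot _ _ E) nu.
rewrite flow_plain ?mid_neq_top //.
  by rewrite next_pt_mid_up // /swap (negbTE po) (negbTE pu).
by rewrite /enters_crossing /= onth_K_mid // negb_or po.
Qed.

Lemma flow_K_mid_down V m p : (m < L)%N -> ~~ nth false st p -> (l1 + m.+1, p)%N \in points K ->
  flow a K V (l1 + m.+1, p)%N = V (l1 + m, p)%N.
Proof.
move=> h hp pK; rewrite flow_plain; last first.
- apply/negP => en; have [s [o [u [E xou]]]] := enters_crossing_at en.
  have [oK uK _ ol ul] := crossing_at_points K_knot E.
  have [/= k' [b [E' ek]]] := enters_onth en.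
  have [h1 h2] := crossing_ok K_knot E'.
  move: h1 h2; rewrite profile_K_mid // => h1 h2.
  by case: ek => /= ek; move: hp; rewrite ek ?h1 ?h2.
- apply: contraNneq hp => e; have := profile_top K_knot.
  by move: e => [<- ->]; rewrite profile_K_mid // => ->.
by rewrite next_pt_mid_down.
Qed.

(** The extension of [U], given at the last copies, that is harmonic inside the
    braid: a walker in the braid is as good as its exit through the top. *)
Definition lift (U : pt -> F) (x : pt) : F :=
  if (x.1 < l1)%N then U x else if (l1 + L < x.1)%N then U (x.1 - L, x.2)%N
  else burau_act a (drop (x.1 - l1) w) (fun p => U (l1, p)) x.2.

(** The value at the first copy of a point, from those at the last copies: the
    braid is replaced by a coupon that applies its Burau matrix. *)
Definition coupon (U : pt -> F) (x : pt) : F :=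
  if x.1 == l1 then burau_act a w (fun p => U (l1, p)) x.2 else U x.

Lemma burau_act_down v f p : {subset v <= w} -> ~~ nth false st p -> burau_act a v f p = f p.
Proof.
move=> sub hp; apply: burau_act_fix => q /sub qw; have /andP [h h'] := w_up qw.
by apply/andP; split; apply: contraNneq hp => ->.
Qed.

Lemma sub_drop m : {subset drop m w <= w}. Proof. by move=> z /mem_drop. Qed.

Lemma lift_mid U m p : (m <= L)%N ->
  lift U (l1 + m, p)%N = burau_act a (drop m w) (fun p => U (l1, p)) p.
Proof.
move=> h; rewrite /lift /= ifF; last by lia.
by rewrite ifF; [rewrite addKn | lia].
Qed.

Lemma lift_last_copy U x : lift U (lastc x) = U x.
Proof.
case: x => l p; rewrite /last_copy /=; have [h|h|->] /= := ltngtP l l1.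
- by rewrite /lift /= h.
- by rewrite /lift /= ifF ?ifT ?addnK //; lia.
case: ifPn => hp; last first.
  by rewrite lift_mid // drop_size.
by rewrite -(addn0 l1) lift_mid // drop0 burau_act_down ?addn0.
Qed.

Lemma lift_first_copy U x : lift U (firstc x) = coupon U x.
Proof.
case: x => l p; rewrite /first_copy /coupon /=; have [h|h|->] /= := ltngtP l l1.
- by rewrite /lift /= h.
- by rewrite /lift /= ifF ?ifT ?addnK //; lia.
case: ifPn => hp; first by rewrite -{1}(addn0 l1) lift_mid // drop0.
by rewrite lift_mid // drop_size /= burau_act_down.
Qed.

(** A point that is not a last copy has a layer of the braid ahead of it, above or
    below according to its orientation. *)
Lemma point_mid x : x \in points K -> (forall z, z \in points D0 -> x != lastc z) ->
  exists m p, (p < size st)%N /\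
   ([/\ x = (l1 + m, p)%N, (m < L)%N & nth false st p]
    \/ [/\ x = (l1 + m.+1, p)%N, (m < L)%N & ~~ nth false st p]).
Proof.
case: x => l p; rewrite mem_points (size_K D1 D2) => /andP /= [lK pl] ninL.
have [h|h] := ltnP l l1.
  have zD : (l, p) \in points D0.
    move: pl; rewrite /= profile_K_lo ?(ltnW h) // => pl.
    by rewrite mem_points /= pl andbT (leq_trans (ltnW h)) // l1_le.
  by have := ninL _ zD; rewrite /last_copy /= h eqxx.
have [h'|h'] := ltnP (l1 + L) l.
  have e : l = (l - L + L)%N by lia.
  have zD : (l - L, p)%N \in points D0.
    move: pl; rewrite /= {1}e profile_K_hi => [pl|]; last by lia.
    by rewrite mem_points /= pl andbT; move: lK; rewrite -/D0; lia.
  have := ninL _ zD; rewrite /last_copy /= ifF; last by lia.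
  by rewrite subnK ?eqxx //; lia.
have e : l = (l1 + (l - l1))%N by lia.
move: pl ninL; rewrite e; set m := (l - l1)%N.
have mL : (m <= L)%N by lia.
rewrite profile_K_mid // => pst ninL.
have xD : (l1, p) \in points D0 by rewrite mem_points /= pst l1_le.
have := ninL _ xD; rewrite /last_copy /= ltnn eqxx /=.
case: (boolP (nth false st p)) => hp /= ne.
  exists m, p; split=> //; left; split => //; rewrite ltn_neqAle mL andbT.
  by apply: contra ne => /eqP ->.
have m0 : (0 < m)%N.
  by rewrite lt0n; apply: contra ne => /eqP ->; rewrite addn0.
exists m.-1, p; split=> //; right; split => //; first by rewrite prednK.
by lia.
Qed.

Lemma lift_inner U x : x \in points K -> (forall z, z \in points D0 -> x != lastc z) ->
  lift U x = flow a K (lift U) x.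
Proof.
move=> xK ninL; have [m [p [pst [[e mL hp]|[e mL hp]]]]] := point_mid xK ninL; rewrite e.
  rewrite flow_K_mid_up // lift_mid 1?ltnW // (drop_nth 0%N) //=.
  by apply: sigma_act_ext => z; rewrite lift_mid.
rewrite flow_K_mid_down -?e // e !lift_mid // 1?ltnW //.
by rewrite !burau_act_down //; apply: sub_drop.
Qed.

(** The walk on [D0] that passes the coupon whenever it arrives at its line. *)
Definition coupon_mx : 'M[F]_N0 :=
  \matrix_(i, j) flow a D0 (coupon (fun z => (z == nth_pt D0 j)%:R)) (nth_pt D0 i).

Definition last_copy_ord (i : 'I_N0) : 'I_NK :=
  Ordinal (idx_lt K_knot (last_copy_mem w (nth_pt_mem D0_knot (ltn_ord i)))).

Lemma nth_pt_last_copy_ord i : nth_pt K (last_copy_ord i) = lastc (nth_pt D0 i).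
Proof. by rewrite /= idxK // last_copy_mem // nth_pt_mem. Qed.

Lemma last_copy_ord_inj : injective last_copy_ord.
Proof.
move=> i j e; apply/val_inj/eqP; rewrite /= -(nth_pt_eq D0_knot) //; apply/eqP.
by apply: (@last_copy_inj D1 D2 w); rewrite -!nth_pt_last_copy_ord e.
Qed.

Lemma notin_last_copy_ord (i : 'I_NK) : i \notin codom last_copy_ord ->
  forall z, z \in points D0 -> nth_pt K i != lastc z.
Proof.
move=> ni z /(point_ord D0_knot) [j ->]; apply: contra ni => /eqP e.
apply/codomP; exists j; apply/val_inj/eqP; rewrite /= -(nth_pt_eq K_knot) //.
  by rewrite idxK ?e // last_copy_mem // nth_pt_mem.
by apply: idx_lt; rewrite // last_copy_mem // nth_pt_mem.
Qed.

(** The matrix of [lift], which intertwines the walk on [K] with the walk on [D0]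
    through the coupon. *)
Definition lift_mx : 'M[F]_(NK, N0) :=
  \matrix_(i, j) lift (fun z => (z == nth_pt D0 j)%:R) (nth_pt K i).

Lemma lift_intertwine :
  (1%:M - walk_mx a K) *m lift_mx = incl_mx _ last_copy_ord *m (1%:M - coupon_mx).
Proof.
apply/matrixP => i k0; rewrite mulmxBl mul1mx.
pose U : pt -> F := fun z => (z == nth_pt D0 k0)%:R.
have E : (walk_mx a K *m lift_mx) i k0 = flow a K (lift U) (nth_pt K i).
  by rewrite mxE -(walk_mxE K_knot); apply: eq_bigr => j _; rewrite [lift_mx _ _]mxE.
rewrite [LHS]mxE [X in _ + X]mxE E mxE; rewrite [RHS]mxE -/U.
have iK : nth_pt K i \in points K by apply: nth_pt_mem.
have [/codomP [j ij]|ni] := boolP (i \in codom last_copy_ord).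
  rewrite (bigD1 j) //= !mxE ij eqxx mul1r big1 ?addr0; last first.
    by move=> m mj; rewrite !mxE (inj_eq last_copy_ord_inj) [j == _]eq_sym (negPf mj) mul0r.
  have jD : nth_pt D0 j \in points D0 by apply: nth_pt_mem.
  rewrite nth_pt_last_copy_ord lift_last_copy flow_K_last_copy // /U nth_pt_eq //; congr (_ - _).
  by apply: flow_ext => // z _; rewrite /= lift_first_copy.
rewrite big1 => [|m _]; last first.
  rewrite !mxE; have -> : (i == last_copy_ord m) = false by apply: contraNF ni => /eqP ->; rewrite codom_f.
  by rewrite mul0r.
by rewrite [in LHS]lift_inner ?subrr //; apply: notin_last_copy_ord.
Qed.

Lemma lift_mx_last_copy_ord i j : lift_mx (last_copy_ord i) j = (i == j)%:R.
Proof. by rewrite mxE nth_pt_last_copy_ord lift_last_copy nth_pt_eq. Qed.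

(** Inside the braid upward walkers climb and downward walkers descend, so the
    progress through the braid ranks the points to be eliminated. *)
Let inner_rank (i : 'I_NK) : nat :=
  if nth false st (nth_pt K i).2 then ((nth_pt K i).1 - l1)%N else (l1 + L - (nth_pt K i).1)%N.

Lemma inner_ranked (i j : 'I_NK) : i \notin codom last_copy_ord -> j \notin codom last_copy_ord ->
  walk_mx a K i j != 0 -> (inner_rank i < inner_rank j)%N.
Proof.
move=> ni nj; rewrite mxE /inner_rank.
have [iK jK] : nth_pt K i \in points K /\ nth_pt K j \in points K by split; apply: nth_pt_mem.
have [m [p [pst [[e mL hp]|[e mL hp]]]]] := point_mid iK (notin_last_copy_ord ni); rewrite e /=.
  rewrite flow_K_mid_up // hp => nz.
  have [z [ez hz]] : exists z, nth_pt K j = (l1 + m.+1, z)%N /\ nth false st z.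
    have /andP [h1 h2] := nth_w_up mL.
    move: nz; rewrite /sigma_act; case: (p =P nth 0%N w m) => [_|_].
      case: ((_, nth 0%N w m) =P nth_pt K j) => [<- _|_]; first by eexists; split; [reflexivity|].
      case: ((_, (nth 0%N w m).+1) =P nth_pt K j) => [<- _|_]; first by eexists; split; [reflexivity|].
      by rewrite !mulr0 addr0 eqxx.
    by case: (p =P _) => [_|_]; case: ((_, _) =P nth_pt K j) => [<- _|_]; rewrite ?eqxx //;
      eexists; split; [reflexivity| |reflexivity|].
  by rewrite ez /= hz; lia.
rewrite flow_K_mid_down -?e // (negbTE hp).
case: (_ =P nth_pt K j) => [<- _|_]; last by rewrite eqxx.
by rewrite /= (negbTE hp); lia.
Qed.

Lemma det_coupon : \det (1%:M - walk_mx a K) = \det (1%:M - coupon_mx).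
Proof.
exact: (det_elimination last_copy_ord_inj lift_mx_last_copy_ord lift_intertwine inner_ranked).
Qed.

Hypothesis unit_K : 1%:M - walk_mx a K \in unitmx.

Lemma unit_coupon : 1%:M - coupon_mx \in unitmx.
Proof. by rewrite unitmxE -det_coupon -unitmxE. Qed.

Definition green_coupon : pt -> pt -> F := entry_at (invmx (1%:M - coupon_mx)).

Lemma green_last_copy x y : x \in points D0 -> y \in points D0 ->
  green K a (lastc x) (lastc y) = green_coupon x y.
Proof.
move=> /(point_ord D0_knot) [i ->] /(point_ord D0_knot) [j ->].
rewrite -!nth_pt_last_copy_ord /green /green_coupon !entry_atE //.
rewrite (green_elimination unit_K unit_coupon lift_intertwine) mxE.
rewrite (bigD1 i) //= lift_mx_last_copy_ord eqxx mul1r big1 ?addr0 // => l li.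
by rewrite lift_mx_last_copy_ord [i == _]eq_sym (negPf li) mul0r.
Qed.

(** The coupon is linear, and it does not mix in positions beyond the end of its
    line, where the indicators vanish. *)
Lemma coupon_sum (U : pt -> F) x : x \in points D0 ->
  flow a D0 (coupon U) x =
  \sum_(j < N0) U (nth_pt D0 j) * flow a D0 (coupon (fun z => (z == nth_pt D0 j)%:R)) x.
Proof.
move=> xD; rewrite -(flow_sum D0 a _ _ (fun j : 'I_N0 => U (nth_pt D0 j))
   (fun j => coupon (fun z => (z == nth_pt D0 j)%:R))).
apply: flow_ext => // z zD; rewrite /coupon; case: eqP => zl; last first.
  by rewrite -(sum_delta D0_knot U zD).
under [RHS]eq_bigr => j _ do rewrite -burau_actZ.
have -> : \sum_(j < N0) burau_act a w (fun z0 => U (nth_pt D0 j) * ((l1, z0) == nth_pt D0 j)%:R) z.2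
  = burau_act a w (fun z0 => \sum_(j < N0) U (nth_pt D0 j) * ((l1, z0) == nth_pt D0 j)%:R) z.2.
  by rewrite (burau_act_sum a w (index_enum _) (fun (j : 'I_N0) z0 => U (nth_pt D0 j) * ((l1, z0) == nth_pt D0 j)%:R)).
have zst : (z.2 < size st)%N by move: zD; rewrite mem_points zl => /andP [].
pose V p := if (p < size st)%N then U (l1, p) else 0.
have VE p : \sum_(j < N0) U (nth_pt D0 j) * ((l1, p) == nth_pt D0 j)%:R = V p.
  rewrite /V; case: ifP => h.
    by apply: sum_delta => //; rewrite mem_points /= h l1_le.
  rewrite big1 // => j _; case: eqP => [e|]; last by rewrite mulr0.
  have : nth_pt D0 j \in points D0 by apply: nth_pt_mem.
  by rewrite -e mem_points /= h andbF.
rewrite [RHS](burau_act_ext a w VE).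
(* the values on the line after a braid only involve values on the line *)
suff : forall v, {subset v <= w} -> forall p, (p < size st)%N ->
    burau_act a v (fun p => U (l1, p)) p = burau_act a v V p.
  by apply=> //.
elim=> [|q v IH] sub p ph /=; first by rewrite /V ph.
have sv : {subset v <= w} by move=> x0 xv; apply: sub; rewrite inE xv orbT.
have /andP [/nth_true_lt h1 /nth_true_lt h2] := w_up (sub q (mem_head _ _)).
by rewrite /sigma_act -/(burau_act a v _) -/(burau_act a v V) !IH.
Qed.

(** ** Visits to a crossing of the braid *)

(** The number of arrivals at the bottom of the braid, at position [p]: visits to
    a point, times the weight of the step from there. *)
Definition return_visits (x : pt) (p : nat) : F :=
  \sum_(j < N0) green_coupon x (nth_pt D0 j) * flow a D0 (fun z => (z == (l1, p))%:R) (nth_pt D0 j).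

Definition return_act (f : nat -> F) (p : nat) : F :=
  \sum_(i < n) f (k + i)%N * return_visits (l1, p) (k + i).

Definition dirac (q0 p : nat) : F := (p == q0)%:R.

Lemma burau_act_dirac_out v q0 p : {subset v <= w} -> (k <= q0 < k + n)%N ->
  ~~ (k <= p < k + n)%N -> burau_act a v (dirac q0) p = 0.
Proof.
move=> sub hq hp; rewrite burau_act_fix => [|q /sub /w_disc hq'].
  by rewrite /dirac; case: eqP => // e; rewrite e hq in hp.
lia.
Qed.

(** Apart from the start itself, a walker comes back to the height of the [m]-th
    crossing only by leaving the braid through the top, returning to its bottom and
    climbing again: these are the three operators, from the outside inwards. *)
Lemma green_mid m q0 p : (m < L)%N -> (k <= q0 < k + n)%N -> (k <= p < k + n)%N ->
  green K a (l1 + m, p)%N (l1 + m, q0)%N =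
  (p == q0)%:R + burau_act a (drop m w) (return_act (burau_act a (take m w) (dirac q0))) p.
Proof.
move=> mL hq hp.
pose src := burau_act a (take m w) (dirac q0).
have sub_take : {subset take m w <= w} by move=> z /mem_take.
pose b (x : pt) : F := flow a D0 (fun z => (z.1 == l1)%:R * src z.2) x.
pose Uo (x : pt) : F := \sum_(j < N0) green_coupon x (nth_pt D0 j) * b (nth_pt D0 j).
have UoE x : x \in points D0 -> Uo x = b x + flow a D0 (coupon Uo) x.
  move=> /[dup] xD /(point_ord D0_knot) [i xi]; rewrite coupon_sum // xi.
  pose M := 1%:M - coupon_mx.
  pose v : 'cV[F]_N0 := \col_j b (nth_pt D0 j).
  have E : M *m (invmx M *m v) = v by rewrite mulmxA mulmxV ?mul1mx //; exact: unit_coupon.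
  have Uo_i (j : 'I_N0) : (invmx M *m v) j 0 = Uo (nth_pt D0 j).
    by rewrite mxE; apply: eq_bigr => l _; rewrite [v _ _]mxE /green_coupon entry_atE.
  have := congr1 (fun B : 'cV[F]_N0 => B i 0) E.
  rewrite mulmxBl mul1mx mxE [X in _ + X]mxE Uo_i [v _ _]mxE => <-.
  rewrite mxE -addrA [X in _ = Uo _ + X](_ : _ = 0) ?addr0 //.
  rewrite addrC; apply/eqP; rewrite subr_eq0; apply/eqP/eq_bigr => j _.
  by rewrite [coupon_mx _ _]mxE Uo_i mulrC.
(* [ex] counts the visits of a direct climb from below, [Uo] the visits of walkers
   starting outside the braid; [V] is then a solution of the equation for visits *)
pose ex (x : pt) : F := if (l1 <= x.1 <= l1 + m)%N
  then burau_act a (take (m - (x.1 - l1)) (drop (x.1 - l1) w)) (dirac q0) x.2 else 0.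
have ex_down l z : ~~ nth false st z -> ex (l, z) = 0.
  move=> hz; rewrite /ex /=; case: ifP => // _; apply: burau_act_dirac_out => //.
    by move=> c /mem_take /mem_drop.
  by apply: contra hz => /disc_up.
pose V x := lift Uo x + ex x.
have q0_up := disc_up hq; have p_up := disc_up hp.
have stK z : (z < size st)%N -> (l1 + m, z)%N \in points K.
  move=> hz; rewrite mem_points (size_K D1 D2) /= profile_K_mid ?(ltnW mL) // hz andbT.
  by have := l1_le D1 D2; lia.
have yK := stK _ (nth_true_lt q0_up).
rewrite (green_uniq K_knot (U := V) unit_K yK) ?stK ?nth_true_lt //.
  rewrite /V lift_mid ?(ltnW mL) // addrC /ex /= leq_addr leqnn addKn subnn take0 /=.
  congr (_ + _); apply: burau_act_ext => z; rewrite /Uo /return_act.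
  under eq_bigr => j _ do rewrite /b.
  under [RHS]eq_bigr => i _ do rewrite /return_visits mulr_sumr.
  rewrite exchange_big /=; apply: eq_bigr => j _.
  under [RHS]eq_bigr => i _ do rewrite mulrCA.
  rewrite -mulr_sumr; congr (_ * _).
  rewrite -(flow_sum D0 a _ _ (fun i : 'I_n => src (k + i)%N) (fun (i : 'I_n) z => (z == (l1, k + i)%N)%:R)).
  have jD : nth_pt D0 j \in points D0 by apply: nth_pt_mem.
  apply: flow_ext => // -[l c] _ /=.
  have [->|nl] := eqVneq l l1; last first.
    rewrite mul0r big1 // => i _; rewrite xpair_eqE (negPf nl) mulr0 //.
  rewrite mul1r; have [mean_visits|mean_visits] := boolP (k <= c < k + n)%N.
    have cn : (c - k < n)%N by lia.
    rewrite (bigD1 (Ordinal cn)) //= subnKC; last by lia.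
    rewrite eqxx mulr1 big1 ?addr0 // => i ic; rewrite xpair_eqE eqxx /=.
    have -> : (c == k + i)%N = false.
      by apply: contraNF ic => /eqP e; apply/eqP/val_inj; rewrite /= e addKn.
    by rewrite mulr0.
  rewrite /src burau_act_dirac_out // big1 // => i _; rewrite xpair_eqE eqxx /=.
  have -> : (c == k + i)%N = false by have := ltn_ord i; lia.
  by rewrite mulr0.
move=> x xK.
have [/existsP [j /eqP xj]|ninL] := boolP [exists j : 'I_N0, x == lastc (nth_pt D0 j)].
  have jD : nth_pt D0 j \in points D0 by apply: nth_pt_mem.
  rewrite xj flow_K_last_copy // /V lift_last_copy.
  have exL z : z \in points D0 -> ex (lastc z) = 0.
    case: z => l c zD; rewrite /last_copy /=; case: ltngtP => //= h.
    - by rewrite /ex /= leqNgt h.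
    - by rewrite /ex /= ifF //; lia.
    case: ifPn => mean_visits; first exact: ex_down.
    by rewrite /ex /= ifF //; lia.
  rewrite exL // addr0.
  have -> : (lastc (nth_pt D0 j) == (l1 + m, q0)%N) = false.
    case: (nth_pt D0 j) => l c; rewrite /last_copy /=; case: ltngtP => //= h; rewrite ?xpair_eqE; try lia.
    case: ifPn => mean_visits; rewrite xpair_eqE; last lia.
    by case: eqP => //= _; apply: contraNF mean_visits => /eqP ->.
  rewrite add0r UoE // -flowD; apply: flow_ext => // z zD /=.
  rewrite lift_first_copy addrC; congr (_ + _).
  case: z zD => l c zD; rewrite /first_copy /=; case: ltngtP => //= h.
  - by rewrite /ex /= leqNgt h mul0r.
  - by rewrite /ex /= ifF ?mul0r //; lia.
  rewrite mul1r h; case: ifPn => mean_visits.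
    by rewrite /ex /= leqnn leq_addr subnn subn0 drop0.
  rewrite (ex_down _ _ mean_visits) /src burau_act_dirac_out //.
  by apply: contra mean_visits => /disc_up.
have {}ninL z : z \in points D0 -> x != lastc z.
  move=> /(point_ord D0_knot) [j ->]; apply: contra ninL => h.
  by apply/existsP; exists j.
rewrite /V lift_inner // addrC [in RHS]flowD addrCA addrC; congr (_ + _).
have [m' [p' [pst [[e mL' hp']|[e mL' hp']]]]] := point_mid xK ninL; rewrite e.
  rewrite flow_K_mid_up //.
  have [lt|] := ltnP m' m.
    rewrite xpair_eqE ltn_eqF ?ltn_add2l //= add0r /ex /= leq_addr leq_add2l (ltnW lt) addKn.
    have -> : (m - m' = (m - m'.+1).+1)%N by lia.
    rewrite (drop_nth 0%N) //=; apply: sigma_act_ext => z.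
    by rewrite leq_addr leq_add2l lt addKn.
  rewrite leq_eqVlt => /orP [/eqP em|lt].
    rewrite /ex /= -em leq_addr leqnn addKn subnn take0 /= xpair_eqE eqxx /=.
    rewrite -[LHS]addr0; congr (_ + _); rewrite -[LHS](burau_act0 a [:: nth 0%N w m] p').
    by apply: sigma_act_ext => z; rewrite ifF //; lia.
  rewrite xpair_eqE eq_sym ltn_eqF ?ltn_add2l //= add0r {1}/ex /= ifF; last by lia.
  rewrite -[LHS](burau_act0 a [:: nth 0%N w m'] p'); apply: sigma_act_ext => z.
  by rewrite /ex /= ifF //; lia.
rewrite flow_K_mid_down -?e // !ex_down // addr0 e xpair_eqE.
have -> : (p' == q0) = false by apply: contraNF hp' => /eqP ->.
by rewrite andbF ex_down.
Qed.

End Lift.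

(** * The full twist *)

Definition twist_word (k n : nat) : seq nat := flatten (nseq n (iota k n.-1)).
Definition twists (k n t : nat) : seq nat := flatten (nseq t (twist_word k n)).

Lemma braid_flatten (s : seq (seq nat)) :
  braid (flatten s) = flatten [seq braid v | v <- s].
Proof. by rewrite /braid map_flatten. Qed.

Lemma full_twistE k n : full_twist k n = braid (twist_word k n).
Proof.
rewrite /twist_word braid_flatten map_nseq /full_twist; congr (flatten (nseq n _)).
by rewrite -[in RHS](addn0 k) iotaDl /braid -map_comp.
Qed.

Lemma full_twistsE k n t : flatten (nseq t (full_twist k n)) = braid (twists k n t).
Proof. by rewrite /twists braid_flatten map_nseq full_twistE. Qed.

Lemma size_twist_word k n : size (twist_word k n) = (n * n.-1)%N.
Proof. by rewrite size_flatten /shape map_nseq size_iota sumn_nseq mulnC. Qed.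

Lemma size_twists k n t : size (twists k n t) = (t * (n * n.-1))%N.
Proof. by rewrite size_flatten /shape map_nseq size_twist_word sumn_nseq mulnC. Qed.

Lemma twistsS k n t : twists k n t.+1 = twist_word k n ++ twists k n t.
Proof. by []. Qed.

Lemma twistsD k n s t : twists k n (s + t) = twists k n s ++ twists k n t.
Proof. by rewrite /twists nseqD flatten_cat. Qed.

Lemma mem_twist_word k n q : q \in twist_word k n -> (k <= q)%N && (q.+1 < k + n)%N.
Proof. by case/flattenP => v /nseqP [-> _]; rewrite mem_iota; lia. Qed.

Lemma mem_twists k n t q : q \in twists k n t -> (k <= q)%N && (q.+1 < k + n)%N.
Proof. by case/flattenP => v /nseqP [-> _]; apply: mem_twist_word. Qed.

Lemma follow_cat v w p : follow (v ++ w) p = follow w (follow v p).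
Proof. exact: foldl_cat. Qed.

Lemma follow_iota k m p : follow (iota k m) p =
  if p == k then (k + m)%N else if (k < p <= k + m)%N then p.-1 else p.
Proof.
elim: m k p => [|m IH] k p; first by rewrite /= addn0; do ?[case: ifP]; lia.
rewrite -[LHS]/(follow (iota k.+1 m) (swap k p)) IH /swap.
have [_|pk] := eqVneq p k; first by rewrite eqxx addSnnS.
have [->|pk1] := eqVneq p k.+1.
  have -> : (k == k.+1) = false by lia.
  have -> : (k.+1 < k)%N = false by lia.
  by have -> : (k < k.+1 <= k + m.+1)%N by lia.
rewrite (negbTE pk1); have -> : (k.+1 < p <= k.+1 + m)%N = (k < p <= k + m.+1)%N by lia.
by [].
Qed.

Lemma follow_cycle k n i : (i < n)%N ->
  follow (iota k n.-1) (k + i) = (k + (i + n.-1) %% n)%N.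
Proof.
move=> i_n; rewrite follow_iota; case: (posnP i) => [->|i0].
  by rewrite addn0 eqxx add0n modn_small //; lia.
rewrite (_ : (k + i == k)%N = false); last by lia.
have -> : (i + n.-1 = i.-1 + n)%N by lia.
rewrite modnDr modn_small; last by lia.
rewrite (_ : (k < k + i <= k + n.-1)%N); lia.
Qed.

Lemma follow_twist_word k n p : follow (twist_word k n) p = p.
Proof.
have [-> //|n0] := posnP n.
have [h|h] := boolP (k <= p < k + n)%N; last first.
  rewrite /twist_word; elim: {-2}n => [|m IH] //=.
  rewrite follow_cat follow_iota; have -> : (p == k) = false by lia.
  have -> : (k < p <= k + n.-1)%N = false by lia.
  exact: IH.
have -> : p = (k + (p - k))%N by lia.
have : (p - k < n)%N by lia.
move: (p - k)%N => i i_n.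
have it m j : (j < n)%N -> follow (flatten (nseq m (iota k n.-1))) (k + j) = (k + (j + m * n.-1) %% n)%N.
  elim: m j => [|m IH] j j_n; first by rewrite mul0n addn0 modn_small.
  rewrite /= follow_cat follow_cycle // IH ?ltn_mod //.
  by rewrite modnDml mulSn addnA.
by rewrite it // [(i + _)%N]addnC [(n * _)%N]mulnC modnMDl modn_small.
Qed.

Lemma follow_twists k n t : follow (twists k n t) =1 id.
Proof.
elim: t => [|t IH] p //; by rewrite twistsS follow_cat follow_twist_word IH.
Qed.

Section TwistBurau.
Variables (F : fieldType) (a : F) (k n : nat).
Local Notation in_disc p := (k <= p < k + n)%N.

(** Each [sigma_act] preserves this sum: up to a factor, the powers of [a] are the
    stationary distribution of the walk on the positions of the disc. *)
Definition weight (f : nat -> F) : F := \sum_(q < n) a ^+ q * f (k + q)%N.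

Lemma sigma_act_weight q f : (k <= q)%N -> (q.+1 < k + n)%N ->
  weight (sigma_act a q f) = weight f.
Proof.
move=> h h'; have i_n : (q - k < n)%N by lia.
have i_n' : ((q - k).+1 < n)%N by lia.
pose i := Ordinal i_n; pose j := Ordinal i_n'.
have ji : j != i by rewrite -val_eqE /=; lia.
rewrite /weight (bigD1 i) // (bigD1 j) //= [RHS](bigD1 i) // [in RHS](bigD1 j) //=.
rewrite !addrA; congr (_ + _).
  have -> : (k + (q - k) = q)%N by lia.
  have -> : (k + (q - k).+1 = q.+1)%N by lia.
  rewrite /sigma_act eqxx ifF; last by lia.
  rewrite eqxx exprS; ring.
apply: eq_bigr => m /andP [mi mj]; rewrite /sigma_act.
have -> : (k + m == q)%N = false.
  by apply: contraNF mi => /eqP e; rewrite -val_eqE /=; lia.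
have -> // : (k + m == q.+1)%N = false.
by apply: contraNF mj => /eqP e; rewrite -val_eqE /=; lia.
Qed.

Lemma burau_act_weight w f : braid_on k n w ->
  weight (burau_act a w f) = weight f.
Proof.
elim: w f => [|q w IH] f //= h; have /andP [h1 h2] := h q (mem_head _ _).
by rewrite sigma_act_weight // IH // => z zw; apply: h; rewrite inE zw orbT.
Qed.

Lemma burau_act_disc w f g : braid_on k n w ->
  (forall p, in_disc p -> f p = g p) ->
  forall p, in_disc p -> burau_act a w f p = burau_act a w g p.
Proof.
elim: w => [|q w IH] h fg p hp /=; first exact: fg.
have /andP [h1 h2] := h q (mem_head _ _).
have {}IH z : in_disc z -> burau_act a w f z = burau_act a w g z.
  by apply: IH => // y yw; apply: h; rewrite inE yw orbT.
by rewrite /sigma_act -/(burau_act a w f) -/(burau_act a w g) !IH //; lia.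
Qed.

Lemma burau_act_const w c p : burau_act a w (fun=> c) p = c.
Proof.
elim: w p => [|q w IH] p //=; rewrite (sigma_act_ext _ _ IH) /sigma_act.
by case: eqP => _; [ring | case: eqP].
Qed.

(** In the cycle [sigma_j .. sigma_(j + m - 1)] the leftmost strand passes over
    all others, and these move one position to the left. *)
Lemma burau_act_iota j m f p : burau_act a (iota j m) f p =
  if p == j then (1 - a) * (\sum_(i < m) a ^+ i * f (j + i)%N) + a ^+ m * f (j + m)%N
  else if (j < p <= j + m)%N then f p.-1 else f p.
Proof.
elim: m j p => [|m IH] j p.
  rewrite /= big_ord0 mulr0 add0r expr0 mul1r addn0.
  case: eqP => [->//|]; case: ifP => //; lia.
rewrite -[LHS]/(sigma_act a j (burau_act a (iota j.+1 m) f) p) /sigma_act !IH.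
rewrite !eqxx.
have -> : (j == j.+1) = false by lia.
have -> : (j.+1 < j)%N = false by lia.
rewrite andFb; have [_|pj] := eqVneq p j.
  rewrite big_ord_recl /= expr0 mul1r addn0 addnS exprS.
  under eq_bigr => i _ do rewrite addSnnS.
  have -> : \sum_(i < m) a ^+ bump 0 i * f (j + bump 0 i)%N =
       a * \sum_(i < m) a ^+ i * f (j + i.+1)%N.
    by rewrite mulr_sumr; apply: eq_bigr => i _; rewrite /bump /= add1n exprS mulrA.
  rewrite addSn; ring.
have [->|pj1] := eqVneq p j.+1; first by rewrite ifT //; lia.
by congr (if _ then _ else _); lia.
Qed.

(** The first [m] strands have passed over the disc once; since [weight] is
    invariant, each of them has picked up the same term. *)
Lemma burau_act_cycles m f i : (i < n)%N -> (m <= n)%N ->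
  burau_act a (flatten (nseq m (iota k n.-1))) f (k + i)%N =
  if (m <= i)%N then f (k + (i - m))%N
  else (1 - a) * weight f + a ^+ n * f (k + (n - (m - i)))%N.
Proof.
elim: m f i => [|m IH] f i i_n mn; first by rewrite /= subn0.
have -> : nseq m.+1 (iota k n.-1) = nseq m (iota k n.-1) ++ [:: iota k n.-1].
  by rewrite -[m.+1]addn1 nseqD.
rewrite flatten_cat burau_act_cat /= cats0 IH //; last exact: ltnW.
have inw : braid_on k n (iota k n.-1).
  by move=> q; rewrite mem_iota; lia.
rewrite burau_act_weight //; case: (ltngtP m i) => [lt|gt|em].
- rewrite burau_act_iota (_ : (k + (i - m) == k)%N = false); last by lia.
  rewrite (_ : (k < k + (i - m) <= k + n.-1)%N = true); last by lia.
  by have -> : ((k + (i - m)).-1 = k + (i - m.+1))%N by lia.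
- rewrite burau_act_iota (_ : (k + (n - (m - i)) == k)%N = false); last by lia.
  rewrite (_ : (k < k + (n - (m - i)) <= k + n.-1)%N = true); last by lia.
  by have -> : ((k + (n - (m - i))).-1 = k + (n - (m.+1 - i)))%N by lia.
rewrite em subnn addn0 burau_act_iota eqxx subSnn.
have n0 : n = n.-1.+1 by lia.
have -> : weight f = \sum_(q < n.-1) a ^+ q * f (k + q)%N + a ^+ n.-1 * f (k + n.-1)%N.
  rewrite /weight -!(big_mkord xpredT (fun q => a ^+ q * f (k + q)%N)).
  by rewrite {1}n0 big_nat_recr.
have -> : a ^+ n = a * a ^+ n.-1 by rewrite -exprS -n0.
have -> : (n - 1 = n.-1)%N by lia.
ring.
Qed.

Lemma burau_act_twist_word f p : in_disc p ->
  burau_act a (twist_word k n) f p = a ^+ n * f p + (1 - a) * weight f.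
Proof.
move=> hp; have -> : p = (k + (p - k))%N by lia.
have i_n : (p - k < n)%N by lia.
rewrite /twist_word burau_act_cycles // ifF; last by lia.
by rewrite addrC; congr (_ * f _ + _); lia.
Qed.

Hypothesis an1 : 1 - a ^+ n != 0.

(** The powers of [a], normalized to have sum one. *)
Definition stat (q : nat) : F := a ^+ q * ((1 - a) / (1 - a ^+ n)).
Definition mean (f : nat -> F) : F := \sum_(q < n) stat q * f (k + q)%N.

Lemma meanE f : mean f = (1 - a) / (1 - a ^+ n) * weight f.
Proof.
by rewrite /mean /weight mulr_sumr; apply: eq_bigr => q _; rewrite /stat; ring.
Qed.

Lemma mean_weight f : (1 - a) * weight f = (1 - a ^+ n) * mean f.
Proof. by rewrite meanE mulrA; congr (_ * _); rewrite mulrCA mulfV // mulr1. Qed.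

Lemma burau_act_mean w f : braid_on k n w ->
  mean (burau_act a w f) = mean f.
Proof. by move=> h; rewrite !meanE burau_act_weight. Qed.

(** One full twist is [a ^+ n + (1 - a ^+ n) * mean], and [mean] is a projection
    which commutes with it, so the powers are immediate. *)
Lemma burau_act_twists t f p : in_disc p ->
  burau_act a (twists k n t) f p = a ^+ (n * t) * f p + (1 - a ^+ (n * t)) * mean f.
Proof.
elim: t => [|t IH] hp; first by rewrite muln0 expr0 subrr mul0r addr0 mul1r.
rewrite twistsS burau_act_cat burau_act_twist_word // mean_weight burau_act_mean; last first.
  by move=> q; apply: mem_twists.
rewrite IH // mulnS exprD; ring.
Qed.

End TwistBurau.

(** * The family of twisted diagrams *)

Lemma flow_sub (F : fieldType) (a : F) D U c V x :
  flow a D (fun z => U z - c * V z) x = flow a D U x - c * flow a D V x.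
Proof.
rewrite /flow; case: eqP => _; first by rewrite mulr0 subr0.
by case: (crossing_at D x.1) => [[[s o] u]|] //; case: eqP => _ //; ring.
Qed.

Lemma sum_halves (F : fieldType) t L :
  \sum_(r < L) \sum_(a < t) (1 / 2%:R) = t%:R * (L%:R / 2%:R) :> F.
Proof.
rewrite !sumr_const !card_ord mul1r -mulrnA -[_ *+ (t * L)]mulr_natr natrM.
by rewrite mulrC -mulrA.
Qed.

(** ** The contribution of one crossing of the twists *)

Section Quadratic.
Variables (F : fieldType) (a : F).
Implicit Types M N : bool -> bool -> F.

(** [lin] and [quad] are the linear and the bilinear part of [R1 + 1 / 2] for a
    positive crossing as functions of the visits [M], the visit of the starting
    point excluded; [false] is the over-point and [true] the under-point. *)
Definition lin M : F := a * M true false - M true true.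
Definition quad M N : F :=
  2%:R * M true false * N true true - M true false * N false true
  - M false false * N true true
  + (1 - a) * M true false * (N true false - N false false).

Definition exponents : seq (nat * nat) :=
  [:: (1, 0); (2, 0); (0, 1); (0, 2); (1, 1); (2, 1); (1, 2); (2, 2)]%N.

(** For [M = A + y B + z C + y z E] with [lin A = 0] and [quad A A = 0], the
    coefficient of [y ^+ e.1 * z ^+ e.2] in [lin M + quad M M], for [e] in
    [exponents]. *)
Definition coefs (A B C E : bool -> bool -> F) (e : nat * nat) : F :=
  match e with
  | (1%N, 0%N) => lin B + quad A B + quad B A
  | (2%N, 0%N) => quad B B
  | (0%N, 1%N) => lin C + quad A C + quad C A
  | (0%N, 2%N) => quad C C
  | (1%N, 1%N) => lin E + quad A E + quad E A + quad B C + quad C B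
  | (2%N, 1%N) => quad B E + quad E B
  | (1%N, 2%N) => quad C E + quad E C
  | (2%N, 2%N) => quad E E
  | _ => 0
  end.

Variables (pi h y z : F) (W V : bool -> F) (K : bool -> bool -> F).
Let P (q : bool) : F := if q then a * pi else pi.
Let A (p q : bool) : F := P q * h.
Let B (p q : bool) : F := W q - P q * h.
Let C (p q : bool) : F := P q * (V p - h).
Let E (p q : bool) : F := K p q - P q * V p - W q + P q * h.
Let M (p q : bool) : F :=
  y * z * K p q + z * (1 - y) * P q * V p + (1 - z) * y * W q
  + (1 - z) * (1 - y) * P q * h.

(** In the bulk of the twists [y] and [z] vanish, and there the number of visits
    does not depend on the start and is stationary in the end, [M p q = P q * h].
    On such [M] both [lin] and [quad] vanish, so the crossing contributes
    [- 1 / 2]. *)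
Lemma R1_of_bulk :
  R1_of 1 a (1 + M false false) (M false true) (M true false) (1 + M true true) =
  - (1 / 2%:R) + \sum_(e <- exponents) coefs A B C E e * (y ^+ e.1 * z ^+ e.2).
Proof.
rewrite /exponents !big_cons big_nil /= /R1_of /lin /quad /M /A /B /C /E /P.
ring.
Qed.

End Quadratic.

Section Family.
Variables (n : nat) (D1 D2 : diagram) (k : nat).
Let D0 := D1 ++ D2.
Local Notation l1 := (size D1).
Local Notation N0 := (size (points D0)).
Local Notation w := (twists k n).
Local Notation K t := (D1 ++ braid (w t) ++ D2).

Hypothesis n_gt0 : (0 < n)%N.
Hypothesis D0_knot : upright_long_knot D0.
Hypothesis disc : forall i, (i < n)%N -> nth false (top_profile D1) (k + i).

Lemma disc_up p : (k <= p < k + n)%N -> nth false (profile D0 l1) p.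
Proof.
move=> h; rewrite profile_cat_le // profile_size.
have -> : p = (k + (p - k))%N by lia.
by apply: disc; lia.
Qed.

Lemma w_disc t : braid_on k n (w t).
Proof. by move=> q; apply: mem_twists. Qed.

Lemma w_pure t : follow (w t) =1 id. Proof. exact: follow_twists. Qed.

Lemma family_knot t : upright_long_knot (K t).
Proof. exact: (braid_knot D0_knot (w_up disc_up (@w_disc t)) (@w_pure t)). Qed.

Definition disc_pt (i : 'I_n) : pt := (l1, k + i)%N.

Lemma disc_pt_mem i : disc_pt i \in points D0.
Proof.
rewrite mem_points /= size_cat leq_addr /=; apply: nth_true_lt.
by apply: disc_up; have := ltn_ord i; lia.
Qed.

Lemma disc_pt_eq i j : (disc_pt i == disc_pt j) = (i == j).
Proof. by rewrite /disc_pt xpair_eqE eqxx /= eqn_add2l. Qed.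

Section Coupon.
Variables (F : fieldType) (a : F).
Hypothesis an1 : 1 - a ^+ n != 0.
Local Notation A0 := (walk_mx a D0).

(** A coupon of [t] full twists is [1 - (1 - a ^+ (n * t)) * center_mx] on the
    disc, which [disc_mx] embeds into the points of the diagram. *)
Definition center_mx : 'M[F]_n := 1%:M - \matrix_(i, j) stat a n j.
Definition disc_mx : 'M[F]_(n, N0) := \matrix_(i, j) (nth_pt D0 j == disc_pt i)%:R.

Lemma coupon_delta t (j : 'I_N0) z : z \in points D0 ->
  coupon D1 (w t) a (fun z => (z == nth_pt D0 j)%:R) z =
  (z == nth_pt D0 j)%:R - (1 - a ^+ (n * t)) *
    \sum_i (z == disc_pt i)%:R * (center_mx *m disc_mx) i j.
Proof.
move=> zD; rewrite /coupon; have [zl|zl] := eqVneq z.1 l1; last first.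
  rewrite big1 ?mulr0 ?subr0 // => i _.
  by case: eqP => [e|]; rewrite ?mul0r //; rewrite e eqxx in zl.
case: z zD zl => l p zD /= ->.
have [hp|hp] := boolP (k <= p < k + n)%N; last first.
  rewrite burau_act_fix => [|q /w_disc]; last by lia.
  rewrite big1 ?mulr0 ?subr0 // => i _; rewrite xpair_eqE eqxx /=.
  have -> : (p == k + i)%N = false by have := ltn_ord i; lia.
  by rewrite mul0r.
rewrite burau_act_twists //.
have pn : (p - k < n)%N by lia.
have ep : (l1, p) = disc_pt (Ordinal pn) by rewrite /disc_pt /= subnKC //; lia.
rewrite ep (bigD1 (Ordinal pn)) //= eqxx mul1r big1 ?addr0; last first.
  by move=> i ip; rewrite disc_pt_eq eq_sym (negPf ip) mul0r.
rewrite mulmxBl mul1mx !mxE.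
have -> : \sum_j0 (\matrix_(_, j1) stat a n j1 : 'M_n) (Ordinal pn) j0 * disc_mx j0 j =
    mean a k n (fun p0 : nat => ((l1, p0) == nth_pt D0 j)%:R).
  by rewrite /mean; apply: eq_bigr => i _; rewrite !mxE eq_sym.
by rewrite [_ == nth_pt D0 j]eq_sym; move: (mean _ _ _ _) => m; ring.
Qed.

Lemma coupon_mxE t :
  coupon_mx D1 D2 (w t) a = A0 - (1 - a ^+ (n * t)) *: (A0 *m (disc_mx^T *m (center_mx *m disc_mx))).
Proof.
apply/matrixP => i j; rewrite mxE [RHS]mxE [X in _ = _ + X]mxE.
rewrite [X in _ = _ - X]mxE [X in _ = _ - _ * X]mxE [A0 i j]mxE.
pose V z := \sum_l (z == disc_pt l)%:R * (center_mx *m disc_mx) l j.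
have -> : \sum_l A0 i l * (disc_mx^T *m (center_mx *m disc_mx)) l j = flow a D0 V (nth_pt D0 i).
  rewrite -(walk_mxE D0_knot); apply: eq_bigr => l _; congr (_ * _).
  by rewrite mxE; apply: eq_bigr => m _; rewrite !mxE.
rewrite -flow_sub; apply: flow_ext => //; first by apply: nth_pt_mem.
by move=> z zD; rewrite coupon_delta.
Qed.

(** Visits between the points of the disc, the visit at the start excluded. *)
Definition visits_mx : 'M[F]_n := \matrix_(i, j) (green D0 a (disc_pt i) (disc_pt j) - (i == j)%:R).

Hypothesis unit0 : 1%:M - A0 \in unitmx.

Lemma visits_mxE : visits_mx = disc_mx *m (invmx (1%:M - A0) *m A0) *m disc_mx^T.
Proof.
have -> : invmx (1%:M - A0) *m A0 = invmx (1%:M - A0) - 1%:M.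
  by have := mulVmx unit0; rewrite mulmxBr mulmx1 => e; rewrite -[X in _ = _ - X]e subKr.
have PP : disc_mx *m disc_mx^T = 1%:M.
  apply/matrixP => i j; rewrite !mxE.
  have [l el] := point_ord D0_knot (disc_pt_mem i).
  rewrite (bigD1 l) //= !mxE -el eqxx mul1r disc_pt_eq big1 ?addr0 // => m ml.
  rewrite !mxE el nth_pt_eq //; have -> : (m == l :> nat) = false by apply: contraNF ml => /eqP e; apply/eqP/val_inj.
  by rewrite mul0r.
rewrite mulmxBr mulmxBl mulmx1 PP; apply/matrixP => i j.
rewrite [RHS]mxE [X in _ = _ + X]mxE [X in _ = _ - X]mxE mxE; congr (_ - _).
rewrite /green /entry_at mxE exchange_big /= big_mkcond /=; apply: eq_bigr => l _.
rewrite !mxE; case: ifP => h; last by rewrite mulr0.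
rewrite mulr1 big_mkcond; apply: eq_bigr => m _; rewrite mxE.
by case: ifP => _; rewrite ?mul1r ?mul0r.
Qed.

(** The coupon changes the walk by a matrix that factors through the disc, so
    the change of the determinant is an [n] by [n] determinant. *)
Lemma det_mix c :
  \det (1%:M - (A0 - c *: (A0 *m (disc_mx^T *m (center_mx *m disc_mx))))) =
  \det (1%:M - A0) * \det (1%:M + c *: (center_mx *m visits_mx)).
Proof.
pose X := invmx (1%:M - A0) *m A0 *m disc_mx^T.
have -> : 1%:M - (A0 - c *: (A0 *m (disc_mx^T *m (center_mx *m disc_mx)))) =
   (1%:M - A0) *m (1%:M - (- c *: X) *m (center_mx *m disc_mx)).
  rewrite mulmxBr mulmx1 opprB addrCA addrC; congr (_ + _).
  rewrite -scalemxAl -scalemxAr scaleNr opprK; congr (_ *: _).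
  by rewrite /X !mulmxA mulmxV // mul1mx.
rewrite det_mulmx det_1_sub_mulC; congr (_ * \det _).
rewrite -scalemxAr scaleNr opprK; congr (_ + _ *: _).
by rewrite visits_mxE /X !mulmxA.
Qed.

End Coupon.

(** ** The Alexander polynomials of the family *)

Lemma one_sub_Tn_neq0 m : (0 < m)%N -> 1 - T ^+ m != 0 :> ratfun.
Proof.
move=> m0; rewrite /T -tofracXn -tofrac1 -tofracB tofrac_eq0 subr_eq0.
apply/eqP => e; have := size_polyXn int m; rewrite -e size_poly1; lia.
Qed.

Local Notation an1 := (one_sub_Tn_neq0 n_gt0).
Local Notation Z := (center_mx T).
Local Notation Gm := (visits_mx T).
Local Notation delta t := (\det (1%:M - A_mx (K t))).
Local Notation delta0 := (\det (1%:M - walk_mx T D0)).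

Lemma deltaE t : delta t = delta0 * \det (1%:M + (1 - T ^+ (n * t)) *: (Z *m Gm)).
Proof.
rewrite (det_strands (family_knot t)).
rewrite (det_coupon D0_knot disc_up (@w_disc t) (@w_pure t)).
by rewrite coupon_mxE ?an1 // det_mix //; exact: unit_walk.
Qed.

Lemma hv_delta t : has_value (delta t) 1 1.
Proof. by rewrite (det_strands (family_knot t)); apply: hv_det_walk (family_knot t). Qed.

Definition delta_lim : ratfun := delta0 * \det (1%:M + Z *m Gm).

Definition center1 : 'M[rat]_n := \matrix_(i, j) ((i == j)%:R - n%:R^-1).
Definition visits1 : 'M[rat]_n := \matrix_(i, j) (idx D0 (disc_pt i) < idx D0 (disc_pt j))%N%:R.

Lemma hv_stat q : has_value (stat T n q) 1 n%:R^-1.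
Proof.
have E : stat T n q = T ^+ q * (\sum_(i < n) T ^+ i)^-1.
  rewrite /stat; congr (_ * _).
  have -> : 1 - T ^+ n = (1 - T) * \sum_(i < n) T ^+ i.
    by rewrite -[LHS]opprB subrX1 -mulNr opprB.
  rewrite invfM mulrA mulfV ?mul1r //.
  exact: (@one_sub_Tn_neq0 1).
rewrite E -[X in has_value _ _ X]mul1r; apply: hvM.
  have := hvX q (hvT 1); by rewrite expr1n.
apply: hvV; last by rewrite pnatr_eq0 -lt0n.
have -> : n%:R = \sum_(i < n) 1 :> rat by rewrite sumr_const card_ord.
apply: hv_sum => i _; have := hvX i (hvT 1); by rewrite expr1n.
Qed.

Lemma hv_center i j : has_value (Z i j) 1 (center1 i j).
Proof. by rewrite !mxE; apply: hvB; [exact: hv_nat_of_bool | exact: hv_stat]. Qed.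

Lemma idx_disc_pt_inj i j : (idx D0 (disc_pt i) == idx D0 (disc_pt j)) = (i == j).
Proof.
rewrite -(nth_pt_eq D0_knot) ?(idx_lt D0_knot (disc_pt_mem _)) //.
by rewrite !(idxK D0_knot (disc_pt_mem _)) disc_pt_eq.
Qed.

Lemma hv_visits i j : has_value (Gm i j) 1 (visits1 i j).
Proof.
have -> : visits1 i j = (idx D0 (disc_pt i) <= idx D0 (disc_pt j))%N%:R - (i == j)%:R.
  have -> : (idx D0 (disc_pt i) <= idx D0 (disc_pt j))%N
      = (i == j) || (idx D0 (disc_pt i) < idx D0 (disc_pt j))%N.
    by rewrite leq_eqVlt idx_disc_pt_inj.
  rewrite mxE; case: eqP => [->|_]; first by rewrite ltnn subrr.
  by rewrite subr0.
rewrite mxE; apply: hvB; last exact: hv_nat_of_bool.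
by apply: hv_green; rewrite // disc_pt_mem.
Qed.

Lemma hv_center_visits i j : has_value ((Z *m Gm) i j) 1 ((center1 *m visits1) i j).
Proof.
rewrite !mxE; apply: hv_sum => l _; apply: hvM; [exact: hv_center | exact: hv_visits].
Qed.

(** Each pair of points of the disc is counted in exactly one order. *)
Lemma sum_visits1 : \sum_i \sum_j visits1 i j = 'C(n, 2)%:R.
Proof.
have two : 2%:R * (\sum_i \sum_j visits1 i j) = (n * n.-1)%:R.
  rewrite mulr_natl mulr2n {1}exchange_big /= -big_split /=.
  under eq_bigr => i _.
    rewrite -big_split /=.
    rewrite (eq_bigr (fun j => 1 - (i == j)%:R)) => [|j _]; last first.
      rewrite !mxE -idx_disc_pt_inj; case: ltngtP => _; rewrite ?addr0 ?add0r ?subr0 ?subrr //.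
    rewrite big_split /= sumr_const card_ord sumrN (bigD1 i) //= eqxx big1 ?addr0; last first.
      by move=> j ji; rewrite eq_sym (negPf ji).
    over.
  rewrite sumr_const card_ord natrM mulr_natl; congr (_ *+ n).
  by rewrite -subn1 natrB.
apply: (mulfI (_ : 2%:R != 0 :> rat)); first by rewrite pnatr_eq0.
by rewrite two -natrM -mul_bin_diag bin1.
Qed.

Lemma trace_center_visits1 : \tr (center1 *m visits1) = - ('C(n, 2)%:R / n%:R).
Proof.
rewrite -sum_visits1 exchange_big /= mulr_suml -sumrN /mxtrace.
have -> : \sum_i (center1 *m visits1) i i = \sum_i \sum_j center1 i j * visits1 j i.
  by apply: eq_bigr => i _; rewrite mxE.
apply: eq_bigr => i _; rewrite mulr_suml -sumrN; apply: eq_bigr => j _.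
rewrite !mxE; have [->|_] := eqVneq i j; first by rewrite ltnn !mulr0 mul0r oppr0.
by rewrite sub0r mulNr mulrC.
Qed.

(** With [u] the column of ones, [center1 = 1 - u u^T / n]. The matrix
    [1 + visits1] is unitriangular and maps the indicator [e] of the last point of
    the disc to [u], so it can be factored out and leaves a rank one perturbation
    of the identity. *)
Lemma det_center_visits1 : \det (1%:M + center1 *m visits1) = n%:R^-1.
Proof.
pose u : 'cV[rat]_n := \col_i 1.
have [m mmax] : exists m : 'I_n, forall i, (idx D0 (disc_pt i) <= idx D0 (disc_pt m))%N.
  have i0 := Ordinal n_gt0.
  by exists [arg max_(i > i0) idx D0 (disc_pt i)]; case: arg_maxnP => // i _ h j; apply: h.
pose e : 'cV[rat]_n := \col_i (i == m)%:R.
have Ge i : (visits1 *m e) i 0 = (i != m)%:R.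
  rewrite mxE (bigD1 m) //= !mxE eqxx mulr1 big1 ?addr0.
    by rewrite ltn_neqAle mmax andbT idx_disc_pt_inj.
  by move=> j jm; rewrite !mxE (negPf jm) mulr0.
have Te : (1%:M + visits1) *m e = u.
  apply/colP => i; rewrite mulmxDl mul1mx mxE Ge !mxE.
  by case: eqP => _; rewrite ?addr0 ?add0r.
have Z1E : center1 = 1%:M - n%:R^-1 *: (u *m u^T).
  apply/matrixP => i j; rewrite !mxE big_ord1 !mxE !mulr1.
  by [].
have -> : 1%:M + center1 *m visits1 = (1%:M + visits1) *m (1%:M - e *m (n%:R^-1 *: (u^T *m visits1))).
  rewrite mulmxBr mulmx1 mulmxA Te Z1E mulmxBl mul1mx addrA; congr (_ - _).
  by rewrite -scalemxAl -scalemxAr mulmxA.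
rewrite det_mulmx det_rank_one.
have -> : \det (1%:M + visits1) = 1.
  rewrite -[visits1]opprK; apply: (@det_1_sub_ranked _ _ _ (fun i => idx D0 (disc_pt i))) => i j.
  by rewrite mxE oppr_eq0 mxE pnatr_eq0 eqb0 negbK.
rewrite mul1r -scalemxAl mxE -mulmxA [(u^T *m _) 0 0]mxE.
rewrite (bigD1 m) //= Ge eqxx mulr0 add0r.
rewrite (eq_bigr (fun=> 1)) => [|i im]; last by rewrite Ge im !mxE mulr1.
have nz : n%:R != 0 :> rat by rewrite pnatr_eq0 -lt0n.
have e1 : n.-1%:R = n%:R - 1 :> rat by rewrite -subn1 natrB.
by rewrite sumr_const cardC1 card_ord e1 mulrBr mulVf // mulr1 subKr.
Qed.

(** Evaluation does not commute with the limit: each [delta t] has the value one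
    at [T = 1]. *)
Lemma hv_delta_lim : has_value delta_lim 1 n%:R^-1.
Proof.
rewrite -[X in has_value _ _ X]mul1r -det_center_visits1; apply: hvM; first exact: hv_det_walk.
apply: hv_det => i j; rewrite [X in has_value X]mxE [X in has_value _ _ X]mxE.
apply: hvD; last exact: hv_center_visits.
by rewrite !mxE; exact: hv_nat_of_bool.
Qed.

Lemma first_order_of_value f (b : int) : has_value f 1 b%:~R ->
  exists2 u, reg 1 u & f = b%:~R + (T - 1) * u.
Proof.
move=> fb; have [u ru e] : exists2 u, exists v, has_value u 1 v & f - b%:~R = (T - 1%:~R) * u.
  by apply: hv_factor; rewrite -(subrr b%:~R); apply: hvB => //; apply: hv_int.
by exists u => //; rewrite -e addrC subrK.
Qed.

(** To first order only the trace of [Z *m Gm] matters, which is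
    minus the number of pairs over [n]; this [n] cancels that of [T ^+ (n * t)]. *)
Lemma jet1_det t : jet1 (\det (1%:M + (1 - T ^+ (n * t)) *: (Z *m Gm))) (t * 'C(n, 2))%:Z.
Proof.
pose S : ratfun := \sum_(i < n * t) T ^+ i.
pose Y := - S *: (Z *m Gm).
have hS : has_value S 1 (n * t)%:R.
  have -> : (n * t)%:R = \sum_(i < n * t) 1 :> rat by rewrite sumr_const card_ord.
  apply: hv_sum => i _; have := hvX i (hvT 1); by rewrite expr1n.
have hY i j : has_value (Y i j) 1 (- (n * t)%:R * (center1 *m visits1) i j).
  by rewrite mxE; apply: hvM (hv_center_visits i j); apply: hvN.
have -> : (1 - T ^+ (n * t)) *: (Z *m Gm) = (T - 1) *: Y.
  by rewrite scalerA mulrN -subrX1 opprB.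
have [u ru ->] := @det_1_add_scale _ (reg 1) n Y (T - 1) (reg0 1) (reg1 1) (regT1 1)
   (@regD 1) (@regN 1) (@regM 1) (fun i j => ex_intro _ _ (hY i j)).
have htr : has_value (\tr Y) 1 (t * 'C(n, 2))%:Z%:~R.
  have -> : (t * 'C(n, 2))%:Z%:~R = \sum_i - (n * t)%:R * (center1 *m visits1) i i :> rat.
    have nz : n%:R != 0 :> rat by rewrite pnatr_eq0 -lt0n.
    rewrite -mulr_sumr -/(\tr (center1 *m visits1)) trace_center_visits1 mulrNN.
    rewrite -[LHS]/((t * 'C(n, 2))%:R) !natrM.
    by move: n%:R nz => N nz; field.
  by apply: hv_sum => i _; exact: hY.
have [v rv ->] := first_order_of_value htr.
exists (v + u); first exact: regD.
move: (_%:~R) (T - 1) => b z; ring.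
Qed.

(** Opposite exponents are paired: [T ^ r + T ^ (- r) - 2] vanishes to second order
    at [T = 1]. *)
Lemma jet1_symmetric (p : laurent) :
  (forall r : int, p (- r) = p r) -> \sum_(r <- finsupp p) p r = 1 ->
  jet1 (ratfun_of p) 0.
Proof.
move=> sym sum1.
have rev : perm_eq (finsupp p) [seq - r | r <- finsupp p].
  apply: uniq_perm; rewrite ?fset_uniq ?(map_inj_uniq oppr_inj) ?fset_uniq // => r.
  rewrite -[r in RHS]opprK (mem_map oppr_inj) !mem_finsupp sym //.
have E2 : ratfun_of p = \sum_(r <- finsupp p) (p r)%:~R * T ^ (- r).
  rewrite /ratfun_of (perm_big _ rev) /= big_map; apply: eq_bigr => r _.
  by rewrite sym.
have one : 1 = \sum_(r <- finsupp p) (p r)%:~R :> ratfun.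
  by rewrite -rmorph_sum /= sum1.
have jr (r : int) : exists2 u, reg 1 u & T ^ r + T ^ (- r) - 2%:R = (T - 1) ^+ 2 * u.
  have [u1 r1 e1] := jet1_exprz r; have [u2 r2 e2] := jet1_exprz (- r).
  exists (u1 + u2); first exact: regD.
  rewrite e1 e2 intrN; move: (r%:~R) (T - 1) => b z; ring.
have half : exists2 u, reg 1 u & 2%:R * (ratfun_of p - 1) = (T - 1) ^+ 2 * u.
  have -> : 2%:R * (ratfun_of p - 1) =
     \sum_(r <- finsupp p) (p r)%:~R * (T ^ r + T ^ (- r) - 2%:R).
    have -> : \sum_(r <- finsupp p) (p r)%:~R * (T ^ r + T ^ (- r) - 2%:R) =
      ratfun_of p + \sum_(r <- finsupp p) (p r)%:~R * T ^ (- r)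
       - (\sum_(r <- finsupp p) (p r)%:~R) * 2%:R.
      rewrite mulr_suml -sumrN -!big_split /=; apply: eq_bigr => r _.
      by rewrite mulrBr mulrDr.
    rewrite -one -E2; move: (ratfun_of p) => x; ring.
  elim: (finsupp p : seq int) => [|r s [u ru IH]].
    by exists 0; [exact: reg0 | rewrite big_nil mulr0].
  have [u' ru' e'] := jr r; exists ((p r)%:~R * u' + u).
    by apply: regD => //; apply: regM => //; apply: reg_int.
  by rewrite big_cons IH e' mulrCA mulrDr.
have [u ru e] := half; exists (u / 2%:R).
  case: ru => c uc; exists (c / 2%:R); apply: hvM uc _.
  by apply: hvV; [exact: hv_nat | rewrite pnatr_eq0].
have two : 2%:R != 0 :> ratfun by apply: hv_neq0 (hv_nat 1 2) _; rewrite pnatr_eq0.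
rewrite mul0r addr0 mulrA -e mulrAC mulfV // mul1r addrC subrK //.
Qed.

Lemma bool_sign_hv (e : bool) f : has_value f 1 1 -> has_value ((-1) ^+ e * f) 1 1 -> e = false.
Proof.
case: e => // f1; rewrite expr1 mulN1r => h.
by have := hv_uniq h (hvN f1).
Qed.

(** The sign in the definition is positive because both polynomials have the value
    one at [T = 1]. *)
Lemma alexander_exponent t p : symmetrized_alexander (K t) p ->
  exists2 m : int, ratfun_of p = T ^ m * delta t & jet1 (T ^ m * delta t) 0.
Proof.
move=> [[e [m E]] sym sum1]; have J := jet1_symmetric sym sum1.
have h1 : has_value (T ^ m * delta t) 1 1.
  rewrite -[X in has_value _ _ X]mul1r; apply: hvM (hv_delta t).
  exact: jet1_value (jet1_exprz m).
have e0 : e = false.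
  apply: (@bool_sign_hv e (T ^ m * delta t)) => //.
  by have := jet1_value J; rewrite E mulrA.
by exists m; move: J; rewrite E e0 expr0 mul1r.
Qed.

(** The symmetrized polynomials have derivative zero at [T = 1], while [delta t]
    is [delta 0] times a factor with derivative [t n (n - 1) / 2]: so the exponent
    that symmetrizes [delta t] drops by this amount. *)
Lemma alexander_square : (exists p0, symmetrized_alexander (K 0) p0) ->
  exists m0 : int, forall t p, symmetrized_alexander (K t) p ->
    T ^+ (t * n * (n - 1)) * ratfun_of p ^+ 2 = (T ^ m0 * delta t) ^+ 2.
Proof.
case=> p0 /alexander_exponent [m0 _ J0]; exists m0 => t p /alexander_exponent [m -> J].
have d0 : delta 0 = delta0.
  by rewrite deltaE muln0 expr0 subrr scale0r addr0 det1 mulr1.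
have E : T ^ m * delta t = T ^ (m - m0) *
   ((T ^ m0 * delta 0) * \det (1%:M + (1 - T ^+ (n * t)) *: (Z *m Gm))).
  by rewrite -mulrA d0 -deltaE mulrA -expfzDr ?T_neq0 // subrK.
have J2 := jet1M (jet1_exprz (m - m0)) (jet1M J0 (jet1_det t)).
rewrite -E in J2; have := jet1_uniq J J2; rewrite add0r => em.
have -> : m0 = m + (t * 'C(n, 2))%:Z by move: em; lia.
rewrite expfzDr ?T_neq0 // -exprnP.
have -> : T ^+ (t * n * (n - 1)) = T ^+ (t * 'C(n, 2)) ^+ 2.
  have e : (n * (n - 1) = 'C(n, 2) * 2)%N.
    by rewrite subn1 -[n.-1 in LHS]bin1 mul_bin_diag mulnC.
  by rewrite -exprM -!mulnA e.
by move: (T ^ m) (T ^+ _) (delta t) => x y z; ring.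
Qed.


(** ** Convergence of the visits *)

Local Notation Gt t := (green_coupon D1 D2 (w t) T).

Lemma delta_lim_neq0 : delta_lim != 0.
Proof. by apply: hv_neq0 hv_delta_lim _; rewrite invr_eq0 pnatr_eq0 -lt0n. Qed.

Lemma tends_Tn : tends (fun t => T ^+ (n * t)) 0.
Proof.
apply: (@tends_ext (fun t => T ^+ (n * t) * 1)) => [t|]; first by rewrite mulr1.
by apply: tends_pow_mul => // t; apply: reg1.
Qed.

Lemma tends_one_sub_pow c : tends (fun t => (1 - T ^+ (n * t)) * c) c.
Proof.
rewrite -[X in tends _ X]mul1r -[X in tends _ (X * _)](subr0 1).
by apply: tendsM (tends_const _); apply: tendsB (tends_const _) tends_Tn.
Qed.

Lemma tends_delta : tends (fun t => delta t) delta_lim.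
Proof.
apply: (@tends_ext _ _ _ (fun t => esym (deltaE t))).
apply: tendsM; first exact: tends_const.
apply: tends_det => i j.
have e t : (1%:M + (1 - T ^+ (n * t)) *: (Z *m Gm)) i j =
   (1%:M : 'M_n) i j + (1 - T ^+ (n * t)) * (Z *m Gm) i j.
  by rewrite mxE [X in _ + X]mxE.
apply: (@tends_ext _ _ _ (fun t => esym (e t))); rewrite [X in tends _ X]mxE.
by apply: tendsD (tends_const _) (tends_one_sub_pow _).
Qed.

Lemma unit_Kt t : 1%:M - walk_mx T (K t) \in unitmx.
Proof. exact: unit_walk (family_knot t). Qed.

(** The coupon tends to the projection [mean]. The matrix of the limit is invertible
    because its determinant is [delta_lim]. *)
Lemma conv_green_coupon x y : x \in points D0 -> y \in points D0 -> conv (fun t => Gt t x y).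
Proof.
move=> /(point_ord D0_knot) [i ->] /(point_ord D0_knot) [j ->].
pose B := walk_mx T D0 *m ((disc_mx ratfun)^T *m (Z *m disc_mx ratfun)).
exists (invmx (1%:M - (walk_mx T D0 - 1 *: B)) i j).
apply: (@tends_ext (fun t => invmx (1%:M - coupon_mx D1 D2 (w t) T) i j)).
  by move=> t; rewrite /green_coupon entry_atE.
apply: tends_invmx.
- move=> t; exact: (unit_coupon D0_knot disc_up (@w_disc t) (@w_pure t) (unit_Kt t)).
- rewrite unitmxE unitfE det_mix; last exact: unit_walk.
  by rewrite scale1r; exact: delta_lim_neq0.
move=> i' j'; apply: (@tends_ext (fun t =>
    (1%:M : 'M_N0) i' j' - (walk_mx T D0 i' j' - (1 - T ^+ (n * t)) * B i' j'))).
  move=> t; rewrite coupon_mxE ?an1 // [RHS]mxE; congr (_ + _).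
  by rewrite [RHS]mxE [in RHS]mxE; congr (- (_ + _)); rewrite [RHS]mxE [in RHS]mxE.
have -> : (1%:M - (walk_mx T D0 - 1 *: B)) i' j'
    = (1%:M : 'M_N0) i' j' - (walk_mx T D0 i' j' - B i' j').
  by rewrite scale1r [LHS]mxE; congr (_ + _); rewrite [LHS]mxE [in LHS]mxE; congr (- (_ + _)); rewrite [LHS]mxE.
apply: tendsB (tends_const _) _; apply: tendsB (tends_const _) _.
exact: tends_one_sub_pow.
Qed.

(** ** The crossings outside the twists *)

Lemma crossing_at_K_hi_omap t l : (l1 <= l)%N -> crossing_at (K t) (l + size (w t))%N =
  omap (fun c => (c.1.1, ((l + size (w t))%N, c.1.2.2), ((l + size (w t))%N, c.2.2)))
       (crossing_at D0 l).
Proof.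
move=> h; rewrite /crossing_at onth_K_hi //; case: (onth D0 l) => [[k' [b|b|]]|] //.
by case: b.
Qed.

Definition R1_term (t : nat) (D : diagram) (l : nat) : ratfun :=
  if crossing_at D l is Some (s, o, u) then R1 D (s, strand D o, strand D u) else 0.

(** The contribution of a crossing outside the twists, in terms of the diagram [D0],
    which does not depend on [t]. *)
Definition R1_out (t l : nat) : ratfun :=
  if crossing_at D0 l is Some (s, o, u)
  then R1_of s%:~R (T ^ s) (Gt t o o) (Gt t o u) (Gt t u o) (Gt t u u) else 0.

Lemma green_K_last_copy t x y : x \in points D0 -> y \in points D0 ->
  green (K t) T (last_copy D1 D2 (w t) x) (last_copy D1 D2 (w t) y) = Gt t x y.
Proof.
exact: (green_last_copy D0_knot disc_up (@w_disc t) (@w_pure t) (unit_Kt t)).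
Qed.

Lemma R1_term_last_copy t l s o u : crossing_at D0 l = Some (s, o, u) ->
  R1_term t (K t) (last_copy D1 D2 (w t) o).1 = R1_out t l.
Proof.
move=> E; have E' := crossing_at_K_last_copy (w t) D0_knot E.
have [oD uD _ _ _] := crossing_at_points D0_knot E.
by rewrite /R1_term /R1_out E' E (R1_green (family_knot t) E') !green_K_last_copy.
Qed.

Lemma R1_term_lo t l : (l < l1)%N -> R1_term t (K t) l = R1_out t l.
Proof.
move=> h; case E : (crossing_at D0 l) => [[[s o] u]|]; last first.
  by rewrite /R1_term /R1_out crossing_at_K_lo // E.
rewrite -(R1_term_last_copy t E); have [_ _ _ ol _] := crossing_at_points D0_knot E.
by congr R1_term; rewrite /last_copy ol h.
Qed.

Lemma R1_term_hi t l : (l1 <= l)%N -> R1_term t (K t) (l + size (w t))%N = R1_out t l.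
Proof.
move=> h; case E : (crossing_at D0 l) => [[[s o] u]|]; last first.
  by rewrite /R1_term /R1_out crossing_at_K_hi_omap // E.
rewrite -(R1_term_last_copy t E); have [_ _ _ ol _] := crossing_at_points D0_knot E.
have [uo _] := crossing_at_up D0_knot E.
congr R1_term; rewrite /last_copy ol ltnNge h /=; case: eqP => //= e.
by rewrite -e uo.
Qed.

Lemma R1_sum_split t :
  \sum_(c <- crossings (K t)) R1 (K t) c =
  \sum_(l <- iota 0 (size D0)) R1_out t l
  + \sum_(m < size (w t)) R1_term t (K t) (l1 + m)%N.
Proof.
rewrite big_crossings -/(R1_term t (K t)).
rewrite (eq_bigr (R1_term t (K t))) //.
have -> : size (K t) = (l1 + size (w t) + size D2)%N.
  by rewrite !size_cat size_map addnA.
rewrite size_cat !iotaD !add0n !big_cat /= -addrA [X in _ = X]addrAC -addrA.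
congr (_ + _).
  by apply: eq_big_seq => l; rewrite mem_iota => /andP [_ h]; rewrite R1_term_lo.
congr (_ + _).
  rewrite -[l1 in iota l1 _]addn0 iotaDl big_map -{1}[size (w t)]subn0.
  by rewrite -/(index_iota 0 (size (w t))) big_mkord.
rewrite [(l1 + _)%N]addnC iotaDl big_map; apply: eq_big_seq => l.
by rewrite mem_iota => /andP [h _]; rewrite addnC R1_term_hi.
Qed.

Lemma conv_R1_of s (a : ratfun) goo gou guo guu :
  conv goo -> conv gou -> conv guo -> conv guu ->
  conv (fun t => R1_of s a (goo t) (gou t) (guo t) (guu t)).
Proof.
move=> c1 c2 c3 c4; rewrite /R1_of; apply: convM (conv_const _) _.
have c5 : conv (fun t => guu t + (1 - a) * guo t).
  by apply: convD => //; apply: convM (conv_const _) _.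
apply: convB (conv_const _); apply: convB; apply: convM => //.
  by apply: convB => //; apply: convD => //; apply: convB (conv_const _).
by apply: convB (conv_const _).
Qed.

Lemma conv_R1_out : conv (fun t => \sum_(l <- iota 0 (size D0)) R1_out t l).
Proof.
apply: conv_sum => l _; rewrite /R1_out; case E : (crossing_at D0 l) => [[[s o] u]|].
  have [oD uD _ _ _] := crossing_at_points D0_knot E.
  by apply: conv_R1_of; apply: conv_green_coupon.
exact: conv_const.
Qed.

(** ** The turning numbers *)

(** There are no turns inside the braid. *)
Lemma turning_family t :
  \sum_(x <- points (K t))
     ((step (K t) x).2)%:~R / 2%:R * (green (K t) T x x - 1 / 2%:R) =
  \sum_(z <- points D0)
     ((step D0 z).2)%:~R / 2%:R * (Gt t z z - 1 / 2%:R) :> ratfun.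
Proof.
set f := fun x => _; pose ims := [seq last_copy D1 D2 (w t) z | z <- points D0].
rewrite (bigID (fun x => x \in ims)) /= [X in _ + X]big1_seq ?addr0; last first.
  move=> x /andP [nims xK].
  have ninL z : z \in points D0 -> x != last_copy D1 D2 (w t) z.
    by move=> zD; apply: contra nims => /eqP ->; apply: map_f.
  have [m [p [pst [[-> mL hp]|[-> mL hp]]]]] := point_mid xK ninL.
    by rewrite /f /= profile_K_mid 1?ltnW // hp onth_K_mid // mul0r mul0r.
  by rewrite /f /= profile_K_mid // (negbTE hp) addnS /= onth_K_mid // mul0r mul0r.
rewrite -big_filter (perm_big ims) /=; last first.
  apply: uniq_perm.
  - by rewrite filter_uniq // uniq_points.
  - by rewrite map_inj_uniq ?uniq_points //; exact: last_copy_inj.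
  move=> x; rewrite mem_filter; case: (boolP (x \in ims)) => //= /mapP [z zD ->].
  exact: last_copy_mem.
rewrite /ims big_map; apply: eq_big_seq => z zD; rewrite /f green_K_last_copy //.
have [->|zt] := eqVneq z (top_end D0).
  rewrite last_copy_top // /= !profile_top //; last exact: family_knot.
  by rewrite /= !onth_default.
by rewrite step_last_copy.
Qed.

Lemma conv_turning : conv (fun t => \sum_(z <- points D0)
     ((step D0 z).2)%:~R / 2%:R * (Gt t z z - 1 / 2%:R) : ratfun).
Proof.
apply: conv_sum => z zD; apply: convM (conv_const _) _.
by apply: convB (conv_const _); apply: conv_green_coupon.
Qed.


(** ** The crossings of the twists *)

Local Notation Lw := (n * n.-1)%N.
Local Notation tw := (twist_word k n).
Local Notation Hact t := (return_act D1 D2 (w t) k n T).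

Lemma big_blocks (f : nat -> ratfun) t L :
  \sum_(m < t * L) f m = \sum_(a < t) \sum_(r < L) f (a * L + r)%N.
Proof.
elim: t => [|t IH]; first by rewrite mul0n !big_ord0.
rewrite big_ord_recr /= -IH mulSn addnC -!(big_mkord xpredT f).
rewrite (@big_cat_nat _ _ _ (t * L)) ?leq_addr //=; congr (_ + _).
rewrite -{1}[(t * L)%N]add0n big_addn addKn big_mkord; apply: eq_bigr => r _.
by rewrite addnC.
Qed.

Lemma conv_return_act f p : (k <= p < k + n)%N -> conv (fun t => Hact t f p).
Proof.
move=> hp; rewrite /return_act.
apply: (@conv_ext (fun t => \sum_(i <- enum 'I_n) f (k + i)%N * return_visits D1 D2 (w t) T (l1, p) (k + i))).
  by move=> t; rewrite big_enum.
apply: conv_sum => i _; apply: convM (conv_const _) _; rewrite /return_visits.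
apply: (@conv_ext (fun t => \sum_(j <- enum 'I_N0) Gt t (l1, p) (nth_pt D0 j) *
   flow T D0 (fun z => (z == (l1, k + i)%N)%:R) (nth_pt D0 j))).
  by move=> t; rewrite big_enum.
apply: conv_sum => j _; apply: convM (conv_const _); apply: conv_green_coupon.
  have pn : (p - k < n)%N by lia.
  by have := disc_pt_mem (Ordinal pn); rewrite /disc_pt /= subnKC //; lia.
by apply: nth_pt_mem.
Qed.

Lemma conv_mean (f : nat -> nat -> ratfun) :
  (forall p, (k <= p < k + n)%N -> conv (fun t => f t p)) ->
  conv (fun t => mean T k n (f t)).
Proof.
move=> cf; rewrite /mean.
apply: (@conv_ext (fun t => \sum_(q <- enum 'I_n) stat T n q * f t (k + q)%N)).
  by move=> t; rewrite big_enum.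
apply: conv_sum => q _; apply: convM (conv_const _) _; apply: cf.
by have := ltn_ord q; lia.
Qed.

Lemma conv_burau_act v (f : nat -> nat -> ratfun) p :
  braid_on k n v ->
  (forall p, (k <= p < k + n)%N -> conv (fun t => f t p)) ->
  (k <= p < k + n)%N -> conv (fun t => burau_act T v (f t) p).
Proof.
elim: v p => [|q v IH] p hv cf hp; first exact: cf.
have /andP [h1 h2] := hv q (mem_head _ _).
have {}IH z : (k <= z < k + n)%N -> conv (fun t => burau_act T v (f t) z).
  by apply: IH => // y yv; apply: hv; rewrite inE yv orbT.
rewrite /= /sigma_act; case: eqP => _.
  by apply: convD; apply: convM (conv_const _) _; apply: IH; lia.
by case: eqP => _; apply: IH; lia.
Qed.

Section Bulk.
Variables (u v : seq nat).
Hypothesis uv_disc : braid_on k n (u ++ v).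

Lemma Hact_disc t f g p : (forall z, (k <= z < k + n)%N -> f z = g z) ->
  Hact t f p = Hact t g p.
Proof.
move=> fg; apply: eq_bigr => i _; rewrite fg //.
by have := ltn_ord i; lia.
Qed.

Lemma Hact_lin t c f d p :
  Hact t (fun z => c * f z + d) p = c * Hact t f p + d * Hact t (fun=> 1) p.
Proof.
rewrite /return_act !mulr_sumr -big_split /=; apply: eq_bigr => i _.
by rewrite mulrDl mul1r mulrA.
Qed.

Lemma mean_dirac q : (k <= q < k + n)%N -> mean T k n (dirac _ q) = stat T n (q - k).
Proof.
move=> hq; have qn : (q - k < n)%N by lia.
rewrite /mean (bigD1 (Ordinal qn)) //= /dirac subnKC; last by lia.
rewrite eqxx mulr1 big1 ?addr0 // => i iq.
have -> : (k + i == q)%N = false.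
  by apply: contraNF iq => /eqP e; apply/eqP/val_inj; rewrite /= -e addKn.
by rewrite mulr0.
Qed.

Lemma burau_act_lin s c f d p :
  burau_act T s (fun z => c * f z + d) p = c * burau_act T s f p + d.
Proof. by rewrite (burau_actD _ _ (fun z => c * f z) (fun=> d)) burau_actZ burau_act_const. Qed.

(** The formula of [green_mid] for the braid [u ++ v] between [a] and [b] full
    twists. By [burau_act_twists] the twists below and above multiply by [y] and
    [z] and replace the rest by the mean, which [u] and [v] preserve. *)
Lemma visits_bulk t a b p q : (k <= p < k + n)%N -> (k <= q < k + n)%N ->
  let y := T ^+ (n * a) in let z := T ^+ (n * b) in
  burau_act T (v ++ w b) (Hact t (burau_act T (w a ++ u) (dirac _ q))) p =
  y * z * burau_act T v (Hact t (burau_act T u (dirac _ q))) p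
  + z * (1 - y) * stat T n (q - k) * burau_act T v (Hact t (fun=> 1)) p
  + (1 - z) * y * mean T k n (Hact t (burau_act T u (dirac _ q)))
  + (1 - z) * (1 - y) * stat T n (q - k) * mean T k n (Hact t (fun=> 1)).
Proof.
move=> hp hq y z.
have u_disc : braid_on k n u.
  by move=> c cu; apply: uv_disc; rewrite mem_cat cu.
have v_disc : braid_on k n v.
  by move=> c cv; apply: uv_disc; rewrite mem_cat cv orbT.
pose f := burau_act T u (dirac ratfun q).
have Hf c : Hact t (burau_act T (w a ++ u) (dirac ratfun q)) c
   = y * Hact t f c + (1 - y) * stat T n (q - k) * Hact t (fun=> 1) c.
  rewrite -Hact_lin; apply: Hact_disc => c' mean_visits.
  rewrite burau_act_cat burau_act_twists //; last exact: an1.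
  by rewrite burau_act_mean // mean_dirac.
rewrite burau_act_cat.
pose h c := y * Hact t f c + (1 - y) * stat T n (q - k) * Hact t (fun=> 1) c.
have -> : burau_act T v (burau_act T (w b) (Hact t (burau_act T (w a ++ u) (dirac _ q)))) p
    = burau_act T v (fun c => z * h c + (1 - z) * mean T k n h) p.
  apply: (burau_act_disc T v_disc _ hp) => c mean_visits.
  rewrite burau_act_twists //; last exact: an1.
  rewrite Hf; congr (_ + _ * _).
  by apply: eq_bigr => i _; rewrite Hf.
rewrite burau_act_lin (burau_actD _ _ (fun c => y * Hact t f c)
   (fun c => (1 - y) * stat T n (q - k) * Hact t (fun=> 1) c)) !burau_actZ.
have -> : mean T k n h
   = y * mean T k n (Hact t f) + (1 - y) * stat T n (q - k) * mean T k n (Hact t (fun=> 1)).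
  rewrite /mean !mulr_sumr -big_split /=; apply: eq_bigr => i _.
  by rewrite mulrDr !(mulrCA (stat T n i)).
rewrite -/f; move: (burau_act _ _ _ _) (burau_act _ _ _ _) (mean _ _ _ _) (mean _ _ _ _) (stat _ _ _).
by move: {Hf h} y z => y z c1 c2 c3 c4 c5; ring.
Qed.

End Bulk.

Lemma conv_quad (M N : nat -> bool -> bool -> ratfun) :
  (forall p q, conv (fun t => M t p q)) -> (forall p q, conv (fun t => N t p q)) ->
  conv (fun t => quad T (M t) (N t)).
Proof.
move=> cM cN; rewrite /quad; apply: convD.
  apply: convB; last exact: convM.
  apply: convB; last exact: convM.
  by apply: convM => //; apply: convM => //; apply: conv_const.
apply: convM; last exact: convB.
by apply: convM => //; apply: conv_const.
Qed.

Lemma conv_lin (M : nat -> bool -> bool -> ratfun) :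
  (forall p q, conv (fun t => M t p q)) -> conv (fun t => lin T (M t)).
Proof.
by move=> cM; apply: convB => //; apply: convM => //; apply: conv_const.
Qed.

Lemma conv_coefs (A B C E : nat -> bool -> bool -> ratfun) e :
  (forall p q, conv (fun t => A t p q)) -> (forall p q, conv (fun t => B t p q)) ->
  (forall p q, conv (fun t => C t p q)) -> (forall p q, conv (fun t => E t p q)) ->
  conv (fun t => coefs T (A t) (B t) (C t) (E t) e).
Proof.
move=> cA cB cC cE; case: e => [[|[|[|i]]] [|[|[|j]]]]; try exact: conv_const.
- exact (convD (convD (conv_lin cC) (conv_quad cA cC)) (conv_quad cC cA)).
- exact (conv_quad cC cC).
- exact (convD (convD (conv_lin cB) (conv_quad cA cB)) (conv_quad cB cA)).
- exact (convD (convD (convD (convD (conv_lin cE) (conv_quad cA cE))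
    (conv_quad cE cA)) (conv_quad cB cC)) (conv_quad cC cB)).
- exact (convD (conv_quad cC cE) (conv_quad cE cC)).
- exact (conv_quad cB cB).
- exact (convD (conv_quad cB cE) (conv_quad cE cB)).
- exact (conv_quad cE cE).
Qed.

Section Block.
Variable r : nat.
Hypothesis r_lt : (r < Lw)%N.
Let q := nth 0%N tw r.
Let u := take r tw.
Let v := drop r tw.
Let pos (b : bool) : nat := if b then q.+1 else q.

Lemma q_disc : (k <= q)%N && (q.+1 < k + n)%N.
Proof. by apply: mem_twist_word; rewrite mem_nth // size_twist_word. Qed.

Lemma pos_disc b : (k <= pos b < k + n)%N.
Proof. by have := q_disc; case: b; rewrite /pos; lia. Qed.

Lemma uv_disc : braid_on k n (u ++ v).
Proof. by move=> c; rewrite cat_take_drop; apply: mem_twist_word. Qed.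

(** The convergent ingredients of [visits_bulk] at the [r]-th crossing of a full
    twist: visits without averaging, averaged at the bottom, at the top, and on
    both sides. *)
Definition inner_visits t (p c : bool) : ratfun := burau_act T v (Hact t (burau_act T u (dirac _ (pos c)))) (pos p).
Definition exit_visits t (p : bool) : ratfun := burau_act T v (Hact t (fun=> 1)) (pos p).
Definition entry_visits t (c : bool) : ratfun := mean T k n (Hact t (burau_act T u (dirac _ (pos c)))).
Definition mean_visits t : ratfun := mean T k n (Hact t (fun=> 1)).
Definition stat_at (c : bool) : ratfun := if c then T * stat T n (q - k) else stat T n (q - k).

Lemma stat_atE c : stat T n (pos c - k) = stat_at c.
Proof.
have /andP [h _] := q_disc; case: c => //; rewrite /pos /stat_at subSn // /stat exprS.
by rewrite -mulrA.
Qed.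

Definition block_coefs t (e : nat * nat) : ratfun :=
  coefs T (fun p c => stat_at c * mean_visits t) (fun p c => entry_visits t c - stat_at c * mean_visits t)
    (fun p c => stat_at c * (exit_visits t p - mean_visits t))
    (fun p c => inner_visits t p c - stat_at c * exit_visits t p - entry_visits t c + stat_at c * mean_visits t) e.

Lemma twists_split t a : (a < t)%N ->
  [/\ nth 0%N (w t) (a * Lw + r) = q, take (a * Lw + r) (w t) = w a ++ u,
      drop (a * Lw + r) (w t) = v ++ w (t.-1 - a) & (a * Lw + r < size (w t))%N].
Proof.
move=> at_; have e : t = (a + (t.-1 - a).+1)%N by lia.
have sz : size (w a) = (a * Lw)%N by apply: size_twists.
have nl : (a * Lw + r < a * Lw)%N = false by lia.
have rtw : (r < size tw)%N by rewrite size_twist_word.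
rewrite {1 2 3}e twistsD twistsS nth_cat take_cat drop_cat sz nl addKn.
rewrite nth_cat take_cat drop_cat rtw; split => //.
rewrite size_twists; apply: (@leq_trans (a.+1 * Lw)); last by rewrite leq_mul2r at_ orbT.
by rewrite mulSn addnC ltn_add2r.
Qed.

Lemma R1_term_block t a : (a < t)%N ->
  R1_term t (K t) (l1 + (a * Lw + r))%N =
  - (1 / 2%:R) + \sum_(e <- exponents)
    block_coefs t e * (T ^+ (n * a) ^+ e.1 * T ^+ (n * (t.-1 - a)) ^+ e.2).
Proof.
move=> at_; have [enth etake edrop mL] := twists_split at_.
have E : crossing_at (K t) (l1 + (a * Lw + r))%N =
   Some (1%:Z, ((l1 + (a * Lw + r))%N, pos false), ((l1 + (a * Lw + r))%N, pos true)).
  by rewrite crossing_at_K_mid // enth.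
rewrite /R1_term E (R1_green (family_knot t) E) expr1z.
have G p c : green (K t) T ((l1 + (a * Lw + r))%N, pos p) ((l1 + (a * Lw + r))%N, pos c) =
   (p == c)%:R + (T ^+ (n * a) * T ^+ (n * (t.-1 - a)) * inner_visits t p c
   + T ^+ (n * (t.-1 - a)) * (1 - T ^+ (n * a)) * stat_at c * exit_visits t p
   + (1 - T ^+ (n * (t.-1 - a))) * T ^+ (n * a) * entry_visits t c
   + (1 - T ^+ (n * (t.-1 - a))) * (1 - T ^+ (n * a)) * stat_at c * mean_visits t).
  rewrite (green_mid D0_knot disc_up (@w_disc t) (@w_pure t) (unit_Kt t) mL (pos_disc c) (pos_disc p)).
  rewrite etake edrop (visits_bulk uv_disc t a _ (pos_disc p) (pos_disc c)) stat_atE.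
  congr (_ + _); congr (_%:R); case: p; case: c; rewrite /pos ?eqxx //; lia.
rewrite !G /= !add0r.
exact: (R1_of_bulk T (stat T n (q - k)) (mean_visits t) (T ^+ (n * a)) (T ^+ (n * (t.-1 - a)))
   (entry_visits t) (exit_visits t) (inner_visits t)).
Qed.

Lemma conv_block_coefs e : conv (fun t => block_coefs t e).
Proof.
have u_disc : braid_on k n u.
  by move=> c cu; apply: uv_disc; rewrite mem_cat cu.
have v_disc : braid_on k n v.
  by move=> c cv; apply: uv_disc; rewrite mem_cat cv orbT.
have cK p c : conv (fun t => inner_visits t p c).
  by apply: conv_burau_act => // [z hz|]; [apply: conv_return_act | apply: pos_disc].
have cV p : conv (fun t => exit_visits t p).
  by apply: conv_burau_act => // [z hz|]; [apply: conv_return_act | apply: pos_disc].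
have cW c : conv (fun t => entry_visits t c) by apply: conv_mean => p hp; apply: conv_return_act.
have ch : conv mean_visits by apply: conv_mean => p hp; apply: conv_return_act.
have cP c : conv (fun=> stat_at c) by apply: conv_const.
apply: (@conv_coefs (fun t p c => stat_at c * mean_visits t) (fun t p c => entry_visits t c - stat_at c * mean_visits t)
  (fun t p c => stat_at c * (exit_visits t p - mean_visits t))
  (fun t p c => inner_visits t p c - stat_at c * exit_visits t p - entry_visits t c + stat_at c * mean_visits t)) => p c.
- exact: convM.
- by apply: convB => //; apply: convM.
- by apply: convM => //; apply: convB.
by apply: convD; [apply: convB => //; apply: convB => // | ]; apply: convM.
Qed.

Lemma conv_block :
  conv (fun t => \sum_(a < t) (R1_term t (K t) (l1 + (a * Lw + r))%N + 1 / 2%:R)).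
Proof.
apply: (@conv_ext (fun t => \sum_(e <- exponents) block_coefs t e *
    \sum_(a < t) T ^+ (n * a) ^+ e.1 * T ^+ (n * (t.-1 - a)) ^+ e.2)).
  move=> t; under [RHS]eq_bigr => a _ do rewrite R1_term_block // addrAC addNr add0r.
  rewrite exchange_big /=; apply: eq_bigr => e _.
  by rewrite mulr_sumr.
apply: conv_sum => e ee; apply: convM; first exact: conv_block_coefs.
apply: conv_geometric => //; move: ee; rewrite /exponents !inE.
by do 7 ![case/orP => [/eqP -> //|]]; move/eqP ->.
Qed.

End Block.

(** Each of the [t n (n - 1)] crossings of the twists contributes [- 1 / 2] up to
    terms with a convergent sum, and the rest of the diagram only sees the
    converging coupon. *)
Lemma R1_minus_turning :
  exists2 gam, conv gam & forall t,
    \sum_(c <- crossings (K t)) R1 (K t) c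
      - \sum_(i < num_strands (K t))
           ((half_turns (K t) i)%:~R / 2%:R) * (g (K t) i i - 1 / 2%:R)
    = gam t - t%:R * (Lw%:R / 2%:R).
Proof.
pose inner t : ratfun :=
  \sum_(r <- enum 'I_Lw) \sum_(a < t) (R1_term t (K t) (l1 + (a * Lw + r))%N + 1 / 2%:R).
pose outer t := \sum_(l <- iota 0 (size D0)) R1_out t l.
pose turn t : ratfun := \sum_(z <- points D0)
     ((step D0 z).2)%:~R / 2%:R * (Gt t z z - 1 / 2%:R).
exists (fun t => outer t + inner t - turn t).
  apply: convB; last exact: conv_turning.
  apply: convD; first exact: conv_R1_out.
  by apply: conv_sum => r _; apply: conv_block.
move=> t; rewrite (turning_sum (family_knot t)) turning_family -/(turn t).
rewrite R1_sum_split -/(outer t).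
have -> : \sum_(m < size (w t)) R1_term t (K t) (l1 + m)%N = inner t - t%:R * (Lw%:R / 2%:R).
  rewrite size_twists (big_blocks (fun m => R1_term t (K t) (l1 + m)%N)) exchange_big /=.
  rewrite /inner big_enum /= -[LHS](addrK (t%:R * (Lw%:R / 2%:R))); congr (_ - _).
  have -> : t%:R * (Lw%:R / 2%:R) = \sum_(r < Lw) \sum_(a < t) (1 / 2%:R) :> ratfun.
    by rewrite sum_halves.
  by rewrite -big_split /=; apply: eq_bigr => r _; rewrite -big_split.
by move: (outer t) (inner t) (turn t) (t%:R * _) => x y z b; ring.
Qed.

(** ** The limit *)

Definition limit_of (m0 : int) : ratfun :=
  - ((T ^ m0 * delta_lim) ^+ 2 * (Lw%:R / 2%:R)).

(** By the product rule the increment of [t * q t] is [q t.+1 + t * (q t.+1 - q t)],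
    and T-adic convergence of [q] is fast enough to kill the last term. *)
Lemma tends_increments (q gam : nat -> ratfun) ql c :
  tends q ql -> conv gam ->
  tends (fun t => q t.+1 * (gam t.+1 - t.+1%:R * c) - q t * (gam t - t%:R * c))
        (- (ql * c)).
Proof.
move=> qq [gl gg].
have qg : tends (fun t => q t * gam t) (ql * gl) := tendsM qq gg.
have dq : tends (fun t => q t.+1 - q t) 0.
  by rewrite -(subrr ql); apply: tendsB => //; apply: tends_shift.
have -> : - (ql * c) = (ql * gl - ql * gl) - (ql + 0) * c.
  by rewrite subrr addr0 sub0r.
apply: (@tends_ext (fun t => (q t.+1 * gam t.+1 - q t * gam t)
   - (q t.+1 + t%:R * (q t.+1 - q t)) * c)).
  move=> t; rewrite -[t.+1%:R]natr1; move: (q t) (q t.+1) (gam t) (gam t.+1) (t%:R) => a b x y z.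
  ring.
apply: tendsB; first exact: (tendsB (tends_shift qg) qg).
apply: tendsM (tends_const c); apply: tendsD; first exact: tends_shift.
exact: tends_natmul dq.
Qed.

Lemma family_limit (rho d : nat -> laurent) :
  (forall t, perturbed_alexander (K t) (rho t)) ->
  (forall t, ratfun_of (d t) = T ^+ (t * n * (n - 1)) *
     (T ^+ (n * (n - 1)) * ratfun_of (rho t.+1) - ratfun_of (rho t))) ->
  exists m0, tends (fun t => ratfun_of (d t)) (limit_of m0).
Proof.
move=> hrho hd.
have [m0 hm0] : exists m0 : int, forall t p, symmetrized_alexander (K t) p ->
    T ^+ (t * n * (n - 1)) * ratfun_of p ^+ 2 = (T ^ m0 * delta t) ^+ 2.
  by apply: alexander_square; have [Delta hD _] := hrho 0%N; exists Delta.
have [gam cg hg] := R1_minus_turning.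
pose c : ratfun := Lw%:R / 2%:R.
pose q t : ratfun := (T ^ m0 * delta t) ^+ 2.
have hF t : T ^+ (t * n * (n - 1)) * ratfun_of (rho t) = q t * (gam t - t%:R * c).
  have [Delta hD ->] := hrho t.
  by rewrite hg mulrA (hm0 t Delta hD).
exists m0; rewrite /limit_of -/c.
have tq : tends q ((T ^ m0 * delta_lim) ^+ 2).
  by apply: tendsX; apply: tendsM; [exact: tends_const | exact: tends_delta].
apply: tends_ext (tends_increments c tq cg) => t.
rewrite hd -!hF mulrBr mulrA -exprD; congr (T ^+ _ * _ - _).
by rewrite -!mulnA mulSn addnC.
Qed.

Lemma hv_limit_of m0 :
  has_value (limit_of m0) 1 (- ((n%:R - 1) / (2%:R * n%:R))).
Proof.
have -> : - ((n%:R - 1) / (2%:R * n%:R)) =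
    - ((1 * n%:R^-1) ^+ 2 * (Lw%:R / 2%:R)) :> rat.
  have nz : n%:R != 0 :> rat by rewrite pnatr_eq0 -lt0n.
  have -> : Lw%:R = n%:R * (n%:R - 1) :> rat.
    by rewrite natrM -subn1 natrB.
  by move: n%:R nz => N nz; field.
apply: hvN; apply: hvM.
  apply: hvX; apply: hvM hv_delta_lim; exact: jet1_value (jet1_exprz m0).
apply: hvM; first exact: hv_nat.
by apply: hvV; [exact: hv_nat | rewrite pnatr_eq0].
Qed.

End Family.

(** Laurent polynomials with integer coefficients have integer values at one,
    whereas [0 < (n - 1) / (2 n) < 1]. *)
Lemma not_laurent (n : nat) (f : ratfun) (p : laurent) : (2 <= n)%N ->
  has_value f 1 (- ((n%:R - 1) / (2%:R * n%:R))) -> f <> ratfun_of p.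
Proof.
move=> hn hf fp; have [z hz] := laurent_value_int p.
rewrite -fp in hz; have e := hv_uniq hz hf.
have nz : n%:R != 0 :> rat by rewrite pnatr_eq0; lia.
have : z%:~R * (2%:R * n%:R) = - (n%:R - 1) :> rat.
  by rewrite e mulNr divfK // mulf_neq0 // pnatr_eq0.
have -> : z%:~R * (2%:R * n%:R) = (z * (2 * n)%N%:Z)%:~R :> rat.
  by rewrite intrM -natrM.
have -> : - (n%:R - 1) = (- (n%:Z - 1))%:~R :> rat by rewrite intrN intrB.
move=> /eqP; rewrite eqr_int => /eqP {}e.
have [z0|z0|z0] := ltgtP z 0.
- have : (z + 1) * (2 * n)%N%:Z <= 0 by apply: mulr_le0_ge0; lia.
  rewrite mulrDl e; lia.
- have : 0 <= z * (2 * n)%N%:Z by apply: mulr_ge0; lia.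
  rewrite e; lia.
by move: e; rewrite z0 mul0r; lia.
Qed.

Theorem theorem1p1 (n : nat) (hn : (2 <= n)%N)
    (K : nat -> diagram) (hK : twisted_family n K)
    (rho : nat -> laurent) (hrho : forall t, perturbed_alexander (K t) (rho t))
    (d : nat -> laurent)
    (hd : forall t : nat, ratfun_of (d t) =
       T ^+ (t * n * (n - 1)) *
       (T ^+ (n * (n - 1)) * ratfun_of (rho t.+1) - ratfun_of (rho t))) :
  stabilizes_positively d /\
  exists (s : int -> int) (f : ratfun),
    [/\ positive_limit d s,
        laurent_expansion f s,
        forall p : laurent, f <> ratfun_of p
      & has_value f 1 ((n%:R - 1) / (2%:R * n%:R))
        \/ has_value f 1 (- ((n%:R - 1) / (2%:R * n%:R)))].
Proof.
have [D1 [D2 [k [D_knot disc Kt]]]] := hK.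
have n0 : (0 < n)%N by apply: leq_trans hn.
have hrho' t : perturbed_alexander (D1 ++ braid (twists k n t) ++ D2) (rho t).
  by have := hrho t; rewrite Kt full_twistsE.
have [m0 lim] := family_limit n0 D_knot disc hrho' hd.
split; first exact: stabilizes_of_tends lim.
have [s pos expn] := limit_of_tends lim.
have val := hv_limit_of n0 D_knot disc m0.
exists s, (limit_of n D1 D2 k m0); split => //; last by right.
by move=> p; apply: not_laurent hn val.
Qed.
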